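(* Let $(A,\le_A)$ and $(A',\le_{A'})$ be quasi-hereditary $k$-algebras with exact Borel subalgebras $B\subseteq A$ and $B'\subseteq A'$, and suppose that $B$ and $B'$ are regular. Consider the exact Borel subalgebra $B\otimes_k B'$ of $A\otimes_k A'$, where $A\otimes_k A'$ carries the product order. Then the following statements are equivalent: (1) $B\otimes_k B'$ is regular. (2) $B\otimes_k B'$ is homological. (3) One of the following statements holds: (a) $A$ and $A'$ are directed; (b) $A^{\mathrm{op}}$ and $(A')^{\mathrm{op}}$ are directed; (c) $A$ is semisimple; (d) $A'$ is semisimple.
   Context: Conventions: $k$ is an algebraically closed field; all algebras are nonzero finite-dimensional associative unital $k$-algebras, subalgebras contain the unit, and modules are finitely generated left modules unless stated otherwise. $\operatorname{Sim}(A)$ is a set of representatives of the isomorphism classes of simple $A$-modules, and $P(L)$ is the projective cover of $L$. Quasi-hereditary algebras: for a partial order $\le_A$ on $\operatorname{Sim}(A)$ and $L\in\operatorname{Sim}(A)$, the standard module is $\Delta(L)=P(L)/\sum_{L'\not\le_A L,\ f\in\operatorname{Hom}_A(P(L'),P(L))}\operatorname{im}(f)$. The pair $(A,\le_A)$ is quasi-hereditary if for every $L\in \operatorname{Sim}(A)$ one has $\operatorname{End}_A(\Delta(L))\cong k$ and the kernel of $P(L)\to\Delta(L)$ has a finite filtration whose subquotients are isomorphic to standard modules $\Delta(L')$ with $L'>_A L$. It is called directed if it is quasi-hereditary and all standard modules are simple. If $(A,\le_A)$ is quasi-hereditary, then $A^{\mathrm{op}}$ is regarded as a quasi-hereditary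 algebra with the order on $\operatorname{Sim}(A^{\mathrm{op}})$ induced by the bijection $L\mapsto\operatorname{Hom}_k(L,k)$. Exact Borel subalgebra: a subalgebra $B$ of a quasi-hereditary algebra $(A,\le_A)$ is an exact Borel subalgebra if (1) $A$ is projective as a right $B$-module; (2) there is a bijection $\phi:\operatorname{Sim}(B)\to\operatorname{Sim}(A)$ with $A\otimes_B L\cong\Delta(\phi(L))$ for all $L\in\operatorname{Sim}(B)$; (3) $(B,\le_B)$ is directed, where $L\le_B L'$ if and only if $\phi(L)\le_A\phi(L')$. Regular and homological: put $L^B=\bigoplus_{L\in\operatorname{Sim}(B)}L$ and $\Delta^A=A\otimes_B L^B\cong\bigoplus_{L\in\operatorname{Sim}(A)}\Delta(L)$. The exact functor $A\otimes_B-$ induces maps $\operatorname{Ext}^n_B(L^B,L^B)\to\operatorname{Ext}^n_A(\Delta^A,\Delta^A)$, $[f]\mapsto[\mathrm{id}_A\otimes_B f]$. The exact Borel subalgebra $B$ is regular if these are isomorphisms for all $n\ge1$; it is homological if the map is an epimorphism for $n=1$ and an isomorphism for all $n\ge2$. Product order: the simple $A\otimes_k A'$-modules are the modules $L\otimes_k L'$ with $L\in \operatorname{Sim}(A)$, $L'\in\operatorname{Sim}(A')$; set $L_1\otimes L_1'\le L_2\otimes L_2'$ if and only if $L_1\le_A L_2$ and $L_1'\le_{A'}L_2'$. With this order $A\otimes_k A'$ is quasi-hereditary and $B\otimes_k B'$ is an exact Borel subalgebra of it. *)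

(* Defs.v *)
From HB Require Import structures.
From mathcomp Require Import all_boot all_order all_algebra falgebra.

Set Implicit Arguments.
Unset Strict Implicit.
Unset Printing Implicit Defensive.

Import GRing.Theory.

Local Open Scope ring_scope.

Reserved Notation "a ∙ x" (at level 40, left associativity).
Reserved Notation "v ⊗ w" (at level 40, left associativity).

(* The opposite algebra of A is the converse ring A^c; MathComp only provides
   its ring structure. *)
Section OppositeAlgebra.

Variables (k : fieldType) (A : falgType k).

HB.instance Definition _ := GRing.Zmodule_isLmodule.Build k A^c
  (@scalerA k A) (@scale1r k A) (@scalerDr k A) (fun v a b => @scalerDl k A v a b).

Fact opp_vect_axiom : Vector.axiom (\dim {:A}) A^c.
Proof.
exists (passmx.rVof (vbasis {:A}) : A -> _); first exact: passmx.rVof_linear.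
have eA := vbasisP {:A}.
exact: Bijective (passmx.rVofK eA) (passmx.vecofK eA).
Qed.

HB.instance Definition _ := Lmodule_hasFinDim.Build k A^c opp_vect_axiom.

Fact opp_scaleAl (c : k) (x y : A^c) : c *: (x * y) = (c *: x) * y.
Proof. exact: (scalerAr c (y : A) (x : A)). Qed.

HB.instance Definition _ := GRing.Lmodule_isLalgebra.Build k A^c opp_scaleAl.

Fact opp_scaleAr (c : k) (x y : A^c) : c *: (x * y) = x * (c *: y).
Proof. exact: (scalerAl c (y : A) (x : A)). Qed.

HB.instance Definition _ := GRing.Lalgebra_isAlgebra.Build k A^c opp_scaleAr.

End OppositeAlgebra.

(* Over a finite-dimensional algebra, finitely generated left modules are the
   same as finite-dimensional ones.  The zero module is allowed. *)
Record fmod (k : fieldType) (A : falgType k) := Fmod {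
  fmod_car :> vectType k;
  act : A -> fmod_car -> fmod_car;
  act_linear : forall a, linear (act a);
  act_linear_l : forall x, linear (act^~ x);
  act1 : forall x, act 1 x = x;
  actM : forall a b x, act (a * b) x = act a (act b x)
}.

Notation "a ∙ x" := (act a x) : ring_scope.

Section Modules.

Variables (k : fieldType) (A : falgType k).
Implicit Types (M N P Q D L : fmod A).

Lemma actDr M a (x y : M) : a ∙ (x + y) = a ∙ x + a ∙ y.
Proof. by have := act_linear a 1 x y; rewrite !scale1r. Qed.

Lemma actDl M a b (x : M) : (a + b) ∙ x = a ∙ x + b ∙ x.
Proof. by have := act_linear_l x 1 a b; rewrite !scale1r. Qed.

Lemma act0r M a : a ∙ (0 : M) = 0.
Proof. by apply: (addrI (a ∙ 0)); rewrite -actDr !addr0. Qed.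

Lemma act0l M (x : M) : 0 ∙ x = 0.
Proof. by apply: (addrI (0 ∙ x)); rewrite -actDl !addr0. Qed.

Lemma actZr M a c (x : M) : a ∙ (c *: x) = c *: (a ∙ x).
Proof. by have := act_linear a c x 0; rewrite act0r !addr0. Qed.

Lemma actZl M c a (x : M) : (c *: a) ∙ x = c *: (a ∙ x).
Proof. by have := act_linear_l x c a 0; rewrite act0l !addr0. Qed.

Lemma actBr M a (x y : M) : a ∙ (x - y) = a ∙ x - a ∙ y.
Proof. by rewrite -scaleN1r actDr actZr scaleN1r. Qed.

Definition mlinear M N (f : 'Hom(M, N)) : Prop :=
  forall a x, f (a ∙ x) = a ∙ f x.

Definition miso M N : Prop := exists2 f : 'Hom(M, N), mlinear f & bijective f.

Definition submod M (U : {vspace M}) : Prop :=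
  forall a x, x \in U -> a ∙ x \in U.

Definition simple M : Prop :=
  (fullv != 0%VS :> {vspace M}) /\
  forall U : {vspace M}, submod U -> U = 0%VS \/ U = fullv.

Definition projective P : Prop :=
  forall M N (g : 'Hom(M, N)) (h : 'Hom(P, N)),
    mlinear g -> limg g = fullv -> mlinear h ->
    exists2 l : 'Hom(P, M), mlinear l & h = (g \o l)%VF.

(* p : P -> L is an essential epimorphism from a projective module. *)
Definition projective_cover P L (p : 'Hom(P, L)) : Prop :=
  [/\ projective P, mlinear p, limg p = fullv
    & forall U : {vspace P}, submod U -> (p @: U)%VS = fullv -> U = fullv].

(* The k-algebra End_A(D) of all A-linear endomorphisms is isomorphic to k. *)
Definition end_iso_field D : Prop :=
  exists g : {linear k^o -> 'End(D)},
    [/\ injective g, g 1 = \1%VF, forall c d, g (c * d) = (g c \o g d)%VF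
      & forall f : 'End(D), mlinear f <-> exists c, f = g c].

Fact regular_act_linear (a : A) : linear (fun x : A => a * x).
Proof. by move=> c x y; rewrite mulrDr scalerAr. Qed.

Fact regular_act_linear_l (x : A) : linear (fun a : A => a * x).
Proof. by move=> c a b; rewrite mulrDl scalerAl. Qed.

Definition regular_mod : fmod A :=
  Fmod regular_act_linear regular_act_linear_l (@mul1r A)
       (fun a b x => esym (mulrA a b x)).

(* Quotient modules: the quotient space M / U is realised on the complement
   U^C, with quo_pi the projection along U. *)
Section Quotient.

Variables (M : fmod A) (U : {vspace M}).

Definition quo : vectType k := subvs_of (U^C)%VS.

Definition quo_pi : 'Hom(M, quo) := linfun (vsproj (U^C)%VS \o daddv_pi (U^C) U).

Definition quo_val : 'Hom(quo, M) := linfun vsval.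

Let dxU : (U^C :&: U = 0)%VS. Proof. by rewrite capvC capv_compl. Qed.
Let dxU' : (U :&: U^C = 0)%VS. Proof. by rewrite capv_compl. Qed.

Lemma quo_piE x : quo_pi x = vsproj (U^C)%VS (daddv_pi (U^C) U x).
Proof. by rewrite lfunE. Qed.

Lemma quo_valK : cancel quo_val quo_pi.
Proof.
move=> y; rewrite quo_piE lfunE /= daddv_pi_id ?vsvalK //; exact: subvsP.
Qed.

Lemma quo_val_pi x : quo_val (quo_pi x) - x \in U.
Proof.
rewrite quo_piE lfunE /= vsprojK ?memv_pi //.
rewrite -{2}[x](@daddv_pi_add _ _ (U^C)%VS U x) //; last first.
  by rewrite addvC addv_complf memvf.
by rewrite opprD addNKr memvN memv_pi.
Qed.

Lemma quo_pi_eq0 x : (quo_pi x == 0) = (x \in U).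
Proof.
apply/eqP/idP=> [x0 | Ux].
  by have := quo_val_pi x; rewrite x0 linear0 sub0r memvN.
have: quo_val (quo_pi x) \in (U :&: U^C)%VS.
  rewrite memv_cap; apply/andP; split.
    by rewrite -(subrK x (quo_val _)) memvD ?quo_val_pi.
  by rewrite lfunE /=; apply: subvsP.
by rewrite dxU' memv0 => /eqP q0; rewrite -[LHS]quo_valK q0 linear0.
Qed.

Hypothesis sU : submod U.

Definition quo_act (a : A) (y : quo) : quo := quo_pi (a ∙ quo_val y).

Lemma quo_act_pi a x : quo_act a (quo_pi x) = quo_pi (a ∙ x).
Proof.
apply/eqP; rewrite -subr_eq0 /quo_act -linearB quo_pi_eq0 -actBr.
by rewrite sU ?quo_val_pi.
Qed.

Fact quo_act_linear a : linear (quo_act a).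
Proof. by move=> c x y; rewrite /quo_act linearP actDr actZr linearP. Qed.

Fact quo_act_linear_l x : linear (quo_act^~ x).
Proof. by move=> c a b; rewrite /quo_act actDl actZl linearP. Qed.

Fact quo_act1 x : quo_act 1 x = x.
Proof. by rewrite /quo_act act1 quo_valK. Qed.

Fact quo_actM a b x : quo_act (a * b) x = quo_act a (quo_act b x).
Proof. by rewrite [quo_act b x]/quo_act quo_act_pi -actM. Qed.

Definition quo_mod : fmod A :=
  Fmod quo_act_linear quo_act_linear_l quo_act1 quo_actM.

End Quotient.

Fact zero_act_linear (a : A) : linear (fun x : 'rV[k]_0 => x).
Proof. by []. Qed.

Fact zero_act_linear_l (x : 'rV[k]_0) : linear (fun a : A => x).
Proof. by move=> c a b; rewrite [LHS]thinmx0 [RHS]thinmx0. Qed.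

Definition zero_mod : fmod A :=
  @Fmod k A 'rV[k]_0 (fun _ x => x) zero_act_linear zero_act_linear_l
    (fun _ => erefl) (fun _ _ _ => erefl).

Section DirectSum.

Variables M N : fmod A.

Definition dsum_act (a : A) (x : M * N) : M * N := (a ∙ x.1, a ∙ x.2).

Fact dsum_act_linear a : linear (dsum_act a).
Proof.
by move=> c x y; rewrite /dsum_act /= !actDr !actZr.
Qed.

Fact dsum_act_linear_l x : linear (dsum_act^~ x).
Proof. by move=> c a b; rewrite /dsum_act !actDl !actZl. Qed.

Fact dsum_act1 x : dsum_act 1 x = x.
Proof. by case: x => x y; rewrite /dsum_act !act1. Qed.

Fact dsum_actM a b x : dsum_act (a * b) x = dsum_act a (dsum_act b x).
Proof. by rewrite /dsum_act !actM. Qed.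

Definition dsum : fmod A :=
  @Fmod k A (M * N)%type dsum_act
    dsum_act_linear dsum_act_linear_l dsum_act1 dsum_actM.

End DirectSum.

Definition semisimple M : Prop :=
  exists n (L : 'I_n -> fmod A),
    (forall t, simple (L t)) /\ miso M (\big[dsum/zero_mod]_(t < n) L t).

(* The family S indexed by I is a version of Sim(A). *)
Definition is_Sim (I : finType) (S : I -> fmod A) : Prop :=
  [/\ forall i, simple (S i),
      forall i j, miso (S i) (S j) -> i = j
    & forall L, simple L -> exists i, miso L (S i)].

(* Orders on Sim(A) are given on the index type I. *)
Section QuasiHereditary.

Variables (I : finType) (S : I -> fmod A) (le : rel I).

(* U is the sum of the images of all f : P(S j) -> P with ~~ le j i, that is
   the least subspace containing them. *)
Definition is_trace (i : I) P (U : {vspace P}) : Prop :=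
  let contains_images (W : {vspace P}) :=
    forall (j : I) Q (q : 'Hom(Q, S j)) (f : 'Hom(Q, P)),
      ~~ le j i -> projective_cover q -> mlinear f -> (limg f <= W)%VS in
  contains_images U /\ forall W, contains_images W -> (U <= W)%VS.

(* D is isomorphic to Delta(S i). *)
Definition is_standard (i : I) D : Prop :=
  exists P (p : 'Hom(P, S i)) (U : {vspace P}) (sU : submod U),
    [/\ projective_cover p, is_trace i U & miso D (quo_mod sU)].

(* For submodules U <= V of M, the subquotient V / U is isomorphic to D. *)
Definition subquotient_iso M (V U : {vspace M}) D : Prop :=
  exists g : 'Hom(M, D),
    [/\ forall a x, x \in V -> g (a ∙ x) = a ∙ g x,
        (g @: V)%VS = fullv & (V :&: lker g)%VS = U].

Definition quasi_hereditary : Prop :=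
  [/\ reflexive le, antisymmetric le, transitive le
    & forall i, exists P (p : 'Hom(P, S i)) (U : {vspace P}) (sU : submod U),
      [/\ projective_cover p, is_trace i U, end_iso_field (quo_mod sU)
        & exists (m : nat) (F : nat -> {vspace P}),
          [/\ F 0%N = 0%VS, F m = U,
              forall t, (t <= m)%N -> submod (F t)
            & forall t, (t < m)%N -> (F t <= F t.+1)%VS /\
                exists j D, [/\ le i j, j != i, is_standard j D
                              & subquotient_iso (F t.+1) (F t) D]]]].

Definition directed : Prop :=
  quasi_hereditary /\ forall i D, is_standard i D -> simple D.

End QuasiHereditary.

Definition projective_resolution M (P : nat -> fmod A)
    (d : forall n, 'Hom(P n.+1, P n)) (e : 'Hom(P 0%N, M)) : Prop :=
  [/\ forall n, projective (P n), forall n, mlinear (d n), mlinear e,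
      limg e = fullv
    & limg (d 0%N) = lker e /\ forall n, limg (d n.+1) = lker (d n)].

(* Ext^n_A(M, N) is the quotient of the cocycles f : P_n -> N by the
   coboundaries, for a projective resolution P of M. *)
Section Cochains.

Variables (N : fmod A) (P : nat -> fmod A) (d : forall n, 'Hom(P n.+1, P n)).

Definition cocycle n (f : 'Hom(P n, N)) : Prop :=
  mlinear f /\ (f \o d n = 0)%VF.

Definition coboundary n : 'Hom(P n, N) -> Prop :=
  match n with
  | 0 => fun f => f = 0
  | m.+1 => fun f => exists2 g : 'Hom(P m, N), mlinear g & f = (g \o d m)%VF
  end.

End Cochains.

End Modules.

Arguments zero_mod {k A}.

(* Hom_k(M, k), as a module over the opposite algebra *)
Section Dual.

Variables (k : fieldType) (A : falgType k) (M : fmod A).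

Fact act_is_linear (a : A) : linear (act (f := M) a).
Proof. exact: act_linear. Qed.

HB.instance Definition _ (a : A) :=
  GRing.isSemilinear.Build k M M _ (act (f := M) a)
    (GRing.semilinear_linear (act_is_linear a)).

Definition dual_act (a : A^c) (f : 'Hom(M, k^o)) : 'Hom(M, k^o) :=
  (f \o linfun (act (f := M) a))%VF.

Lemma dual_actE a f x : dual_act a f x = f ((a : A) ∙ x).
Proof. by rewrite comp_lfunE lfunE. Qed.

Fact dual_act_linear a : linear (dual_act a).
Proof.
move=> c f g; apply/lfunP=> x.
by rewrite add_lfunE scale_lfunE !dual_actE add_lfunE scale_lfunE.
Qed.

Fact dual_act_linear_l f : linear (dual_act^~ f).
Proof.
move=> c a b; apply/lfunP=> x; rewrite add_lfunE scale_lfunE !dual_actE.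
by rewrite -linearP -actZl -actDl.
Qed.

Fact dual_act1 f : dual_act 1 f = f.
Proof. by apply/lfunP=> x; rewrite dual_actE act1. Qed.

Fact dual_actM a b f : dual_act (a * b) f = dual_act a (dual_act b f).
Proof. by apply/lfunP=> x; rewrite !dual_actE actM. Qed.

Definition dual_mod : fmod A^c :=
  Fmod dual_act_linear dual_act_linear_l dual_act1 dual_actM.

End Dual.

(* V ⊗_k W for vector spaces, realised as matrices of coordinates in fixed
   bases of V and W. *)
Section TensorSpace.

Variables (k : fieldType) (V W : vectType k).

Definition tens := 'M[k]_(\dim {:V}, \dim {:W}).

HB.instance Definition _ := Vector.copy tens 'M[k]_(\dim {:V}, \dim {:W}).

Definition pure (v : V) (w : W) : tens :=
  \matrix_(i, j) (coord (vbasis {:V}) i v * coord (vbasis {:W}) j w).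

(* The linear map on V ⊗ W extending a bilinear map b. *)
Definition tlift (U : vectType k) (b : V -> W -> U) (x : tens) : U :=
  \sum_i \sum_j x i j *: b (vbasis {:V})`_i (vbasis {:W})`_j.

End TensorSpace.

Notation "v ⊗ w" := (pure v w) : ring_scope.

Section TensorSpaceTheory.

Variables (k : fieldType) (V W : vectType k).

Lemma pure_linear_r (v : V) : linear (@pure k V W v).
Proof.
by move=> c w w'; apply/matrixP=> i j; rewrite !mxE linearP mulrDr mulrCA.
Qed.

Lemma pure_linear_l (w : W) : linear ((@pure k V W)^~ w).
Proof.
by move=> c v v'; apply/matrixP=> i j; rewrite !mxE linearP mulrDl mulrA.
Qed.

Fact tlift_is_linear (U : vectType k) (b : V -> W -> U) : linear (tlift b).
Proof.
move=> c x y; rewrite /tlift scaler_sumr -big_split /=; apply: eq_bigr => i _.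
rewrite scaler_sumr -big_split /=; apply: eq_bigr => j _.
by rewrite !mxE scalerDl scalerA.
Qed.

HB.instance Definition _ (U : vectType k) (b : V -> W -> U) :=
  GRing.isSemilinear.Build k (tens V W) U _ (tlift b)
    (GRing.semilinear_linear (tlift_is_linear b)).

Lemma lin_sum (X Y : lmodType k) (f : X -> Y) (J : finType) (c : J -> k)
  (x : J -> X) : linear f -> f (\sum_j c j *: x j) = \sum_j c j *: f (x j).
Proof.
move=> lf; pose fM := GRing.isLinear.Build _ _ _ _ f lf.
pose fL : {linear X -> Y} := HB.pack f fM.
rewrite -[f]/(fL : X -> Y) linear_sum; apply: eq_bigr => j _; exact: linearZ.
Qed.

Lemma tlift_pure (U : vectType k) (b : V -> W -> U) v w :
  (forall w, linear (b^~ w)) -> (forall v, linear (b v)) ->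
  tlift b (v ⊗ w) = b v w.
Proof.
move=> bl br; rewrite {2}(coord_vbasis (memvf v)) {2}(coord_vbasis (memvf w)).
rewrite (lin_sum _ _ (bl _)); apply: eq_bigr => i _.
rewrite (lin_sum _ _ (br _)) scaler_sumr; apply: eq_bigr => j _.
by rewrite mxE scalerA.
Qed.

Lemma tlift_ext (U : vectType k) (b b' : V -> W -> U) :
  (forall v w, b v w = b' v w) -> tlift b =1 tlift b'.
Proof.
by move=> e x; apply: eq_bigr => i _; apply: eq_bigr => j _; rewrite e.
Qed.

Lemma tlift_pureE (x : tens V W) : tlift (@pure k V W) x = x.
Proof.
apply/matrixP=> i j; rewrite /tlift summxE (bigD1 i) //= summxE (bigD1 j) //=.
rewrite !mxE !coord_free ?(basis_free (vbasisP _)) // !eqxx mulr1 mulr1.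
rewrite big1 => [|j' ne]; last first.
  rewrite !mxE !coord_free ?(basis_free (vbasisP _)) //.
  by rewrite (negPf ne) !mulr0.
rewrite addr0 big1 ?addr0 // => i' ne; rewrite summxE big1 // => j' _.
rewrite !mxE !coord_free ?(basis_free (vbasisP _)) //.
by rewrite (negPf ne) mul0r mulr0.
Qed.

Lemma tens_sum (x : tens V W) :
  x = \sum_i \sum_j x i j *: ((vbasis {:V})`_i ⊗ (vbasis {:W})`_j).
Proof. by rewrite -[LHS]tlift_pureE. Qed.

Lemma tens_ext (U : lmodType k) (f g : tens V W -> U) :
  linear f -> linear g -> (forall v w, f (v ⊗ w) = g (v ⊗ w)) -> f =1 g.
Proof.
move=> lf lg e x; rewrite [x]tens_sum.
have s h: linear h -> h (\sum_i \sum_j x i j *: ((vbasis {:V})`_i ⊗ (vbasis {:W})`_j))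
    = \sum_i \sum_j x i j *: h ((vbasis {:V})`_i ⊗ (vbasis {:W})`_j) :> U.
  move=> lh; have := lin_sum (fun=> 1) (fun i => \sum_j x i j *: ((vbasis {:V})`_i ⊗ (vbasis {:W})`_j)) lh.
  under eq_bigr => i do rewrite scale1r.
  move=> ->; apply: eq_bigr => i _.
  by rewrite scale1r (lin_sum _ _ lh).
by rewrite !s //; apply: eq_bigr => i _; apply: eq_bigr => j _; rewrite e.
Qed.

Lemma pure_neq0 (v : V) (w : W) : v != 0 -> w != 0 -> v ⊗ w != 0.
Proof.
move=> v0 w0; apply/eqP=> /matrixP e.
have nz (X : vectType k) (x : X) : x != 0 ->
    exists i, coord (vbasis {:X}) i x != 0.
  move=> x0; apply/existsP; apply: contraR x0 => /existsPn x0.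
  rewrite (coord_vbasis (memvf x)) big1 // => i _.
  by have /negPn/eqP-> := x0 i; rewrite scale0r.
have [[i vi] [j wj]] := (nz _ _ v0, nz _ _ w0).
have := e i j; rewrite !mxE => /eqP; rewrite mulf_eq0.
by rewrite (negPf vi) (negPf wj).
Qed.

End TensorSpaceTheory.

Lemma tlift_linear_fun (k : fieldType) (V W U : vectType k) (b b' : V -> W -> U)
  (c : k) (x : tens V W) :
  tlift (fun v w => c *: b v w + b' v w) x = c *: tlift b x + tlift b' x.
Proof.
rewrite /tlift scaler_sumr -big_split /=; apply: eq_bigr => i _.
rewrite scaler_sumr -big_split /=; apply: eq_bigr => j _.
by rewrite scalerDr !scalerA mulrC.
Qed.

Section TensorMaps.

Variables (k : fieldType) (V W V' W' U : vectType k).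

(* The bilinear map on (V ⊗ W) x (V' ⊗ W') extending a 4-linear map f. *)
Definition tlift2 (f : V -> W -> V' -> W' -> U) (x : tens V W) (y : tens V' W')
  : U := tlift (fun v w => tlift (f v w) y) x.

Variable f : V -> W -> V' -> W' -> U.

Lemma tlift2_linear_l y : linear ((tlift2 f)^~ y).
Proof. exact: tlift_is_linear. Qed.

Lemma tlift2_linear_r x : linear (tlift2 f x).
Proof.
move=> c y y'; apply: etrans (tlift_linear_fun _ _ _ _).
by apply: tlift_ext => v w; apply: tlift_is_linear.
Qed.

Lemma tlift2_pure v w v' w' :
    (forall w v' w', linear (fun v => f v w v' w')) ->
    (forall v v' w', linear (fun w => f v w v' w')) ->
    (forall v w w', linear (fun v' => f v w v' w')) ->
    (forall v w v', linear (fun w' => f v w v' w')) ->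
  tlift2 f (v ⊗ w) (v' ⊗ w') = f v w v' w'.
Proof.
move=> f1 f2 f3 f4; rewrite /tlift2 tlift_pure ?tlift_pure //.
  move=> w0 c v1 v2; apply: etrans (tlift_linear_fun _ _ _ _); apply: tlift_ext => *; apply: f1.
by move=> v0 c w1 w2; apply: etrans (tlift_linear_fun _ _ _ _); apply: tlift_ext => *; apply: f2.
Qed.

End TensorMaps.

Section TensorAlgebra.

Variables (k : fieldType) (A A' : falgType k).

Definition tens_alg := tens A A'.

HB.instance Definition _ := Vector.copy tens_alg (tens A A').

Definition tens_mul : tens_alg -> tens_alg -> tens_alg :=
  tlift2 (fun (a : A) (a' : A') (b : A) (b' : A') => (a * b) ⊗ (a' * b')).

Definition tens_one : tens_alg := 1 ⊗ 1.

Fact tens_mul_linear_l y : linear (tens_mul^~ y).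
Proof. exact: tlift2_linear_l. Qed.

Fact tens_mul_linear_r x : linear (tens_mul x).
Proof. exact: tlift2_linear_r. Qed.

Fact tens_mul_pure (a b : A) (a' b' : A') :
  tens_mul (a ⊗ a') (b ⊗ b') = (a * b) ⊗ (a' * b').
Proof.
rewrite /tens_mul tlift2_pure // => [w v' w'|v v' w'|v w w'|v w v'] c x y.
- by rewrite mulrDl -scalerAl pure_linear_l.
- by rewrite mulrDl -scalerAl pure_linear_r.
- by rewrite mulrDr -scalerAr pure_linear_l.
by rewrite mulrDr -scalerAr pure_linear_r.
Qed.

Fact tens_mulA : associative tens_mul.
Proof.
move=> x y z.
apply: (tens_ext (f := fun x => tens_mul x _) (g := fun x => tens_mul (tens_mul x _) _)).
- exact: tens_mul_linear_l.
- by move=> c u v; rewrite !tens_mul_linear_l.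
move=> a a'.
apply: (tens_ext (f := fun y => tens_mul _ (tens_mul y _))
                 (g := fun y => tens_mul (tens_mul _ y) _)).
- by move=> c u v; rewrite tens_mul_linear_l tens_mul_linear_r.
- by move=> c u v; rewrite tens_mul_linear_r tens_mul_linear_l.
move=> b b'.
apply: (tens_ext (f := fun z => tens_mul _ (tens_mul _ z))).
- by move=> c u v; rewrite !tens_mul_linear_r.
- exact: tens_mul_linear_r.
by move=> c c'; rewrite !tens_mul_pure !mulrA.
Qed.

Fact tens_mul1l : left_id tens_one tens_mul.
Proof.
apply: (tens_ext (g := id)) => //; first exact: tens_mul_linear_r.
by move=> a a'; rewrite tens_mul_pure !mul1r.
Qed.

Fact tens_mul1r : right_id tens_one tens_mul.
Proof.
apply: (tens_ext (f := tens_mul^~ tens_one) (g := id)) => //.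
  exact: tens_mul_linear_l.
by move=> a a'; rewrite tens_mul_pure !mulr1.
Qed.

Fact tens_mulDl : left_distributive tens_mul +%R.
Proof.
by move=> x y z; have := tens_mul_linear_l z 1 x y; rewrite /= !scale1r.
Qed.

Fact tens_mulDr : right_distributive tens_mul +%R.
Proof.
by move=> x y z; have := tens_mul_linear_r x 1 y z; rewrite /= !scale1r.
Qed.

Fact tens_one_neq0 : tens_one != 0.
Proof. by apply: pure_neq0; apply: oner_neq0. Qed.

HB.instance Definition _ := GRing.Zmodule_isNzRing.Build tens_alg
  tens_mulA tens_mul1l tens_mul1r tens_mulDl tens_mulDr tens_one_neq0.

Fact tens_scaleAl (c : k) (x y : tens_alg) : c *: (x * y) = (c *: x) * y.
Proof.
apply: esym; have := tens_mul_linear_l y c x 0.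
by rewrite /= (mul0r y : tens_mul 0 y = 0) !addr0.
Qed.

HB.instance Definition _ :=
  GRing.Lmodule_isLalgebra.Build k tens_alg tens_scaleAl.

Fact tens_scaleAr (c : k) (x y : tens_alg) : c *: (x * y) = x * (c *: y).
Proof.
apply: esym; have := tens_mul_linear_r x c y 0.
by rewrite /= (mulr0 x : tens_mul x 0 = 0) !addr0.
Qed.

HB.instance Definition _ :=
  GRing.Lalgebra_isAlgebra.Build k tens_alg tens_scaleAr.
HB.instance Definition _ := Algebra_isFalgebra.Build k tens_alg.

Definition tpure (a : A) (a' : A') : tens_alg := a ⊗ a'.

Lemma tpureM a b a' b' : tpure a a' * tpure b b' = tpure (a * b) (a' * b').
Proof. exact: tens_mul_pure. Qed.

Lemma tpure1 : tpure 1 1 = 1. Proof. by []. Qed.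

Section TensorSubalgebra.

Variables (B : {aspace A}) (B' : {aspace A'}).

Definition tens_sub : {vspace tens_alg} :=
  <<[seq tpure b b' | b <- vbasis B, b' <- vbasis B']>>%VS.

Lemma mem_tens_sub b b' : b \in B -> b' \in B' -> tpure b b' \in tens_sub.
Proof.
move=> /coord_vbasis-> /coord_vbasis->; rewrite /tpure.
rewrite (lin_sum _ _ (pure_linear_l _)); apply: memv_suml => i _.
rewrite memvZ // (lin_sum _ _ (pure_linear_r _)); apply: memv_suml => j _.
rewrite memvZ // memv_span //.
by apply/allpairsP; exists ((vbasis B)`_i, (vbasis B')`_j); rewrite !memt_nth.
Qed.

Lemma tens_sub_ind (P : tens_alg -> Prop) :
    P 0 -> (forall x y, P x -> P y -> P (x + y)) ->
    (forall c x, P x -> P (c *: x)) ->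
    (forall b b', b \in B -> b' \in B' -> P (tpure b b')) ->
  forall x, x \in tens_sub -> P x.
Proof.
move=> P0 PD PZ Pp x; rewrite /tens_sub => xS.
rewrite (@coord_span _ _ _ (in_tuple _) x xS).
elim/big_rec: _ => // i y _ Py; apply: PD => //; apply: PZ.
have /allpairsP[[b b'] /= [Bb Bb' ->]] := mem_nth 0 (ltn_ord i).
by apply: Pp; apply: vbasis_mem.
Qed.

Fact tens_sub_is_aspace : is_aspace tens_sub.
Proof.
apply/andP; split.
  apply/has_algidP; exists (tpure (algid B) (algid B')); split.
  - by rewrite mem_tens_sub ?memv_algid.
  - by rewrite pure_neq0 ?algid_neq0.
  apply: tens_sub_ind => [|x y [ex xe] [ey ye]|c x [ex xe]|b b' Bb Bb'].
  - by rewrite mulr0 mul0r.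
  - by rewrite mulrDr mulrDl ex xe ey ye.
  - by rewrite -scalerAr -scalerAl ex xe.
  by rewrite !tpureM !algidl ?algidr.
apply/prodvP=> x y Bx By; move: x Bx.
apply: tens_sub_ind => [|x x' ? ?|c x ?|b b' Bb Bb'].
- by rewrite mul0r mem0v.
- by rewrite mulrDl memvD.
- by rewrite -scalerAl memvZ.
move: y By; apply: tens_sub_ind => [|y y' ? ?|c y ?|d d' Bd Bd'].
- by rewrite mulr0 mem0v.
- by rewrite mulrDr memvD.
- by rewrite -scalerAr memvZ.
by rewrite tpureM mem_tens_sub // (subvP (asubv _)) ?memv_mul.
Qed.

Canonical tens_aspace : {aspace tens_alg} := ASpace tens_sub_is_aspace.

End TensorSubalgebra.

Section TensorModule.

Variables (M : fmod A) (M' : fmod A').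

Definition tens_act : tens_alg -> tens M M' -> tens M M' :=
  tlift2 (fun (a : A) (a' : A') (x : M) (x' : M') => (a ∙ x) ⊗ (a' ∙ x')).

Lemma tens_act_pure a a' (x : M) (x' : M') :
  tens_act (a ⊗ a') (x ⊗ x') = (a ∙ x) ⊗ (a' ∙ x').
Proof.
rewrite /tens_act tlift2_pure // => [w v' w'|v v' w'|v w w'|v w v'] c y z.
- by rewrite actDl actZl pure_linear_l.
- by rewrite actDl actZl pure_linear_r.
- by rewrite actDr actZr pure_linear_l.
by rewrite actDr actZr pure_linear_r.
Qed.

Fact tens_act_linear x : linear (tens_act x).
Proof. exact: tlift2_linear_r. Qed.

Fact tens_act_linear_l y : linear (tens_act^~ y).
Proof. exact: tlift2_linear_l. Qed.

Fact tens_act1 y : tens_act 1 y = y.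
Proof.
move: y; apply: (tens_ext (g := id)) => //; first exact: tens_act_linear.
by move=> x x'; rewrite [LHS]tens_act_pure !act1.
Qed.

Fact tens_actM a b y : tens_act (a * b) y = tens_act a (tens_act b y).
Proof.
change (tens_act (tens_mul a b) y = tens_act a (tens_act b y)).
move: a; apply: (tens_ext (f := fun a => tens_act (tens_mul a b) y)
                          (g := fun a => tens_act a (tens_act b y))).
- by move=> c u v; rewrite tens_mul_linear_l tens_act_linear_l.
- exact: tens_act_linear_l.
move=> a a'; move: b.
apply: (tens_ext (f := fun b => tens_act (tens_mul _ b) y)
                 (g := fun b => tens_act _ (tens_act b y))).
- by move=> c u v; rewrite tens_mul_linear_r tens_act_linear_l.
- by move=> c u v; rewrite tens_act_linear_l tens_act_linear.
move=> b b'; move: y; apply: (tens_ext (g := fun y => tens_act _ (tens_act _ y))).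
- exact: tens_act_linear.
- by move=> c u v; rewrite !tens_act_linear.
by move=> x x'; rewrite tens_mul_pure !tens_act_pure !actM.
Qed.

Definition tens_mod : fmod tens_alg :=
  Fmod tens_act_linear tens_act_linear_l tens_act1 tens_actM.

End TensorModule.

End TensorAlgebra.

(* Induction along a subalgebra B of A: A ⊗_B M is the quotient of A ⊗_k M by
   the relations ab ⊗ m = a ⊗ bm, which it is enough to impose on bases. *)
Section Induction.

Variables (k : fieldType) (A : falgType k) (B : {aspace A}).
Implicit Types M N : fmod (subvs_of B).

Section Object.

Variable M : fmod (subvs_of B).

Definition free_act (a : A) : tens A M -> tens A M :=
  tlift (fun (b : A) (x : M) => (a * b) ⊗ x).

Lemma free_act_pure a b x : free_act a (b ⊗ x) = (a * b) ⊗ x.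
Proof.
rewrite /free_act tlift_pure // => [w|v] c y z.
  by rewrite mulrDr -scalerAr pure_linear_l.
by rewrite pure_linear_r.
Qed.

Fact free_act_linear a : linear (free_act a).
Proof. exact: tlift_is_linear. Qed.

Fact free_act_linear_l y : linear (free_act^~ y).
Proof.
move=> c a b; rewrite /free_act -tlift_linear_fun; apply: tlift_ext => d x.
by rewrite mulrDl -scalerAl pure_linear_l.
Qed.

Fact free_act1 y : free_act 1 y = y.
Proof.
move: y; apply: (tens_ext (g := id)) => //; first exact: free_act_linear.
by move=> b x; rewrite free_act_pure mul1r.
Qed.

Fact free_actM a b y : free_act (a * b) y = free_act a (free_act b y).
Proof.
move: y; apply: (tens_ext (g := fun y => free_act a (free_act b y))).
- exact: free_act_linear.
- by move=> c u v; rewrite !free_act_linear.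
by move=> d x; rewrite !free_act_pure mulrA.
Qed.

Definition free_mod : fmod A :=
  Fmod free_act_linear free_act_linear_l free_act1 free_actM.

Definition balance (a : A) (b : subvs_of B) (x : M) : free_mod :=
  (a * vsval b) ⊗ x - a ⊗ (b ∙ x).

Definition balance_sub : {vspace free_mod} :=
  (\sum_(a <- vbasis {:A}) \sum_(b <- vbasis {:subvs_of B})
     <<[seq balance a b x | x <- vbasis {:M}]>>)%VS.

Fact balance_linear1 b x : linear (fun a => balance a b x).
Proof.
move=> c a a'; rewrite /balance mulrDl -scalerAl !pure_linear_l.
by rewrite scalerBr opprD addrACA.
Qed.

Fact balance_linear2 a x : linear (fun b => balance a b x).
Proof.
move=> c b b'; rewrite /balance actDl actZl linearP mulrDr -scalerAr.
by rewrite pure_linear_l pure_linear_r scalerBr opprD addrACA.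
Qed.

Fact balance_linear3 a b : linear (balance a b).
Proof.
move=> c x x'; rewrite /balance actDr actZr !pure_linear_r.
by rewrite scalerBr opprD addrACA.
Qed.

Lemma mem_balance a b x : balance a b x \in balance_sub.
Proof.
rewrite (coord_vbasis (memvf a)) (lin_sum _ _ (balance_linear1 b x)).
apply: memv_suml => i _; apply: memvZ.
rewrite (coord_vbasis (memvf b)) (lin_sum _ _ (balance_linear2 _ x)).
apply: memv_suml => j _; apply: memvZ.
rewrite (coord_vbasis (memvf x)) (lin_sum _ _ (balance_linear3 _ _)).
apply: memv_suml => l _; apply: memvZ.
have sub (X : vectType k) (e : seq X) (z : X) (W : X -> {vspace free_mod}) :
    z \in e -> (W z <= \sum_(t <- e) W t)%VS.
  elim: e => // t e IHe; rewrite inE big_cons => /predU1P[-> | /IHe].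
    exact: addvSl.
  by move/subv_trans; apply; apply: addvSr.
apply: (subvP (sub _ _ _ _ (mem_tnth i (vbasis {:A})))).
rewrite -tnth_nth; apply: (subvP (sub _ _ _ _ (mem_tnth j _))).
rewrite -tnth_nth memv_span //; apply/mapP.
by exists (tnth (vbasis {:M}) l); rewrite ?mem_tnth // -!tnth_nth.
Qed.

Lemma balance_sub_le (W : {vspace free_mod}) :
  (forall a b x, balance a b x \in W) -> (balance_sub <= W)%VS.
Proof.
move=> BW; rewrite /balance_sub.
elim/big_ind: _ => [|U V UW VW|a _]; rewrite ?sub0v ?subv_add ?UW //.
elim/big_ind: _ => [|U V UW VW|b _]; rewrite ?sub0v ?subv_add ?UW //.
by apply/span_subvP=> _ /mapP[x _ ->].
Qed.

Fact balance_submod : submod balance_sub.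
Proof.
move=> c y; have -> : c ∙ y = linfun (act (f := free_mod) c) y by rewrite lfunE.
rewrite memv_preim; apply/subvP/balance_sub_le => a b x.
have e d u : act (f := free_mod) c (d ⊗ u) = (c * d) ⊗ u := free_act_pure c d u.
rewrite -memv_preim lfunE -[X in X \in _]/(c ∙ balance a b x) actBr !e mulrA.
exact: mem_balance.
Qed.

Definition ind_mod : fmod A := quo_mod balance_submod.

Definition ind_pure (a : A) (x : M) : ind_mod := quo_pi balance_sub (a ⊗ x).

Lemma ind_pure_balanced a (b : subvs_of B) x :
  ind_pure (a * vsval b) x = ind_pure a (b ∙ x).
Proof.
by apply/eqP; rewrite -subr_eq0 -linearB quo_pi_eq0; apply: mem_balance.
Qed.

Lemma act_ind_pure a b x : a ∙ ind_pure b x = ind_pure (a * b) x.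
Proof.
rewrite /ind_pure -(free_act_pure a b x).
exact: (quo_act_pi balance_submod).
Qed.

End Object.

(* id_A ⊗_B f, for B-linear f: see ind_map_pure below. *)
Definition ind_map M N (f : 'Hom(M, N)) : 'Hom(ind_mod M, ind_mod N) :=
  (quo_pi (balance_sub N)
     \o linfun (tlift (fun (a : A) (x : M) => (a ⊗ f x : tens A N)))
     \o quo_val (balance_sub M))%VF.

Lemma ind_map_pi M N (f : 'Hom(M, N)) z : mlinear f ->
  ind_map f (quo_pi (balance_sub M) z) =
  quo_pi (balance_sub N) (tlift (fun (a : A) (x : M) => (a ⊗ f x : tens A N)) z).
Proof.
move=> mf; pose b (a : A) (x : M) : tens A N := a ⊗ f x.
pose h : 'Hom(free_mod M, free_mod N) := linfun (tlift b).
have hE y : tlift b y = h y by rewrite lfunE.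
rewrite 2!comp_lfunE -/b -/h [tlift _ z]hE.
apply/eqP; rewrite -subr_eq0 -linearB quo_pi_eq0 -linearB.
move: (quo_val_pi (balance_sub M) z); set y := _ - z.
rewrite memv_preim; move: y; apply/subvP/balance_sub_le => a c x.
have hp d u : h (d ⊗ u) = d ⊗ f u.
  rewrite -hE tlift_pure // => [v|v] e s t; rewrite /b.
    by rewrite pure_linear_l.
  by rewrite linearP pure_linear_r.
rewrite -memv_preim.
suff -> : h (balance a c x) = balance a c (f x) by apply: mem_balance.
by rewrite /balance -mf -!hp; apply: linearB.
Qed.

Lemma ind_map_pure M N (f : 'Hom(M, N)) a x :
  mlinear f -> ind_map f (ind_pure a x) = ind_pure a (f x).
Proof.
move=> mf; rewrite ind_map_pi // tlift_pure // => [v|v] d s t.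
  by rewrite pure_linear_l.
by rewrite linearP pure_linear_r.
Qed.

End Induction.

(* A as a right module over its subalgebra B, i.e. a left module over B^op *)
Section RightModule.

Variables (k : fieldType) (A : falgType k) (B : {aspace A}).

Definition right_act (b : (subvs_of B)^c) (x : A) : A := x * vsval b.

Fact right_act_linear b : linear (right_act b).
Proof. by move=> c x y; rewrite /right_act mulrDl scalerAl. Qed.

Fact right_act_linear_l x : linear (right_act^~ x).
Proof.
by move=> c a b; rewrite /right_act -[c *: a + b]/(c *: a + b : subvs_of B)
  linearP mulrDr scalerAr.
Qed.

Hypothesis B1 : 1 \in B.

Fact right_act1 x : right_act 1 x = x.
Proof.
rewrite /right_act /= (_ : algid B = 1) ?mulr1 //.
by apply/eqP; rewrite algid_eq1.
Qed.

Fact right_actM a b x : right_act (a * b) x = right_act a (right_act b x).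
Proof. by rewrite /right_act /= mulrA. Qed.

Definition right_mod : fmod (subvs_of B)^c :=
  Fmod right_act_linear right_act_linear_l right_act1 right_actM.

End RightModule.

Section ExactBorel.

Variables (k : fieldType) (A : falgType k).

(* MathComp's {aspace A} only asks B to have an identity element of its own. *)
Definition exact_borel (I : finType) (S : I -> fmod A) (le : rel I)
    (B : {aspace A}) : Prop :=
  exists2 B1 : 1 \in B, projective (right_mod B1) &
  exists (J : finType) (L : J -> fmod (subvs_of B)) (phi : J -> I),
    [/\ is_Sim L, bijective phi,
        forall j, is_standard S le (phi j) (ind_mod (L j))
      & directed L (fun j j' => le (phi j) (phi j'))].

Variable B : {aspace A}.

(* The map Ext^n_B(M, N) -> Ext^n_A(A ⊗_B M, A ⊗_B N), [f] |-> [id_A ⊗_B f],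
   for a projective resolution (P, d) of M over B.  When A is projective as a
   right B-module, (A ⊗_B P, id_A ⊗_B d) is a projective resolution of
   A ⊗_B M, and cocycles and coboundaries over A are taken with respect to
   it. *)
Section ExtMap.

Variables (N : fmod (subvs_of B)) (P : nat -> fmod (subvs_of B)).
Variable d : forall n, 'Hom(P n.+1, P n).

Definition ind_diff n : 'Hom(ind_mod (P n.+1), ind_mod (P n)) := ind_map (d n).

Definition ext_map_mono n : Prop :=
  forall f : 'Hom(P n, N), cocycle d f ->
    coboundary ind_diff (ind_map f) -> coboundary d f.

Definition ext_map_epi n : Prop :=
  forall F : 'Hom(ind_mod (P n), ind_mod N), cocycle ind_diff F ->
    exists2 f : 'Hom(P n, N),
      cocycle d f & coboundary ind_diff (F - ind_map f).

End ExtMap.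

(* The same, for M = N = L^B, the direct sum of the simple B-modules; neither
   the choice of Sim(B) nor that of the resolution matters. *)
Definition ext_LB_mono n : Prop :=
  forall (J : finType) (L : J -> fmod (subvs_of B)), is_Sim L ->
  let LB := \big[@dsum _ _/zero_mod]_j L j in
  forall (P : nat -> fmod (subvs_of B)) (d : forall n, 'Hom(P n.+1, P n))
         (e : 'Hom(P 0%N, LB)),
    projective_resolution d e -> ext_map_mono LB d n.

Definition ext_LB_epi n : Prop :=
  forall (J : finType) (L : J -> fmod (subvs_of B)), is_Sim L ->
  let LB := \big[@dsum _ _/zero_mod]_j L j in
  forall (P : nat -> fmod (subvs_of B)) (d : forall n, 'Hom(P n.+1, P n))
         (e : 'Hom(P 0%N, LB)),
    projective_resolution d e -> ext_map_epi LB d n.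

Variables (I : finType) (S : I -> fmod A) (le : rel I).

Definition regular_exact_borel : Prop :=
  exact_borel S le B /\
  forall n, (1 <= n)%N -> ext_LB_mono n /\ ext_LB_epi n.

Definition homological_exact_borel : Prop :=
  [/\ exact_borel S le B, ext_LB_epi 1
    & forall n, (2 <= n)%N -> ext_LB_mono n /\ ext_LB_epi n].

End ExactBorel.

Definition semisimple_alg (k : fieldType) (A : falgType k) : Prop :=
  semisimple (regular_mod A).

(* Sim(A ⊗_k A') and the product order on it, both indexed by I x I' *)
Section ProductSim.

Variables (k : fieldType) (A A' : falgType k) (I I' : finType).

Definition prod_Sim (S : I -> fmod A) (S' : I' -> fmod A') (x : I * I')
  : fmod (tens_alg A A') := tens_mod (S x.1) (S' x.2).

Definition prod_rel (le : rel I) (le' : rel I') : rel (I * I') :=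
  fun x y => le x.1 y.1 && le' x.2 y.2.

End ProductSim.

(* Sim(A^op), indexed like Sim(A) via L |-> Hom_k(L, k) *)
Definition dual_Sim (k : fieldType) (A : falgType k) (I : finType)
  (S : I -> fmod A) (i : I) : fmod A^c := dual_mod (S i).

(* Main.v *)
(* By Shapiro's lemma Ext_A(A ⊗_B M, A ⊗_B N) is Ext_B(M, res (A ⊗_B N)), and the comparison map
   becomes composition with the unit N -> A ⊗_B N; so all Ext groups are computed over B.  For a
   regular exact Borel subalgebra, injectivity in degree one shows:
   - all units on simples are bijective iff B = A iff A is directed; otherwise some L_c has a
     nonzero map F : L_a -> res (A ⊗_B L_c) with a <> c;
   - all simple B-modules are projective iff all standard modules are projective iff A^op is
     directed; otherwise some nonzero class f in Ext^1(L_b, L_d), d <> b, survives in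
     Ext^1(L_b, res (A ⊗_B L_d));
   - A is semisimple iff both conditions hold.
   If F exists for A and f exists for A', then the degree-one Kunneth class F ⊗ f is not in the
   image of the comparison map.  Hence surjectivity in degree one for B ⊗ B' forces A directed or
   (A')^op directed and, symmetrically, A' directed or A^op directed, which is (3).
   Conversely, the units of B ⊗ B' are products of units, hence bijective in case (a); in case (b)
   the simple B ⊗ B'-modules are projective; in case (c) tensoring with a projective simple module S
   turns a resolution of L' into one of S ⊗ L' and reduces the comparison map to that of B'. *)
Require Import Defs.
From HB Require Import structures.
From mathcomp Require Import all_boot all_order all_algebra falgebra.
From Stdlib Require Import ClassicalEpsilon ProofIrrelevance FunctionalExtensionality.

Set Implicit Arguments.
Unset Strict Implicit.
Unset Printing Implicit Defensive.

Import GRing.Theory.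

Local Open Scope ring_scope.

(** * Finite-dimensional modules *)

(** Why the class F ⊗ f is missed: Hom(L_a, L_c) and Hom(L_b, L_d) vanish for a <> c and b <> d, so
    by Kunneth Ext^1(L_a ⊗ L_b, L_c ⊗ L_d) = 0. Surjectivity would make F ⊗ f a coboundary, and
    contracting the first factor at a point where F is nonzero would make the image of f a
    coboundary for the second algebra alone. Two obstacles shape the development. The comparison
    conditions quantify over every resolution, so they are shown to pass along chain homotopies and
    direct summands; after that, one convenient resolution of each simple module is enough. And
    duality turns projective modules into injective ones, so directedness cannot be carried to the
    opposite algebra by dualising covers. It is carried by idempotents e_i with one-dimensional
    corners e_i A e_i: the spaces e_i A e_j are the same in A and A^op up to exchanging i and j, and
    they compute the maps between projective covers. *)

Section LinearAlgebra.

Variable k : fieldType.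
Implicit Types V W : vectType k.

Lemma linfunE V W (f : V -> W) : linear f -> linfun f =1 f.
Proof.
move=> lf x; pose fM := GRing.isLinear.Build _ _ _ _ f lf.
pose fL : {linear V -> W} := HB.pack f fM.
by rewrite -[f]/(fL : V -> W) lfunE.
Qed.

Lemma limg_fullP V W (f : 'Hom(V, W)) :
  limg f = fullv <-> forall y, exists x, f x = y.
Proof.
split=> [e y | s].
  have: y \in limg f by rewrite e memvf.
  by move/memv_imgP=> [x _ ->]; exists x.
apply/vspaceP=> y; rewrite memvf; have [x <-] := s y.
by rewrite memv_img ?memvf.
Qed.

Lemma memv_limgP V W (f : 'Hom(V, W)) y :
  reflect (exists x, y = f x) (y \in limg f).
Proof.
apply: (iffP memv_imgP) => [[x _ ->] | [x ->]]; first by exists x.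
by exists x; rewrite ?memvf.
Qed.

Lemma bij_lfun_inv V W (f : 'Hom(V, W)) : bijective f ->
  exists g : 'Hom(W, V), (forall x, g (f x) = x) /\ (forall y, f (g y) = y).
Proof.
move=> bf; have k0 : lker f == 0%VS by apply/lker0P; apply: bij_inj.
exists (f^-1)%VF; split=> [x | y]; first by rewrite -comp_lfunE lker0_compVf ?id_lfunE.
have [g _ gK] := bf; by rewrite -[y]gK limg_lfunVK // memv_img ?memvf.
Qed.

Lemma lfun_bij V W (f : 'Hom(V, W)) :
  (forall x, f x = 0 -> x = 0) -> (forall y, exists x, f x = y) -> bijective f.
Proof.
move=> i /limg_fullP s.
have k0 : lker f == 0%VS.
  by rewrite -subv0; apply/subvP=> x; rewrite memv_ker memv0 => /eqP/i/eqP.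
exists (f^-1)%VF => x; first by rewrite -comp_lfunE lker0_compVf ?id_lfunE.
by rewrite limg_lfunVK ?s ?memvf.
Qed.

(** [f^-1] is a partial inverse, so [x - f^-1 (f x)] lies in the kernel of [f], where [g] vanishes.
    Off the image of [f] the values of [h] carry no meaning. *)
Lemma lfun_factor V W (U : vectType k) (f : 'Hom(V, W)) (g : 'Hom(V, U)) :
  (forall x, f x = 0 -> g x = 0) -> exists h : 'Hom(W, U), forall x, g x = h (f x).
Proof.
move=> e; exists (g \o f^-1)%VF => x; rewrite comp_lfunE.
apply/eqP; rewrite -subr_eq0 -linearB; apply/eqP/e.
by rewrite linearB /= limg_lfunVK ?subrr ?memv_img ?memvf.
Qed.

Lemma lfun_section V W (f : 'Hom(V, W)) : (forall y, exists x, f x = y) ->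
  exists s : 'Hom(W, V), forall y, f (s y) = y.
Proof.
move/limg_fullP=> s; exists (f^-1)%VF => y.
by rewrite limg_lfunVK // s memvf.
Qed.

Lemma functional_neq0 V (x : V) : x != 0 -> exists xi : 'Hom(V, k^o), xi x = 1.
Proof.
move=> x0.
have [i ci] : exists i, coord (vbasis {:V}) i x != 0.
  apply/existsP; apply: contraR x0 => /existsPn x0.
  rewrite (coord_vbasis (memvf x)) big1 // => i _.
  by have /negPn/eqP-> := x0 i; rewrite scale0r.
exists (linfun (fun y => (coord (vbasis {:V}) i x)^-1 * coord (vbasis {:V}) i y : k^o)).
rewrite linfunE ?mulVf // => c y z.
by rewrite linearP mulrDr mulrCA.
Qed.

Lemma functional_eq0 V (x : V) : (forall xi : 'Hom(V, k^o), xi x = 0) -> x = 0.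
Proof.
move=> h; apply/eqP; apply: contraTT isT => /functional_neq0[xi].
by rewrite h => /eqP; rewrite eq_sym oner_eq0.
Qed.

Lemma neq0_exists V (U : {vspace V}) : U != 0%VS -> exists2 x, x \in U & x != 0.
Proof. by move=> U0; exists (vpick U); rewrite ?memv_pick ?vpick0. Qed.

Lemma lfun_neq0 V W (f : 'Hom(V, W)) : f <> 0 -> exists x, f x != 0.
Proof.
move=> f0; apply: NNPP => h; apply: f0; apply/lfunP=> x; rewrite zero_lfunE.
by apply/eqP; apply: contraTT isT => nx; case: h; exists x.
Qed.

Lemma subv_neq_ex V (U W : {vspace V}) : ~~ (U <= W)%VS -> exists2 x, x \in U & x \notin W.
Proof.
by move=> nUW; exact: (subvPn nUW).
Qed.

(** Finite length in the form used throughout, by induction on the dimension. [Pr] is in general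
    undecidable, hence the classical case split. *)
Lemma min_vspace V (Pr : {vspace V} -> Prop) U : Pr U ->
  exists U1, [/\ Pr U1 & forall U2, Pr U2 -> (U2 <= U1)%VS -> U2 = U1].
Proof.
have [n] := ubnP (\dim U); elim: n U => // n IHn U dU PU.
have [[U2 [PU2 lU nU]] | h] := classic (exists U2, [/\ Pr U2, (U2 <= U)%VS & U2 <> U]).
  apply: (IHn U2) => //; rewrite ltnS in dU; apply: leq_trans dU.
  rewrite ltn_neqAle dimvS // andbT; apply/eqP => e; apply: nU.
  by apply/eqP; rewrite eqEdim lU e leqnn.
exists U; split=> // U2 PU2 lU; apply: NNPP => nU; apply: h; by exists U2.
Qed.

Lemma max_vspace V (Pr : {vspace V} -> Prop) U : Pr U ->
  exists U1, [/\ Pr U1 & forall U2, Pr U2 -> (U1 <= U2)%VS -> U2 = U1].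
Proof.
have [n] := ubnP (\dim {:V} - \dim U); elim: n U => // n IHn U dU PU.
have [[U2 [PU2 lU nU]] | h] := classic (exists U2, [/\ Pr U2, (U <= U2)%VS & U2 <> U]).
  apply: (IHn U2) => //; rewrite ltnS in dU; apply: leq_trans dU.
  have lt : (\dim U < \dim U2)%N.
    rewrite ltn_neqAle dimvS // andbT; apply/eqP => e; apply: nU.
    by apply/eqP; rewrite eq_sym eqEdim lU e leqnn.
  by rewrite ltn_sub2l // (leq_trans lt) // dimvS ?subvf.
exists U; split=> // U2 PU2 lU; apply: NNPP => nU; apply: h; by exists U2.
Qed.

Lemma lfun_eq_sub V W (f : 'Hom(V, W)) x y : f (x - y) = 0 -> f x = f y.
Proof. by move=> e; apply/eqP; rewrite -subr_eq0 -linearB; apply/eqP. Qed.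

End LinearAlgebra.

(** * Submodules, quotients, Schur's lemma and composition layers *)

Section ModuleTheory.

Variables (k : fieldType) (A : falgType k).
Implicit Types (M N P Q D L : fmod A).

Lemma mlinear_comp M N Q (g : 'Hom(N, Q)) (f : 'Hom(M, N)) :
  mlinear g -> mlinear f -> mlinear (g \o f)%VF.
Proof. by move=> mg mf a x; rewrite !comp_lfunE mf mg. Qed.

Lemma mlinear_id M : mlinear (\1%VF : 'End(M)).
Proof. by move=> a x; rewrite !id_lfunE. Qed.

Lemma mlinear0 M N : mlinear (0 : 'Hom(M, N)).
Proof. by move=> a x; rewrite !zero_lfunE act0r. Qed.

Lemma mlinearB M N (f g : 'Hom(M, N)) : mlinear f -> mlinear g -> mlinear (f - g).
Proof.
by move=> mf mg a x; rewrite !add_lfunE !opp_lfunE mf mg -actBr.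
Qed.

Lemma mlinearD M N (f g : 'Hom(M, N)) : mlinear f -> mlinear g -> mlinear (f + g).
Proof. by move=> mf mg a x; rewrite !add_lfunE mf mg -actDr. Qed.

Lemma mlinearZ M N c (f : 'Hom(M, N)) : mlinear f -> mlinear (c *: f).
Proof. by move=> mf a x; rewrite !scale_lfunE mf actZr. Qed.

Lemma mlinear_sum M N (K : finType) (f : K -> 'Hom(M, N)) :
  (forall i, mlinear (f i)) -> mlinear (\sum_i f i).
Proof.
move=> mf; elim/big_ind: _ => //; first exact: mlinear0.
by move=> *; apply: mlinearD.
Qed.

Lemma bij_mlinear_inv M N (f : 'Hom(M, N)) : mlinear f -> bijective f ->
  exists g : 'Hom(N, M),
    [/\ mlinear g, forall x, g (f x) = x & forall y, f (g y) = y].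
Proof.
move=> mf /bij_lfun_inv[g [fK gK]]; exists g; split=> // a y.
by rewrite -{1}[y]gK -mf fK.
Qed.

Lemma miso_refl M : miso M M.
Proof. by exists \1%VF; [apply: mlinear_id | exists id => x; rewrite id_lfunE]. Qed.

Lemma miso_sym M N : miso M N -> miso N M.
Proof.
case=> f mf bf; have [g [mg fK gK]] := bij_mlinear_inv mf bf.
by exists g => //; exists f.
Qed.

Lemma miso_trans M N Q : miso M N -> miso N Q -> miso M Q.
Proof.
case=> f mf bf [g mg bg]; exists (g \o f)%VF; first exact: mlinear_comp.
by apply: (eq_bij (bij_comp bg bf)) => x; rewrite /= comp_lfunE.
Qed.

Section Submodules.

Variable M : fmod A.
Implicit Types U V W : {vspace M}.

Lemma submod0 : submod (0%VS : {vspace M}).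
Proof. by move=> a x; rewrite !memv0 => /eqP->; rewrite act0r. Qed.

Lemma submodT : submod (fullv : {vspace M}).
Proof. by move=> a x _; rewrite memvf. Qed.

Lemma submodI U V : submod U -> submod V -> submod (U :&: V)%VS.
Proof.
by move=> sU sV a x; rewrite !memv_cap => /andP[/sU-> /sV->].
Qed.

Lemma submodD U V : submod U -> submod V -> submod (U + V)%VS.
Proof.
move=> sU sV a x /memv_addP[u Uu [v Vv ->]]; rewrite actDr memv_add //.
  exact: sU.
exact: sV.
Qed.

Lemma submod_ker N (f : 'Hom(M, N)) : mlinear f -> submod (lker f).
Proof. by move=> mf a x; rewrite !memv_ker mf => /eqP->; rewrite act0r. Qed.

Lemma submod_preim N (f : 'Hom(M, N)) (W : {vspace N}) :
  mlinear f -> submod W -> submod (f @^-1: W)%VS.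
Proof. by move=> mf sW a x; rewrite -!memv_preim mf; apply: sW. Qed.

Lemma submod_img N (f : 'Hom(M, N)) U : mlinear f -> submod U -> submod (f @: U)%VS.
Proof.
move=> mf sU a _ /memv_imgP[x Ux ->]; rewrite -mf memv_img //; exact: sU.
Qed.

(** The sum of two submodules inside [W] is again one, so a maximal such submodule is the greatest.
    This serves [is_trace], which tests traces against arbitrary subspaces and not only against
    submodules. *)
Lemma submod_core W : exists U, [/\ submod U, (U <= W)%VS &
  forall V, submod V -> (V <= W)%VS -> (V <= U)%VS].
Proof.
have [U [[sU UW] mU]] := @max_vspace _ _
  (fun U => submod U /\ (U <= W)%VS) 0%VS (conj submod0 (sub0v _)).
exists U; split=> // V sV VW; rewrite -(mU (U + V)%VS) ?addvSl ?addvSr //.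
by split; [apply: submodD | rewrite subv_add UW].
Qed.

Variables (U : {vspace M}) (sU : submod U).

Definition subm_act (a : A) (x : subvs_of U) : subvs_of U := vsproj U (a ∙ vsval x).

Lemma vsval_subm_act a x : vsval (subm_act a x) = a ∙ vsval x.
Proof. by rewrite vsprojK // sU ?subvsP. Qed.

Fact subm_act_linear a : linear (subm_act a).
Proof.
move=> c x y; apply: val_inj => /=.
by rewrite !vsval_subm_act [vsval (_ + _)]linearP actDr actZr.
Qed.

Fact subm_act_linear_l x : linear (subm_act^~ x).
Proof.
move=> c a b; apply: val_inj => /=.
by rewrite !vsval_subm_act actDl actZl.
Qed.

Fact subm_act1 x : subm_act 1 x = x.
Proof. by apply: val_inj; rewrite /= vsval_subm_act act1. Qed.

Fact subm_actM a b x : subm_act (a * b) x = subm_act a (subm_act b x).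
Proof. by apply: val_inj; rewrite /= !vsval_subm_act actM. Qed.

Definition subm : fmod A :=
  Fmod subm_act_linear subm_act_linear_l subm_act1 subm_actM.

Definition subm_val : 'Hom(subm, M) := linfun vsval.

Lemma subm_valE x : subm_val x = vsval x. Proof. exact: lfunE. Qed.

Lemma mlinear_subm_val : mlinear subm_val.
Proof. by move=> a x; rewrite !subm_valE vsval_subm_act. Qed.

Lemma subm_valP x : subm_val x \in U.
Proof. by rewrite subm_valE subvsP. Qed.

Lemma subm_val_inj : injective subm_val.
Proof. by move=> x y; rewrite !subm_valE => /val_inj. Qed.

Lemma subm_ex y : y \in U -> exists x : subm, subm_val x = y.
Proof. by move=> Uy; exists (vsproj U y); rewrite subm_valE vsprojK. Qed.

Lemma subm_lift N (f : 'Hom(N, M)) : mlinear f -> (forall x, f x \in U) ->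
  exists2 g : 'Hom(N, subm), mlinear g & forall x, subm_val (g x) = f x.
Proof.
move=> mf Uf.
have gE x : subm_val ((linfun (vsproj U) \o f)%VF x) = f x.
  by rewrite comp_lfunE subm_valE lfunE /= vsprojK.
exists (linfun (vsproj U) \o f)%VF => // a x; apply: subm_val_inj.
by rewrite mlinear_subm_val !gE mf.
Qed.

Lemma mlinear_quo_pi : mlinear (quo_pi U : 'Hom(M, quo_mod sU)).
Proof. by move=> a x; rewrite -(quo_act_pi sU). Qed.

Lemma quo_pi_surj y : exists x, (quo_pi U : 'Hom(M, quo_mod sU)) x = y.
Proof. by exists (quo_val U y); rewrite quo_valK. Qed.

Lemma quo_lift N (f : 'Hom(M, N)) : mlinear f -> (forall x, x \in U -> f x = 0) ->
  exists2 g : 'Hom(quo_mod sU, N), mlinear g & forall x, g (quo_pi U x) = f x.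
Proof.
move=> mf Uf; have [|g gE] := @lfun_factor _ _ _ _ (quo_pi U) f.
  by move=> x /eqP; rewrite quo_pi_eq0 => /Uf.
exists g => // a y; have [x <-] := quo_pi_surj y.
by rewrite -mlinear_quo_pi -!gE mf.
Qed.

End Submodules.

Lemma submod_limg M N (f : 'Hom(M, N)) : mlinear f -> submod (limg f).
Proof. by move=> mf; apply: submod_img => //; apply: submodT. Qed.

(** Projectivity applied to the corestriction of [g] to its image. *)
Lemma proj_lift P M N (g : 'Hom(M, N)) (h : 'Hom(P, N)) :
  projective P -> mlinear g -> mlinear h -> (forall x, h x \in limg g) ->
  exists2 l : 'Hom(P, M), mlinear l & forall x, g (l x) = h x.
Proof.
move=> pP mg mh hg; have sg := submod_limg mg.
have [h1 mh1 h1E] := subm_lift sg mh hg.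
have [g1 mg1 g1E] := subm_lift sg mg (fun x => memv_img g (memvf x)).
have [|l ml e] := pP M (subm sg) g1 h1 mg1 _ mh1.
  apply/limg_fullP => y; have /memv_limgP[x e] := subm_valP y.
  by exists x; apply: subm_val_inj; rewrite g1E e.
by exists l => // x; rewrite -g1E -[g1 _]comp_lfunE -e h1E.
Qed.

Lemma proj_lift_surj P M N (g : 'Hom(M, N)) (h : 'Hom(P, N)) :
  projective P -> mlinear g -> mlinear h -> (forall y, exists x, g x = y) ->
  exists2 l : 'Hom(P, M), mlinear l & forall x, g (l x) = h x.
Proof.
move=> pP mg mh sg; apply: proj_lift => // x; apply/memv_limgP.
by have [y e] := sg (h x); exists y.
Qed.

Lemma proj_retract P Q (i : 'Hom(P, Q)) (r : 'Hom(Q, P)) :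
  mlinear i -> mlinear r -> (forall x, r (i x) = x) -> projective Q -> projective P.
Proof.
move=> mi mr ri pQ M N g h mg /limg_fullP sg mh.
have [l ml e] := proj_lift_surj pQ mg (mlinear_comp mh mr) sg.
exists (l \o i)%VF; first exact: mlinear_comp.
by apply/lfunP=> x; rewrite !comp_lfunE e comp_lfunE ri.
Qed.

Lemma proj_miso P Q : miso P Q -> projective P -> projective Q.
Proof.
case=> f mf bf; have [g [mg fK gK]] := bij_mlinear_inv mf bf.
exact: proj_retract gK.
Qed.

Lemma bij_of_dim M N (f : 'Hom(M, N)) : (forall y, exists x, f x = y) ->
  (\dim {:M} <= \dim {:N})%N -> bijective f.
Proof.
move=> /[dup] sf /limg_fullP e le; apply: lfun_bij sf => x fx.
have := limg_ker_dim f fullv; rewrite capfv e => d.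
have: \dim (lker f) = 0%N by apply/eqP; rewrite -leqn0 -(leq_add2r (\dim {:N})) d add0n.
move/eqP; rewrite dimv_eq0 => /eqP k0; apply/eqP.
by rewrite -memv0 -k0 memv_ker fx.
Qed.

Lemma surj_dim M N (f : 'Hom(M, N)) : (forall y, exists x, f x = y) ->
  (\dim {:N} <= \dim {:M})%N.
Proof.
by move=> /limg_fullP e; have := limg_ker_dim f fullv; rewrite e => <-; apply: leq_addl.
Qed.

Lemma simple_neq0 L : simple L -> exists x : L, x != 0.
Proof. by case=> /neq0_exists[x _ x0] _; exists x. Qed.

Lemma simple_sub L U x : simple L -> submod (M := L) U -> x \in U -> x != 0 -> U = fullv.
Proof.
by case=> _ h /h[->|//]; rewrite memv0 => /eqP->; rewrite eqxx.
Qed.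

Lemma simple_surj M L (f : 'Hom(M, L)) x : simple L -> mlinear f -> f x != 0 ->
  forall y, exists x, f x = y.
Proof.
move=> sL mf fx; apply/limg_fullP; apply: (simple_sub sL (submod_limg mf) _ fx).
by rewrite memv_img ?memvf.
Qed.

Lemma simple_inj M L (f : 'Hom(L, M)) x : simple L -> mlinear f -> f x != 0 ->
  forall y, f y = 0 -> y = 0.
Proof.
move=> [L0 sL] mf fx y fy; case: (sL (lker f) (submod_ker mf)) => [e|e].
  by apply/eqP; rewrite -memv0 -e memv_ker fy.
have xk: x \in lker f by rewrite e memvf.
  by move: xk; rewrite memv_ker (negPf fx).
Qed.

Lemma schur L L' (f : 'Hom(L, L')) x :
  simple L -> simple L' -> mlinear f -> f x != 0 -> bijective f.
Proof.
move=> sL sL' mf fx; apply: lfun_bij; first exact: simple_inj fx.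
exact: simple_surj fx.
Qed.

Lemma simple_miso L L' : miso L L' -> simple L -> simple L'.
Proof.
case=> f mf bf [L0 sL]; have [g [mg fK gK]] := bij_mlinear_inv mf bf; split.
  have [x _ x0] := neq0_exists L0; apply: contraNneq x0 => e.
  by rewrite -[x]fK (_ : f x = 0) ?linear0 //; apply/eqP; rewrite -memv0 -e memvf.
move=> U sU; case: (sL (f @^-1: U)%VS (submod_preim mf sU)) => e; [left | right].
  apply/eqP; rewrite -subv0; apply/subvP=> y Uy; rewrite memv0 -[y]gK.
  have: g y \in (f @^-1: U)%VS by rewrite -memv_preim gK.
  by rewrite e memv0 => /eqP->; rewrite linear0.
apply/vspaceP=> y; rewrite memvf -[y]gK memv_preim e memvf //.
Qed.

(** A minimal submodule [V] strictly above [K] has simple quotient V / K. [D] is the image of [V] in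
    M / K; the map to it is built with a linear projection and is a module map on [V] only, which is
    what [subquotient_iso] asks. *)
Lemma layer M (K W : {vspace M}) : submod K -> submod W -> (K <= W)%VS -> K <> W ->
  exists V D, [/\ submod V, (K <= V <= W)%VS, K <> V, simple D & subquotient_iso V K D].
Proof.
move=> sK sW KW nKW.
have [|V [[sV KV VW nV] mV]] := @min_vspace _ _
  (fun V : {vspace M} => [/\ submod V, (K <= V)%VS, (V <= W)%VS & K <> V]) W.
  by split.
pose p : 'Hom(M, quo_mod sK) := quo_pi K.
have mp : mlinear p := mlinear_quo_pi sK.
have sI : submod (p @: V)%VS by apply: submod_img.
pose D := subm sI.
have pK x : (p x == 0) = (x \in K) by apply: quo_pi_eq0.
pose g : 'Hom(M, D) := (linfun (vsproj (p @: V)%VS) \o p)%VF.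
have gE x : x \in V -> subm_val sI (g x) = p x.
  by move=> Vx; rewrite subm_valE comp_lfunE lfunE /= vsprojK // memv_img.
exists V, D; split=> //; first by rewrite KV.
  split.
    have: ~~ (V <= K)%VS by apply/negP=> VK; apply: nV; apply/eqP; rewrite eqEsubv KV.
    move=> /subv_neq_ex[x Vx nKx].
    apply/eqP=> e; have: g x \in (fullv : {vspace D}) by rewrite memvf.
    rewrite e memv0 => /eqP gx; move: (gE x Vx); rewrite gx linear0 => /esym/eqP.
    by rewrite pK (negPf nKx).
  move=> U sU; pose U' := (V :&: (p @^-1: ((subm_val sI) @: U)))%VS.
  have sU' : submod U'.
    apply: submodI => //; apply: submod_preim => //; apply: submod_img => //.
    exact: mlinear_subm_val.
  have KU' : (K <= U')%VS.
    apply/subvP=> x Kx; rewrite memv_cap (subvP KV) // -memv_preim.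
    by move: (Kx); rewrite -pK => /eqP->; rewrite mem0v.
  have U'V : (U' <= V)%VS by apply: capvSl.
  have UP y : (y \in U) -> exists2 x, x \in U' & subm_val sI y = p x.
    move=> Uy; have /memv_imgP[x Vx e] := subm_valP y.
    by exists x => //; rewrite memv_cap Vx -memv_preim -e memv_img.
  case: (classic (K = U')) => [e | ne]; [left | right].
    apply/eqP; rewrite -subv0; apply/subvP=> y /UP[x].
    rewrite -e -pK => /eqP-> /eqP; rewrite memv0 => /eqP z.
    by apply/eqP; apply: (@subm_val_inj _ _ sI); rewrite z linear0.
  have e : U' = V.
    apply: mV => //; split=> //; exact: subv_trans U'V VW.
  apply/vspaceP=> y; rewrite memvf; have /memv_imgP[x Vx ey] := subm_valP y.
  move: Vx; rewrite -e memv_cap -memv_preim => /andP[_ /memv_imgP[z Uz]].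
  by rewrite -ey => /subm_val_inj->.
exists g; split.
- move=> a x Vx; apply: (@subm_val_inj _ _ sI).
  by rewrite gE ?sV // mlinear_subm_val gE // mp.
- apply/vspaceP=> y; rewrite memvf; have /memv_imgP[x Vx ey] := subm_valP y.
  apply/memv_imgP; exists x => //; apply: (@subm_val_inj _ _ sI).
  by rewrite gE.
apply/vspaceP=> x; rewrite memv_cap memv_ker; apply/andP/idP=> [[Vx /eqP gx]|Kx].
  by rewrite -pK -gE // gx linear0.
have Vx := subvP KV x Kx; split=> //; apply/eqP; apply: (@subm_val_inj _ _ sI).
by rewrite gE // linear0; apply/eqP; rewrite pK.
Qed.

(** For a maximal proper [U], the simple layer above [U] has to reach [W]. *)
Lemma colayer M (K W : {vspace M}) : submod K -> submod W -> (K <= W)%VS -> K <> W ->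
  exists U D, [/\ submod U, (K <= U <= W)%VS, U <> W, simple D & subquotient_iso W U D].
Proof.
move=> sK sW KW nKW.
have [|U [[sU KU UW nU] mU]] := @max_vspace _ _
  (fun V : {vspace M} => [/\ submod V, (K <= V)%VS, (V <= W)%VS & V <> W]) K.
  by split.
have [V [D [sV /andP[UV VW] nUV sD i]]] := layer sU sW UW nU.
exists U, D; split=> //; first by rewrite KU.
suff <- : V = W by [].
apply: NNPP => nVW; apply: nUV; rewrite (mU V) //; split=> //.
exact: subv_trans UV.
Qed.

Lemma subquotient_miso M (V U : {vspace M}) D D' :
  subquotient_iso V U D -> miso D D' -> subquotient_iso V U D'.
Proof.
case=> g [mg gV gU] [f mf bf]; exists (f \o g)%VF; split.
- by move=> a x Vx; rewrite !comp_lfunE mg // mf.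
- rewrite limg_comp gV; apply/limg_fullP=> y; have [h _ hK] := bf; by exists (h y).
apply/vspaceP=> x; rewrite -gU !memv_cap !memv_ker comp_lfunE; congr (_ && _).
by rewrite -(inj_eq (bij_inj bf)) linear0.
Qed.

(** This turns composition factors of [M] into maps to [M]: with [Q] the projective cover of a
    factor, [f] hits that factor. *)
Lemma subquotient_lift M (V U : {vspace M}) D Q (h : 'Hom(Q, D)) :
  submod V -> subquotient_iso V U D -> projective Q -> mlinear h ->
  exists g : 'Hom(M, D), exists f : 'Hom(Q, M),
   [/\ mlinear f, forall x, f x \in V, forall x, g (f x) = h x & (V :&: lker g)%VS = U].
Proof.
move=> sV [g [mg gV gU]] pQ mh.
have m1 : mlinear (g \o subm_val sV)%VF.
  by move=> a x; rewrite !comp_lfunE mlinear_subm_val mg ?subm_valP.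
have [|l ml e] := proj_lift_surj pQ m1 mh.
  move=> y; have : y \in (g @: V)%VS by rewrite gV memvf.
  move=> /memv_imgP[x Vx ->]; have [z <-] := subm_ex sV Vx.
  by exists z; rewrite comp_lfunE.
exists g, (subm_val sV \o l)%VF; split=> //.
- by move=> a x; rewrite !comp_lfunE ml mlinear_subm_val.
- by move=> x; rewrite comp_lfunE subm_valP.
by move=> x; rewrite -e !comp_lfunE.
Qed.

Lemma composition_series M (U W : {vspace M}) : submod U -> submod W -> (U <= W)%VS ->
  exists (m : nat) (F : nat -> {vspace M}),
  [/\ F 0%N = U, F m = W, forall t, (t <= m)%N -> submod (F t)
    & forall t, (t < m)%N -> [/\ (F t <= F t.+1)%VS, (F t.+1 <= W)%VS, F t <> F t.+1
        & exists2 D, simple D & subquotient_iso (F t.+1) (F t) D]].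
Proof.
move=> sU sW; have [n] := ubnP (\dim W - \dim U); elim: n U sU => // n IHn U sU dU UW.
have [e | ne] := classic (U = W).
  by exists 0%N, (fun=> W); split.
have [V [D [sV /andP[UV VW] nUV sD i]]] := layer sU sW UW ne.
have lt : (\dim U < \dim V)%N.
  rewrite ltn_neqAle dimvS // andbT; apply/eqP => e; apply: nUV.
  by apply/eqP; rewrite eqEdim UV e leqnn.
have [||m [F [F0 Fm sF lF]]] := IHn V sV => //.
  by rewrite ltnS in dU; apply: leq_trans dU; rewrite ltn_sub2l // (leq_trans lt) // dimvS.
exists m.+1, (fun t => if t is t'.+1 then F t' else U); split=> //.
  by case=> // t lt_m; apply: sF.
case=> [_ | t lt_m]; first by rewrite F0; split=> //; exists D.
exact: lF.
Qed.

End ModuleTheory.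

Section Eigenvector.

Import VectorInternalTheory.

(** The nonzero [x] witnesses positive dimension, so the characteristic polynomial is not constant
    and has a root. *)
Lemma exists_eigenvector (k : closedFieldType) (V : vectType k) (f : 'End(V)) (x : V) :
  x != 0 -> exists c y, y != 0 /\ f y = c *: y.
Proof.
move=> x0.
have [c rc] : exists c, root (char_poly (f2mx f)) c.
  apply/closed_rootP; rewrite size_char_poly; apply/eqP=> -[d].
  move/eqP: x0; apply; apply: (can_inj v2rK).
  by apply/matrixP=> i j; have := ltn_ord j; rewrite [X in (_ < X)%N]d.
move: rc; rewrite -eigenvalue_root_char => /eigenvalueP[v e v0].
exists c, (r2v v); split; first by rewrite -(inj_eq (can_inj v2rK)) r2vK linear0.
by rewrite unlock /= r2vK e linearZ.
Qed.

End Eigenvector.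

(** Schur's conclusion as a predicate, shared by simple modules, standard modules and projective
    covers over directed algebras. The zero module satisfies it too, so nonvanishing is stated
    separately where it matters. *)
Definition scalar_end (k : fieldType) (A : falgType k) (S : fmod A) : Prop :=
  forall f : 'End(S), mlinear f -> exists c, forall x, f x = c *: x.

Lemma schur_scalar (k : closedFieldType) (A : falgType k) (S : fmod A) :
  simple S -> scalar_end S.
Proof.
move=> sS f mf; have [x x0] := simple_neq0 sS.
have [c [y [y0 fy]]] := exists_eigenvector f x0.
exists c => z; pose g := f - c *: \1%VF.
have gE u : g u = f u - c *: u by rewrite add_lfunE opp_lfunE scale_lfunE id_lfunE.
have mg : mlinear g by apply: mlinearB => //; apply/mlinearZ/mlinear_id.
apply/eqP; rewrite -subr_eq0 -gE; apply: contraT => gz.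
have := simple_inj sS mg gz; move/(_ y); rewrite gE fy subrr => /(_ erefl) e.
by rewrite e eqxx in y0.
Qed.

(** * Projective covers and directed algebras *)

Section Covers.

Variables (k : fieldType) (A : falgType k).
Implicit Types (M N P Q D L S : fmod A).

Lemma scalar_end_miso M N : miso M N -> scalar_end M -> scalar_end N.
Proof.
case=> h mh bh sc f mf; have [g [mg hK gK]] := bij_mlinear_inv mh bh.
have [|c e] := sc (g \o f \o h)%VF; first by do ?apply: mlinear_comp.
exists c => x; apply: (can_inj gK); have := e (g x).
by rewrite !comp_lfunE gK linearZ.
Qed.

Lemma end_iso_fieldP D (x : D) : x != 0 -> scalar_end D -> end_iso_field D.
Proof.
move=> x0 sD.
have gl : linear (fun c : k^o => c *: (\1%VF : 'End(D))).
  by move=> c d e; rewrite scalerDl scalerA.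
pose gM := GRing.isLinear.Build _ _ _ _ _ gl.
pose g : {linear k^o -> 'End(D)} := HB.pack (fun c : k^o => c *: (\1%VF : 'End(D))) gM.
have gE c y : (g c : 'End(D)) y = c *: y by rewrite scale_lfunE id_lfunE.
exists g; split.
- move=> c d /lfunP/(_ x); rewrite !gE => /eqP.
  by rewrite -subr_eq0 -scalerBl scaler_eq0 subr_eq0 (negPf x0) orbF => /eqP.
- by apply/lfunP=> y; rewrite gE scale1r id_lfunE.
- by move=> c d; apply/lfunP=> y; rewrite comp_lfunE !gE scalerA.
move=> f; split=> [mf | [c ->] a y]; last by rewrite !gE actZr.
by have [c e] := sD f mf; exists c; apply/lfunP=> y; rewrite gE e.
Qed.

Lemma end_iso_field_scalar D : end_iso_field D -> scalar_end D.
Proof.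
case=> g [_ g1 _ gs] f /gs[c ->]; exists c => x.
have -> : c = c *: (1 : k^o) by rewrite /GRing.scale /= mulr1.
by rewrite linearZ g1 scale_lfunE id_lfunE /GRing.scale /= mulr1.
Qed.

Lemma end_iso_field_neq0 D : end_iso_field D -> exists x : D, x != 0.
Proof.
case=> g [gi g1 _ _]; apply: NNPP => h.
have /eqP := oner_neq0 k; apply; apply: gi; apply/lfunP=> x.
rewrite g1 linear0 id_lfunE zero_lfunE; apply/eqP; apply: contraT => x0.
by case: h; exists x.
Qed.

Section OneCover.

Variables (P S : fmod A) (p : 'Hom(P, S)).
Hypotheses (cp : projective_cover p) (sS : simple S).

Lemma cover_surj y : exists x, p x = y.
Proof. by case: cp => _ _ /limg_fullP. Qed.

Lemma cover_proper (U : {vspace P}) : submod U -> U <> fullv -> (U <= lker p)%VS.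
Proof.
case: cp => _ mp _ ep sU nU.
have [_ /(_ _ (submod_img mp sU))[e | /(ep U sU)//]] := sS.
by apply/subvP=> x Ux; rewrite memv_ker -memv0 -e memv_img.
Qed.

Lemma cover_ker_proper : lker p <> fullv.
Proof.
move=> e; have [y y0] := simple_neq0 sS; have [x px] := cover_surj y.
by have := memvf x; rewrite -e memv_ker px (negPf y0).
Qed.

(** The kernel of [p] contains every proper submodule of [P]. If [lker f] were strictly smaller than
    [lker p], then [f] would map [lker p] onto [D], and [lker p], which contains [lker f], would be
    all of [P]. *)
Lemma cover_hom D (f : 'Hom(P, D)) x : simple D -> mlinear f -> f x != 0 ->
  lker f = lker p /\ miso S D.
Proof.
move=> sD mf fx; have [_ mp _ _] := cp.
have fs := simple_surj sD mf fx.
have le : (lker f <= lker p)%VS.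
  apply: cover_proper; first exact: submod_ker.
  by move=> e; have := memvf x; rewrite -e memv_ker (negPf fx).
have e : lker f = lker p.
  apply/eqP; rewrite eqEsubv le /=.
  have [_ /(_ _ (submod_img mf (submod_ker mp)))[e | e]] := sD.
    by apply/subvP=> y py; rewrite memv_ker -memv0 -e memv_img.
  case: cover_ker_proper; apply/vspaceP=> y; rewrite memvf.
  have: f y \in (f @: lker p)%VS by rewrite e memvf.
  case/memv_imgP=> z pz ez; rewrite -[y](subrK z) memvD //.
  by rewrite (subvP le) // memv_ker linearB /= ez subrr.
split=> //; have [|g gE] := @lfun_factor _ _ _ _ p f.
  by move=> y /eqP; rewrite -memv_ker -e memv_ker => /eqP.
exists g.
  by move=> a y; have [z <-] := cover_surj y; rewrite -mp -!gE mf.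
apply: lfun_bij => [y | y].
  have [z <-] := cover_surj y; rewrite -gE => /eqP.
  by rewrite -memv_ker e memv_ker => /eqP.
by have [z <-] := fs y; exists (p z); rewrite -gE.
Qed.

(** Lifts in both directions are onto because the covers are essential; then dimensions force
    bijectivity. *)
Lemma cover_iso Q (q : 'Hom(Q, S)) : projective_cover q ->
  exists h : 'Hom(P, Q), [/\ mlinear h, bijective h & forall x, q (h x) = p x].
Proof.
move=> cq; case: (cp) (cq) => pP mp fp ep [pQ mq fq eq].
have sp := proj1 (limg_fullP _) fp; have sq := proj1 (limg_fullP _) fq.
have [h mh hE] := proj_lift_surj pP mq mp sq.
have [h' mh' hE'] := proj_lift_surj pQ mp mq sp.
have hs : forall y, exists x, h x = y.
  apply/(limg_fullP h); apply: eq; first exact: submod_limg.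
  apply/vspaceP => y; have [x <-] := sp y.
  by rewrite memvf -hE memv_img // memv_img ?memvf.
have hs' : forall y, exists x, h' x = y.
  apply/(limg_fullP h'); apply: ep; first exact: submod_limg.
  apply/vspaceP => y; have [x <-] := sq y.
  by rewrite memvf -hE' memv_img // memv_img ?memvf.
exists h; split=> //; apply: bij_of_dim hs _; exact: surj_dim hs'.
Qed.

End OneCover.

End Covers.

(** * Directedness in terms of radical maps between projective covers *)

Section DirectedCriterion.

Variables (k : fieldType) (A : falgType k) (I : finType) (S : I -> fmod A) (le : rel I).
Implicit Types (P Q D : fmod A).
Hypotheses (simS : is_Sim S) (le_refl : reflexive le) (le_anti : antisymmetric le).

Let simple_S i : simple (S i). Proof. by case: simS. Qed.

Lemma cover_hom_Sim i j P (p : 'Hom(P, S i)) (f : 'Hom(P, S j)) :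
  projective_cover p -> mlinear f -> f <> 0 -> i = j.
Proof.
move=> cp mf /lfun_neq0[x fx].
by have [_ h _] := simS; apply: h; have [_] := cover_hom cp (simple_S i) (simple_S j) mf fx.
Qed.

Lemma standard_unique i D D' : is_standard S le i D -> is_standard S le i D' -> miso D D'.
Proof.
case=> P [p [U [sU [cp tU iD]]]] [P' [p' [U' [sU' [cp' tU' iD']]]]].
apply: miso_trans iD _; apply: miso_trans (miso_sym iD').
have [h [mh bh _]] := cover_iso cp cp'.
have [h' [mh' hK hK']] := bij_mlinear_inv mh bh.
have hU x : x \in U -> h x \in U'.
  move=> Ux; rewrite memv_preim; move: x Ux; apply/subvP; apply: (proj2 tU).
  move=> j Q q f nle cq mf; apply/subvP=> _ /memv_limgP[y ->].
  rewrite -memv_preim -comp_lfunE.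
  have := proj1 tU' j Q q (h \o f)%VF nle cq (mlinear_comp mh mf).
  by move/subvP; apply; rewrite memv_img ?memvf.
have hU' x : x \in U' -> h' x \in U.
  move=> Ux; rewrite memv_preim; move: x Ux; apply/subvP; apply: (proj2 tU').
  move=> j Q q f nle cq mf; apply/subvP=> _ /memv_limgP[y ->].
  rewrite -memv_preim -comp_lfunE.
  have := proj1 tU j Q q (h' \o f)%VF nle cq (mlinear_comp mh' mf).
  by move/subvP; apply; rewrite memv_img ?memvf.
have [||g mg gE] := @quo_lift _ _ _ _ sU (quo_mod sU') (quo_pi U' \o h)%VF.
- apply: mlinear_comp mh; exact: mlinear_quo_pi.
- by move=> x /hU hx; rewrite comp_lfunE; apply/eqP; rewrite quo_pi_eq0.
exists g => //; apply: lfun_bij => y.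
  have [x <-] := quo_pi_surj y; rewrite gE comp_lfunE => /eqP.
  rewrite quo_pi_eq0 => /hU'; rewrite hK => Ux; apply/eqP; by rewrite quo_pi_eq0.
have [x <-] := quo_pi_surj y; exists (quo_pi U (h' x)).
by rewrite gE comp_lfunE hK'.
Qed.

Lemma quasi_hereditary_cover : quasi_hereditary S le ->
  forall i, exists P (p : 'Hom(P, S i)), projective_cover p.
Proof. by case=> _ _ _ h i; have [P [p [U [sU [cp _ _ _]]]]] := h i; exists P, p. Qed.

Lemma simple_standard i D : is_standard S le i D -> simple D -> miso (S i) D.
Proof.
case=> P [p [U [sU [cp _ iD]]]] sD.
have sQ : simple (quo_mod sU) := simple_miso iD sD.
apply: miso_trans (miso_sym iD).
have [y y0] := simple_neq0 sQ; have [x e] := quo_pi_surj y.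
rewrite -e in y0.
by have [_] := cover_hom cp (simple_S i) sQ (mlinear_quo_pi sU) y0.
Qed.

(** Directedness without standard modules or filtrations: only P(j) with i < j map nontrivially into
    the radical of P(i). In this form it can be checked on tensor products and on opposite
    algebras. *)
Definition radical_homs_increase : Prop :=
  forall i j P Q (p : 'Hom(P, S i)) (q : 'Hom(Q, S j)) (f : 'Hom(Q, P)),
    projective_cover p -> projective_cover q -> mlinear f -> f <> 0 ->
    (forall x, p (f x) = 0) -> le i j /\ j != i.

(** When Delta(i) is simple, the kernel of P(i) -> Delta(i) is the radical, and its filtration has
    simple layers of index above i. A nonzero map from P(j) into the radical hits one of these
    layers, which is then S j. *)
Lemma directed_radical : directed S le -> radical_homs_increase.
Proof.
move=> [[_ _ _ qh] sst] i j P Q p q f cp cq mf nf pf.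
have [P1 [p1 [U1 [sU1 [cp1 tU1 _ [m [F [F0 Fm sF lF]]]]]]]] := qh i.
have [h [mh bh hE]] := cover_iso cp cp1.
have st1 : is_standard S le i (quo_mod sU1).
  by exists P1, p1, U1, sU1; split=> //; apply: miso_refl.
have sQ1 := sst _ _ st1.
have kU1 : U1 = lker p1.
  have [y y0] := simple_neq0 sQ1; have [x e] := quo_pi_surj y.
  rewrite -e in y0; have [<- _] := cover_hom cp1 (simple_S i) sQ1 (mlinear_quo_pi sU1) y0.
  by apply/vspaceP=> z; rewrite memv_ker quo_pi_eq0.
pose f1 := (h \o f)%VF; have mf1 : mlinear f1 by apply: mlinear_comp.
have f1U : (limg f1 <= F m)%VS.
  rewrite Fm kU1; apply/subvP=> _ /memv_limgP[x ->].
  by rewrite memv_ker comp_lfunE hE pf.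
have nf1 : f1 <> 0.
  move=> e; apply: nf; apply/lfunP=> x; apply: (bij_inj bh).
  by rewrite -comp_lfunE -/f1 e !zero_lfunE linear0.
(* The step of the filtration at which the image of [f1] becomes contained. *)
have {f1U}: exists t, (t < m)%N && (limg f1 <= F t.+1)%VS && ~~ (limg f1 <= F t)%VS.
  elim: m F0 f1U {Fm sF lF} => [F0 | m IHm F0 lm].
    rewrite F0 subv0 => /eqP e; case: nf1; apply/lfunP=> x; apply/eqP.
    by rewrite zero_lfunE -memv0 -e memv_img ?memvf.
  have [/(IHm F0)[t /andP[/andP[lt l1] l2]] | nl] := boolP (limg f1 <= F m)%VS.
    by exists t; rewrite ltnS (ltnW lt) l1 l2.
  by exists m; rewrite ltnS leqnn lm nl.
case=> t /andP[/andP[lt l1] l2].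
have [_ [j' [D [lij nij sD [g [mg gF gK]]]]]] := lF t lt.
have iD := simple_standard sD (sst _ _ sD).
have mgf : mlinear (g \o f1)%VF.
  move=> a x; rewrite !comp_lfunE mf mh mg //.
  by rewrite -comp_lfunE (subvP l1) // memv_img ?memvf.
have [_ /memv_limgP[x ->] nx] := subvPn l2.
have gx : (g \o f1)%VF x != 0.
  apply: contra nx => /eqP e; rewrite -gK memv_cap (subvP l1) ?memv_img ?memvf //.
  by rewrite /= memv_ker -comp_lfunE e.
have [_ jD] := cover_hom cq (simple_S j) (sst _ _ sD) mgf gx.
have [_ inj _] := simS.
by rewrite (inj _ _ (miso_trans jD (miso_sym iD))).
Qed.

(** Lifting the cover of a composition factor S j of the radical of P(i) gives a nonzero radical
    map, so i < j. Hence the radical is the trace defining Delta(i), Delta(i) is simple, and a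
    composition series of the radical is the required filtration. *)
Lemma directed_criterion : transitive le ->
  (forall i, exists P (p : 'Hom(P, S i)), projective_cover p) ->
  (forall i, scalar_end (S i)) -> radical_homs_increase -> directed S le.
Proof.
move=> le_trans cov sc rad.
have [_ inj compl] := simS.
have st i P (p : 'Hom(P, S i)) (sU : submod (lker p)) :
    projective_cover p -> is_trace S le i (lker p) /\ miso (S i) (quo_mod sU).
  move=> cp; have [pP mp fp ep] := cp; split; first split.
  - move=> j Q q f nle cq mf; apply/subvP=> _ /memv_limgP[x ->].
    rewrite memv_ker; apply: contraT => pfx.
    have e : j = i.
      apply: (@cover_hom_Sim j i Q q (p \o f)%VF cq); first exact: mlinear_comp.
      by move=> e; move: pfx; rewrite -comp_lfunE e zero_lfunE eqxx.
    by rewrite e le_refl in nle.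
  (* If [W] missed part of the radical, a simple factor of the radical would sit just above its
     intersection with the core [V]; but the lifted cover of that factor has its image in [W], hence
     in [V]. *)
  - move=> W cW; have [V [sV VW mV]] := submod_core W.
    have sK := submodI sU sV.
    have [<-|ne] := classic ((lker p :&: V)%VS = lker p).
      exact: subv_trans (capvSr _ _) VW.
    have [V1 [D [sV1 /andP[KV VK] nKV sD iD]]] := layer sK sU (capvSl _ _) ne.
    have [j jD] := compl D sD; have [Q [q cq]] := cov j.
    have [pQ mq _ _] := cq.
    have iDj := subquotient_miso iD jD.
    have [g [f [mf fV gf gK]]] := subquotient_lift sV1 iDj pQ mq.
    have [y y0] := simple_neq0 (simple_S j); have [x qx] := cover_surj cq y.
    have fx : f x != 0.
      by apply: contraNneq y0 => e; rewrite -qx -gf e linear0.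
    have [||lij nij] := rad i j P Q p q f cp cq mf.
    - by move=> e; rewrite e zero_lfunE eqxx in fx.
    - by move=> z; apply/eqP; rewrite -memv_ker (subvP VK).
    have nle : ~~ le j i.
      by apply: contra nij => lji; apply/eqP/le_anti; rewrite lji lij.
    have fVV : (limg f <= V)%VS by apply: mV; [apply: submod_limg | apply: cW cq mf].
    case/negP: y0; rewrite -qx -gf -memv_ker.
    suff : f x \in (V1 :&: lker g)%VS by rewrite memv_cap => /andP[].
    rewrite gK memv_cap (subvP VK) //= (subvP fVV) // memv_img ?memvf //.
  have [||g mg gE] := @quo_lift _ _ _ _ sU (S i) p => //.
    by move=> x; rewrite memv_ker => /eqP.
  apply: miso_sym; exists g => //; apply: lfun_bij => y.
    have [x <-] := quo_pi_surj y; rewrite gE => /eqP px.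
    by apply/eqP; rewrite quo_pi_eq0 memv_ker px.
  by have [x <-] := cover_surj cp y; exists (quo_pi (lker p) x); rewrite gE.
have stS j : is_standard S le j (S j).
  have [Q [q cq]] := cov j; have [_ mq _ _] := cq.
  have sU := submod_ker mq; have [tU iS] := st j Q q sU cq.
  by exists Q, q, (lker q), sU.
split; last first.
  by move=> i D sD; apply: simple_miso (simple_S i); apply: standard_unique sD.
split=> // i; have [P [p cp]] := cov i; have [_ mp _ _] := cp.
have sU := submod_ker mp; have [tU iS] := st i P p sU cp.
exists P, p, (lker p), sU; split=> //.
  have [x x0] := simple_neq0 (simple_miso iS (simple_S i)).
  exact: end_iso_fieldP x0 (scalar_end_miso iS (sc i)).
have [m [F [F0 Fm sF lF]]] := composition_series (@submod0 _ _ P) sU (sub0v _).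
exists m, F; split=> // t lt; have [l1 l2 nF [D sD iD]] := lF t lt; split=> //.
have [j jD] := compl D sD; exists j, (S j).
have iDj := subquotient_miso iD jD.
have [Q [q cq]] := cov j; have [pQ mq _ _] := cq.
have [g [f [mf fV gf gK]]] := subquotient_lift (sF _ lt) iDj pQ mq.
have [y y0] := simple_neq0 (simple_S j); have [x qx] := cover_surj cq y.
have [||lij nij] := rad i j P Q p q f cp cq mf; last by split.
  move=> e; case/eqP: y0; by rewrite -qx -gf e zero_lfunE linear0.
by move=> z; apply/eqP; rewrite -memv_ker (subvP l2).
Qed.

End DirectedCriterion.

(** * Projective resolutions and comparison maps on Ext *)

Section FreeModules.

Variables (k : fieldType) (A : falgType k).

Section Free.

Variable V : vectType k.

Definition freem_act (a : A) : tens A V -> tens A V :=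
  tlift (fun (b : A) (x : V) => (a * b) ⊗ x).

Lemma freem_act_pure a b x : freem_act a (b ⊗ x) = (a * b) ⊗ x.
Proof.
rewrite /freem_act tlift_pure // => [w|v] c y z.
  by rewrite mulrDr -scalerAr pure_linear_l.
by rewrite pure_linear_r.
Qed.

Fact freem_act_linear a : linear (freem_act a).
Proof. exact: tlift_is_linear. Qed.

Fact freem_act_linear_l y : linear (freem_act^~ y).
Proof.
move=> c a b; rewrite /freem_act -tlift_linear_fun; apply: tlift_ext => d x.
by rewrite mulrDl -scalerAl pure_linear_l.
Qed.

Fact freem_act1 y : freem_act 1 y = y.
Proof.
move: y; apply: (tens_ext (g := id)) => //; first exact: freem_act_linear.
by move=> b x; rewrite freem_act_pure mul1r.
Qed.

Fact freem_actM a b y : freem_act (a * b) y = freem_act a (freem_act b y).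
Proof.
move: y; apply: (tens_ext (g := fun y => freem_act a (freem_act b y))).
- exact: freem_act_linear.
- by move=> c u v; rewrite !freem_act_linear.
by move=> d x; rewrite !freem_act_pure mulrA.
Qed.

(** The free module A ⊗_k V. In contrast to [free_mod], [V] is a mere vector space and no subalgebra
    enters. *)
Definition freem : fmod A :=
  Fmod freem_act_linear freem_act_linear_l freem_act1 freem_actM.

Lemma freem_lift (N : fmod A) (s : 'Hom(V, N)) :
  exists2 l : 'Hom(freem, N), mlinear l & forall a x, l (a ⊗ x) = a ∙ s x.
Proof.
pose l : 'Hom(freem, N) := linfun (tlift (fun (a : A) x => a ∙ s x)).
have lE a x : l (a ⊗ x) = a ∙ s x.
  rewrite linfunE; last exact: tlift_is_linear.
  rewrite tlift_pure // => [y | b] c u v; first by rewrite actDl actZl.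
  by rewrite linearP actDr actZr.
exists l => // a; apply: tens_ext => [c u v | c u v | b x].
- by rewrite actDr actZr linearP.
- by rewrite linearP actDr actZr.
by rewrite [a ∙ _]freem_act_pure !lE actM.
Qed.

Lemma freem_ext (N : fmod A) (f g : 'Hom(freem, N)) : mlinear f -> mlinear g ->
  (forall x, f (1 ⊗ x) = g (1 ⊗ x)) -> forall z, f z = g z.
Proof.
move=> mf mg e; apply: tens_ext => [c u v | c u v | a x]; rewrite ?linearP //.
have -> : a ⊗ x = a ∙ (1 ⊗ x : freem) by rewrite [a ∙ _]freem_act_pure mulr1.
by rewrite mf mg e.
Qed.

Lemma freem_projective : projective freem.
Proof.
move=> M N g h mg /limg_fullP sg mh; have [s sE] := lfun_section sg.
have [l ml lE] := freem_lift (linfun (fun x => s (h (1 ⊗ x)))).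
exists l => //; apply/lfunP; apply: freem_ext => // [|x].
  exact: mlinear_comp.
rewrite comp_lfunE lE act1 linfunE ?sE // => c u v.
by rewrite pure_linear_r !linearP.
Qed.

End Free.

Definition free_cover (M : fmod A) : 'Hom(freem M, M) := linfun (tlift (fun a x => a ∙ x)).

Lemma free_coverE (M : fmod A) (a : A) (x : M) : free_cover M (a ⊗ x) = a ∙ x.
Proof.
rewrite linfunE; last exact: tlift_is_linear.
by rewrite tlift_pure // => [y | b] c u v; rewrite ?actDl ?actDr ?actZl ?actZr.
Qed.

Lemma free_cover_mlinear (M : fmod A) : mlinear (free_cover M).
Proof.
move=> a; apply: tens_ext => [c u v | c u v | b x].
- by rewrite actDr actZr linearP.
- by rewrite linearP actDr actZr.
by rewrite [a ∙ _]freem_act_pure !free_coverE actM.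
Qed.

Lemma free_cover_surj (M : fmod A) (y : M) : exists x, free_cover M x = y.
Proof. by exists (1 ⊗ y); rewrite free_coverE act1. Qed.

(** A map bundled with its linearity, so that covering its kernel by a free module is an operation
    that can be iterated. *)
Record stage := Stage {
  stage_dom : fmod A; stage_cod : fmod A;
  stage_map : 'Hom(stage_dom, stage_cod); stage_mlinear : mlinear stage_map }.

Definition stage_ker (s : stage) := subm (submod_ker (@stage_mlinear s)).

Definition stage_next_map s : 'Hom(freem (stage_ker s), stage_dom s) :=
  (subm_val (submod_ker (@stage_mlinear s)) \o free_cover (stage_ker s))%VF.

Lemma stage_next_mlinear s : mlinear (stage_next_map s).
Proof.
by move=> a x; rewrite !comp_lfunE free_cover_mlinear mlinear_subm_val.
Qed.

Definition stage_next s := Stage (@stage_next_mlinear s).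

Lemma stage_exact s : limg (stage_next_map s) = lker (stage_map s).
Proof.
apply/vspaceP=> y; apply/memv_limgP/idP => [[x ->] | ky].
  by rewrite comp_lfunE subm_valP.
have [z <-] := subm_ex (submod_ker (@stage_mlinear s)) ky.
by have [x <-] := free_cover_surj z; exists x; rewrite comp_lfunE.
Qed.

Definition cons_mod (P0 : fmod A) (P : nat -> fmod A) n :=
  if n is m.+1 then P m else P0.

Definition cons_diff (P0 : fmod A) (P : nat -> fmod A) (d0 : 'Hom(P 0%N, P0)) (d : forall n, 'Hom(P n.+1, P n)) n :
    'Hom(cons_mod P0 P n.+1, cons_mod P0 P n) :=
  match n with 0 => d0 | m.+1 => d m end.

(** The term in degree zero is prescribed, because Ext^1 will be computed with a projective cover
    there. *)
Lemma resolution_from (M P0 : fmod A) (e : 'Hom(P0, M)) :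
  projective P0 -> mlinear e -> (forall y, exists x, e x = y) ->
  exists (P : nat -> fmod A) (d0 : 'Hom(P 0%N, P0)) (d : forall n, 'Hom(P n.+1, P n)),
    @projective_resolution k A M (cons_mod P0 P) (cons_diff d0 d) e.
Proof.
move=> pP me se; pose s := Stage me.
pose S n := iter n stage_next (stage_next s).
exists (fun n => stage_dom (S n)), (stage_next_map s), (fun n => stage_next_map (S n)).
have pS n : projective (stage_dom (S n)).
  by case: n => [|n]; apply: freem_projective.
split=> //; first by case.
- by case=> [|n]; apply: stage_next_mlinear.
- exact/limg_fullP.
split; first exact: (stage_exact s).
case=> [|n]; first exact: (stage_exact (stage_next s)).
exact: (stage_exact (S n.+1)).
Qed.

Lemma resolution_exists (M : fmod A) :
  exists (P : nat -> fmod A) (d : forall n, 'Hom(P n.+1, P n)) (e : 'Hom(P 0%N, M)), projective_resolution d e.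
Proof.
have [P [d0 [d r]]] := resolution_from (freem_projective (V := M)) (free_cover_mlinear (M := M))
  (@free_cover_surj M).
by exists (cons_mod (freem M) P), (cons_diff d0 d), (free_cover M).
Qed.

End FreeModules.

(** Chain maps and homotopies are built degree by degree in a dependent family: [Inv] makes the next
    step solvable, [R] links consecutive terms. *)
Lemma dependent_choice_seq (T : nat -> Type) (Inv : forall n, T n -> Prop)
    (R : forall n, T n -> T n.+1 -> Prop) (x0 : T 0%N) : Inv 0%N x0 ->
  (forall n x, Inv n x -> exists y, R n x y /\ Inv n.+1 y) ->
  exists s : forall n, T n, s 0%N = x0 /\ forall n, R n (s n) (s n.+1).
Proof.
move=> i0 step.
have nxt n (x : {x : T n | Inv n x}) :
    {y : {y : T n.+1 | Inv n.+1 y} | R n (sval x) (sval y)}.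
  have h := constructive_indefinite_description _ (step n (sval x) (svalP x)).
  exact: (exist _ (exist _ (sval h) (proj2 (svalP h))) (proj1 (svalP h))).
pose s := fix s n : {x : T n | Inv n x} :=
  match n with 0 => exist _ x0 i0 | m.+1 => sval (nxt m (s m)) end.
exists (fun n => sval (s n)); split=> // n; exact: (svalP (nxt n (s n))).
Qed.

Section Resolutions.

Variables (k : fieldType) (A : falgType k).
Implicit Types (M N X : fmod A).

Section Facts.

Variables (M : fmod A) (P : nat -> fmod A) (d : forall n, 'Hom(P n.+1, P n)) (e : 'Hom(P 0%N, M)).
Hypothesis r : projective_resolution d e.

Lemma res_projective n : projective (P n). Proof. by case: r. Qed.
Lemma res_mlinear n : mlinear (d n). Proof. by case: r. Qed.
Lemma res_aug_mlinear : mlinear e. Proof. by case: r. Qed.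

Lemma res_dd n x : d n (d n.+1 x) = 0.
Proof.
case: r => _ _ _ _ [_ ex]; apply/eqP; rewrite -memv_ker -ex.
by rewrite memv_img ?memvf.
Qed.

Lemma res_ed x : e (d 0%N x) = 0.
Proof.
case: r => _ _ _ _ [ex _]; apply/eqP; rewrite -memv_ker -ex.
by rewrite memv_img ?memvf.
Qed.

Lemma res_exact n x : d n x = 0 -> exists y, d n.+1 y = x.
Proof.
case: r => _ _ _ _ [_ ex] /eqP; rewrite -memv_ker -ex.
by case/memv_limgP=> y ->; exists y.
Qed.

Lemma res_exact0 x : e x = 0 -> exists y, d 0%N y = x.
Proof.
case: r => _ _ _ _ [ex _] /eqP; rewrite -memv_ker -ex.
by case/memv_limgP=> y ->; exists y.
Qed.

Lemma res_surj y : exists x, e x = y.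
Proof. by case: r => _ _ _ /limg_fullP. Qed.

End Facts.

Section Comparison.

Variables (M : fmod A) (P : nat -> fmod A) (d : forall n, 'Hom(P n.+1, P n)) (e : 'Hom(P 0%N, M)).
Variables (M' : fmod A) (P' : nat -> fmod A) (d' : forall n, 'Hom(P' n.+1, P' n)) (e' : 'Hom(P' 0%N, M')).
Hypotheses (r : projective_resolution d e) (r' : projective_resolution d' e').

Lemma chain_lift (f : 'Hom(M, M')) : mlinear f ->
  exists chi : forall n, 'Hom(P n, P' n),
    [/\ forall n, mlinear (chi n), forall x, e' (chi 0%N x) = f (e x)
      & forall n x, d' n (chi n.+1 x) = chi n (d n x)].
Proof.
move=> mf.
have [c0 mc0 c0E] := proj_lift_surj (res_projective r (n := 0%N)) (res_aug_mlinear r')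
  (mlinear_comp mf (res_aug_mlinear r)) (res_surj r').
(* The second half says that [c] sends boundaries to boundaries, so that the next lift exists. *)
pose Inv n (c : 'Hom(P n, P' n)) := mlinear c /\ forall x, c (d n x) \in limg (d' n).
pose R n (c : 'Hom(P n, P' n)) (c' : 'Hom(P n.+1, P' n.+1)) :=
  mlinear c' /\ forall x, d' n (c' x) = c (d n x).
have [||chi [chi0 chiR]] := @dependent_choice_seq (fun n => 'Hom(P n, P' n)) Inv R c0.
- split=> // x; apply/memv_limgP.
  have [y ye] : exists y, d' 0%N y = c0 (d 0%N x).
    by apply: (res_exact0 r'); rewrite c0E comp_lfunE (res_ed r) linear0.
  by exists y.
- move=> n c [mc ci].
  have [|l ml lE] := proj_lift (res_projective r (n := n.+1)) (res_mlinear r' (n := n))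
    (mlinear_comp mc (res_mlinear r (n := n))).
    by move=> x; rewrite comp_lfunE ci.
  exists l; split; first by split=> // x; rewrite lE comp_lfunE.
  split=> // x; apply/memv_limgP.
  have [y ye] : exists y, d' n.+1 y = l (d n.+1 x).
    by apply: (res_exact r'); rewrite lE comp_lfunE (res_dd r) linear0.
  by exists y.
exists chi; split.
- by case=> [|n]; [rewrite chi0 | have [] := chiR n].
- by move=> x; rewrite chi0 c0E comp_lfunE.
by move=> n; have [] := chiR n.
Qed.

Lemma chain_homotopy (chi : forall n, 'Hom(P n, P' n)) :
    (forall n, mlinear (chi n)) -> (forall x, e' (chi 0%N x) = 0) ->
    (forall n x, d' n (chi n.+1 x) = chi n (d n x)) ->
  exists h : forall n, 'Hom(P n, P' n.+1),
    [/\ forall n, mlinear (h n), forall x, chi 0%N x = d' 0%N (h 0%N x)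
      & forall n x, chi n.+1 x = d' n.+1 (h n.+1 x) + h n (d n x)].
Proof.
move=> mchi e0 cc.
have [|h0 mh0 h0E] := proj_lift (res_projective r (n := 0%N)) (res_mlinear r' (n := 0%N)) (mchi 0%N).
  move=> x; apply/memv_limgP; have [y ye] := res_exact0 r' (e0 x); by exists y.
(* By the invariant, [chi - h d] in the next degree is killed by [d'], so it lifts once more. *)
pose Inv n (h : 'Hom(P n, P' n.+1)) := mlinear h /\ forall x, d' n (h (d n x)) = chi n (d n x).
pose R n (h : 'Hom(P n, P' n.+1)) (h' : 'Hom(P n.+1, P' n.+2)) :=
  mlinear h' /\ forall x, chi n.+1 x = d' n.+1 (h' x) + h (d n x).
have [||h [hh0 hR]] := @dependent_choice_seq (fun n => 'Hom(P n, P' n.+1)) Inv R h0.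
- by split=> // x; rewrite h0E.
- move=> n h [mh hi].
  have [|l ml lE] := proj_lift (res_projective r (n := n.+1)) (res_mlinear r' (n := n.+1))
    (mlinearB (mchi n.+1) (mlinear_comp mh (res_mlinear r (n := n)))).
    move=> x; rewrite add_lfunE opp_lfunE comp_lfunE; apply/memv_limgP.
    have [y ye] : exists y, d' n.+1 y = chi n.+1 x - h (d n x).
      by apply: (res_exact r'); rewrite linearB /= cc hi subrr.
    by exists y.
  exists l; split.
    by split=> // x; rewrite lE add_lfunE opp_lfunE comp_lfunE subrK.
  split=> // x.
  by rewrite lE add_lfunE opp_lfunE comp_lfunE (res_dd r) linear0 subr0.
exists h; split.
- by case=> [|n]; [rewrite hh0 | have [] := hR n].
- by move=> x; rewrite hh0 h0E.
by move=> n; have [] := hR n.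
Qed.

End Comparison.

(** * Maps on Ext induced by the coefficients: change of coefficients and of resolution *)

Section ExtMaps.

Variables (N X : fmod A) (eta : 'Hom(N, X)) (P : nat -> fmod A).
Variable d : forall n, 'Hom(P n.+1, P n).

(** For a resolution of M this is injectivity of Ext^n(M, N) -> Ext^n(M, X), and [coef_epi] is
    surjectivity. After Shapiro's lemma [eta] will be a unit N -> A ⊗_B N. *)
Definition coef_mono n : Prop := forall f : 'Hom(P n, N),
  cocycle d f -> coboundary d (eta \o f)%VF -> coboundary d f.

Definition coef_epi n : Prop := forall F : 'Hom(P n, X), cocycle d F ->
  exists2 f : 'Hom(P n, N), cocycle d f & coboundary d (F - (eta \o f)%VF).

End ExtMaps.

Section TransportN.

Variables (N X : fmod A) (eta : 'Hom(N, X)) (K : finType) (Nc Xc : K -> fmod A).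
Variables (etac : forall c, 'Hom(Nc c, Xc c)).
Variables (ic : forall c, 'Hom(Nc c, N)) (pc : forall c, 'Hom(N, Nc c)).
Variables (Ic : forall c, 'Hom(Xc c, X)) (Pc : forall c, 'Hom(X, Xc c)).
Hypotheses (mic : forall c, mlinear (ic c)) (mpc : forall c, mlinear (pc c)).
Hypotheses (mIc : forall c, mlinear (Ic c)) (mPc : forall c, mlinear (Pc c)).
Hypotheses (idN : forall x, \sum_c ic c (pc c x) = x) (idX : forall x, \sum_c Ic c (Pc c x) = x).
Hypotheses (etai : forall c x, eta (ic c x) = Ic c (etac c x)).
Hypotheses (etap : forall c x, etac c (pc c x) = Pc c (eta x)).

Variables (P : nat -> fmod A) (d : forall n, 'Hom(P n.+1, P n)).

Lemma cocycleP N' n (f : 'Hom(P n, N')) :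
  cocycle d f <-> mlinear f /\ forall x, f (d n x) = 0.
Proof.
split=> -[mf e]; split=> //; last by apply/lfunP=> x; rewrite comp_lfunE zero_lfunE.
by move=> x; rewrite -comp_lfunE e zero_lfunE.
Qed.

Lemma coboundaryP N' n (f : 'Hom(P n.+1, N')) :
  coboundary d f <-> exists2 g : 'Hom(P n, N'), mlinear g & forall x, f x = g (d n x).
Proof.
split=> -[g mg e]; exists g => //; last by apply/lfunP=> x; rewrite comp_lfunE.
by move=> x; rewrite e comp_lfunE.
Qed.

Lemma transport_coef_mono n :
  (forall c, coef_mono (etac c) d n.+1) -> coef_mono eta d n.+1.
Proof.
move=> h f /cocycleP[mf fd] /coboundaryP[G mG GE].
have hc c : exists g : 'Hom(P n, Nc c), mlinear g /\ forall x, pc c (f x) = g (d n x).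
  have /coboundaryP[g mg e] : coboundary d (pc c \o f)%VF.
    apply: h.
      apply/cocycleP; split; first exact: mlinear_comp.
      by move=> x; rewrite comp_lfunE fd linear0.
    apply/coboundaryP; exists (Pc c \o G)%VF; first exact: mlinear_comp.
    by move=> x; rewrite !comp_lfunE etap -GE comp_lfunE.
  by exists g; split=> // x; rewrite -e comp_lfunE.
have [g gE] := fin_all_exists hc.
apply/coboundaryP; exists (\sum_c (ic c \o g c))%VF.
  by apply: mlinear_sum => c; apply: mlinear_comp => //; have [] := gE c.
move=> x; rewrite sum_lfunE -[LHS]idN; apply: eq_bigr => c _.
by rewrite comp_lfunE; have [_ ->] := gE c.
Qed.

Lemma transport_coef_epi n :
  (forall c, coef_epi (etac c) d n.+1) -> coef_epi eta d n.+1.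
Proof.
move=> h F /cocycleP[mF Fd].
have hc c : exists f : 'Hom(P n.+1, Nc c), exists G : 'Hom(P n, Xc c),
   [/\ mlinear f, forall x, f (d n.+1 x) = 0, mlinear G &
       forall x, Pc c (F x) = etac c (f x) + G (d n x)].
  have [|f /cocycleP[mf fd] /coboundaryP[G mG GE]] := h c (Pc c \o F)%VF.
    apply/cocycleP; split; first exact: mlinear_comp.
    by move=> x; rewrite comp_lfunE Fd linear0.
  exists f, G; split=> // x.
  by rewrite -GE add_lfunE opp_lfunE !comp_lfunE addrC subrK.
have {hc} [f hc] := fin_all_exists hc; have [G hG] := fin_all_exists hc.
exists (\sum_c (ic c \o f c))%VF.
  apply/cocycleP; split.
    by apply: mlinear_sum => c; apply: mlinear_comp => //; have [] := hG c.
  move=> x; rewrite sum_lfunE big1 // => c _; rewrite comp_lfunE.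
  by have [_ -> _ _] := hG c; rewrite linear0.
apply/coboundaryP; exists (\sum_c (Ic c \o G c))%VF.
  by apply: mlinear_sum => c; apply: mlinear_comp => //; have [] := hG c.
move=> x; rewrite add_lfunE opp_lfunE comp_lfunE -[F x]idX.
rewrite !sum_lfunE linear_sum /= -sumrB; apply: eq_bigr => c _.
have [_ _ _ ->] := hG c; rewrite !comp_lfunE etai linearD /=.
by rewrite addrC addKr.
Qed.

End TransportN.

Section TransportM.

Variables (N X : fmod A) (eta : 'Hom(N, X)) (meta : mlinear eta) (M : fmod A) (K : finType) (Ma : K -> fmod A).
Variables (ia : forall a, 'Hom(Ma a, M)) (pa : forall a, 'Hom(M, Ma a)).
Hypotheses (mia : forall a, mlinear (ia a)) (mpa : forall a, mlinear (pa a)).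
Hypothesis idM : forall x, \sum_a ia a (pa a x) = x.

Variables (P : nat -> fmod A) (d : forall n, 'Hom(P n.+1, P n)) (e : 'Hom(P 0%N, M)).
Variables (Pa : K -> nat -> fmod A) (da : forall a n, 'Hom(Pa a n.+1, Pa a n)) (ea : forall a, 'Hom(Pa a 0%N, Ma a)).
Hypotheses (r : projective_resolution d e) (ra : forall a, projective_resolution (da a) (ea a)).

(** The identity of [P] and the sum of the composites through the [Pa a] both lift the identity of
    [M], hence are homotopic. *)
Lemma transport_chain : exists (chi : forall a n, 'Hom(Pa a n, P n)) (psi : forall a n, 'Hom(P n, Pa a n))
    (h : forall n, 'Hom(P n, P n.+1)),
  [/\ (forall a n, mlinear (chi a n)) /\ (forall a n, mlinear (psi a n)),
      forall a n x, d n (chi a n.+1 x) = chi a n (da a n x),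
      forall a n x, da a n (psi a n.+1 x) = psi a n (d n x),
      forall n, mlinear (h n)
    & forall n x, x = \sum_a chi a n.+1 (psi a n.+1 x) + (d n.+1 (h n.+1 x) + h n (d n x))].
Proof.
have [chi chiP] := fin_all_exists (fun a => chain_lift (ra a) r (@mia a)).
have [psi psiP] := fin_all_exists (fun a => chain_lift r (ra a) (@mpa a)).
pose th n : 'Hom(P n, P n) := \1%VF - \sum_a (chi a n \o psi a n)%VF.
have thE n x : th n x = x - \sum_a chi a n (psi a n x).
  rewrite add_lfunE opp_lfunE id_lfunE sum_lfunE; congr (_ - _).
  by apply: eq_bigr => a _; rewrite comp_lfunE.
have [|||h [mh _ hE]] := @chain_homotopy _ _ _ _ _ _ _ _ r r th.
- move=> n; apply: mlinearB; first exact: mlinear_id.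
  apply: mlinear_sum => a; apply: mlinear_comp.
    by have [] := chiP a.
  by have [] := psiP a.
- move=> x; rewrite thE linearB /= linear_sum /= -[X in X - _](idM) -sumrB big1 // => a _.
  have [_ -> _] := chiP a; have [_ -> _] := psiP a; by rewrite subrr.
- move=> n x; rewrite !thE linearB /= linear_sum /=; congr (_ - _).
  apply: eq_bigr => a _; have [_ _ ->] := chiP a; by have [_ _ ->] := psiP a.
exists chi, psi, h; split=> //.
- by split=> a n; [have [] := chiP a | have [] := psiP a].
- by move=> a n x; have [_ _ ->] := chiP a.
- by move=> a n x; have [_ _ ->] := psiP a.
by move=> n x; rewrite -hE thE addrC subrK.
Qed.

(** On a cocycle the homotopy contributes a coboundary, so the class of [f] is the sum of its
    restrictions along [chi a] pulled back along [psi a]. *)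
Lemma transport_res_mono n :
  (forall a, coef_mono eta (da a) n.+1) -> coef_mono eta d n.+1.
Proof.
have [chi [psi [h [[mchi mpsi] cchi cpsi mh hE]]]] := transport_chain.
move=> mono f /cocycleP[mf fd] /coboundaryP[G mG GE].
have hc a : exists g : 'Hom(Pa a n, N), mlinear g /\ forall x, f (chi a n.+1 x) = g (da a n x).
  have /coboundaryP[g mg gE] : coboundary (da a) (f \o chi a n.+1)%VF.
    apply: mono.
      apply/cocycleP; split; first exact: mlinear_comp.
      by move=> x; rewrite comp_lfunE -cchi fd.
    apply/coboundaryP; exists (G \o chi a n)%VF; first exact: mlinear_comp.
    by move=> x; rewrite !comp_lfunE -cchi -GE comp_lfunE.
  by exists g; split=> // x; rewrite -gE comp_lfunE.
have [g gE] := fin_all_exists hc.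
apply/coboundaryP; exists (\sum_a (g a \o psi a n)%VF + (f \o h n)%VF).
  apply: mlinearD; last exact: mlinear_comp.
  by apply: mlinear_sum => a; apply: mlinear_comp => //; have [] := gE a.
move=> x; rewrite {1}[x](hE n) !linearD /= fd add0r linear_sum /= add_lfunE sum_lfunE !comp_lfunE.
congr (_ + _); apply: eq_bigr => a _.
by rewrite comp_lfunE -cpsi; have [_ ->] := gE a.
Qed.

Lemma transport_res_epi n :
  (forall a, coef_epi eta (da a) n.+1) -> coef_epi eta d n.+1.
Proof.
have [chi [psi [h [[mchi mpsi] cchi cpsi mh hE]]]] := transport_chain.
move=> epi F /cocycleP[mF Fd].
have hc a : exists f : 'Hom(Pa a n.+1, N), exists G : 'Hom(Pa a n, X),
   [/\ mlinear f, forall x, f (da a n.+1 x) = 0, mlinear G &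
       forall x, F (chi a n.+1 x) = eta (f x) + G (da a n x)].
  have [|f /cocycleP[mf fd] /coboundaryP[G mG GE]] := epi a (F \o chi a n.+1)%VF.
    apply/cocycleP; split; first exact: mlinear_comp.
    by move=> x; rewrite comp_lfunE -cchi Fd.
  exists f, G; split=> // x.
  by rewrite -GE add_lfunE opp_lfunE !comp_lfunE addrC subrK.
have {hc} [f hc] := fin_all_exists hc; have [G hG] := fin_all_exists hc.
exists (\sum_a (f a \o psi a n.+1))%VF.
  apply/cocycleP; split.
    by apply: mlinear_sum => a; apply: mlinear_comp => //; have [] := hG a.
  move=> x; rewrite sum_lfunE big1 // => a _; rewrite comp_lfunE -cpsi.
  by have [_ -> _ _] := hG a.
apply/coboundaryP; exists (\sum_a (G a \o psi a n)%VF + (F \o h n)%VF).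
  apply: mlinearD; last exact: mlinear_comp.
  by apply: mlinear_sum => a; apply: mlinear_comp => //; have [] := hG a.
move=> x; rewrite add_lfunE opp_lfunE comp_lfunE {1}[x](hE n) !linearD /= Fd add0r.
rewrite !add_lfunE !sum_lfunE !comp_lfunE !linear_sum /= addrAC; congr (_ + _).
rewrite -big_split /=; apply: eq_bigr => a _; rewrite !comp_lfunE.
by have [_ _ _ ->] := hG a; rewrite -cpsi addrC addKr.
Qed.

End TransportM.

End Resolutions.

Section Decompositions.

Variables (k : fieldType) (A : falgType k).
Implicit Types (M N X : fmod A).

(** [M] is a direct summand of the sum of the [Ma]; the composites [p i] are left free. This treats
    direct sums, direct summands and isomorphisms at once, the last two with [K = unit]. *)
Definition decomposition M (K : finType) (Ma : K -> fmod A) : Prop :=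
  exists (i : forall a, 'Hom(Ma a, M)) (p : forall a, 'Hom(M, Ma a)),
    [/\ forall a, mlinear (i a), forall a, mlinear (p a) & forall x, \sum_a i a (p a x) = x].

Lemma decomposition_dsum M N : decomposition (dsum M N) (fun b : bool => if b then M else N).
Proof.
exists (fun b : bool => if b return 'Hom(if b then M else N, dsum M N)
  then linfun (fun x : M => (x, 0 : N)) else linfun (fun x : N => (0 : M, x))).
exists (fun b : bool => if b return 'Hom(dsum M N, if b then M else N)
  then linfun (fun x : dsum M N => x.1) else linfun (fun x : dsum M N => x.2)).
have l1 : linear (fun x : M => (x, 0) : dsum M N).
  by move=> c x y; congr (_, _); rewrite /= ?scaler0 ?addr0.
have l2 : linear (fun x : N => (0, x) : dsum M N).
  by move=> c x y; congr (_, _); rewrite /= ?scaler0 ?addr0.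
have l3 : linear (fun x : dsum M N => x.1) by [].
have l4 : linear (fun x : dsum M N => x.2) by [].
split; [case=> a x | case=> a x | case=> x y].
- by rewrite !(linfunE l1) /act /= /dsum_act /= act0r.
- by rewrite !(linfunE l2) /act /= /dsum_act /= act0r.
- by rewrite !(linfunE l3).
- by rewrite !(linfunE l4).
rewrite big_bool /= !(linfunE l1, linfunE l2, linfunE l3, linfunE l4) /=.
by congr (_, _); rewrite /= ?addr0 ?add0r.
Qed.

Lemma decomposition_zero : decomposition zero_mod (fun a : void => match a with end : fmod A).
Proof.
exists (fun a : void => match a with end), (fun a : void => match a with end).
by split=> // x; rewrite [LHS]thinmx0 [RHS]thinmx0.
Qed.

Lemma decomposition_retract M N (i : 'Hom(N, M)) (p : 'Hom(M, N)) :
  mlinear i -> mlinear p -> (forall x, i (p x) = x) -> decomposition M (fun _ : unit => N).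
Proof.
move=> mi mp ip; exists (fun=> i), (fun=> p); split=> // x.
by rewrite big_const card_unit /= addr0 ip.
Qed.

Lemma decomposition_miso M N : miso M N -> decomposition M (fun _ : unit => N).
Proof.
case=> f mf bf; have [g [mg fK gK]] := bij_mlinear_inv mf bf.
exact: decomposition_retract mg mf fK.
Qed.

Lemma big_dsum_retract (J : eqType) (L : J -> fmod A) (r : seq J) j : j \in r ->
  exists (i : 'Hom(L j, \big[@dsum _ _/zero_mod]_(j <- r) L j))
         (p : 'Hom(\big[@dsum _ _/zero_mod]_(j <- r) L j, L j)),
    [/\ mlinear i, mlinear p & forall x, p (i x) = x].
Proof.
elim: r => // j0 r IHr; rewrite inE big_cons.
set R := \big[_/_]_(_ <- _) _ in IHr *.
have l1 : linear (fun x : L j0 => (x, 0) : dsum (L j0) R).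
  by move=> c x y; congr (_, _); rewrite /= ?scaler0 ?addr0.
have l2 : linear (fun x : R => (0, x) : dsum (L j0) R).
  by move=> c x y; congr (_, _); rewrite /= ?scaler0 ?addr0.
have l3 : linear (fun x : dsum (L j0) R => x.1) by [].
have l4 : linear (fun x : dsum (L j0) R => x.2) by [].
have [-> _ | _ /= /IHr[i [p [mi mp pi]]]] := eqVneq j j0.
  exists (linfun (fun x : L j0 => (x, 0) : dsum (L j0) R)), (linfun (fun x : dsum (L j0) R => x.1)).
  split=> [a x|a x|x].
  - by rewrite !(linfunE l1) /act /= /dsum_act /= act0r.
  - by rewrite !(linfunE l3).
  by rewrite (linfunE l1) (linfunE l3).
exists (linfun (fun x : R => (0, x) : dsum (L j0) R) \o i)%VF.
exists (p \o linfun (fun x : dsum (L j0) R => x.2))%VF.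
split=> [a x|a x|x].
- by rewrite !comp_lfunE mi !(linfunE l2) /act /= /dsum_act /= act0r.
- by rewrite !comp_lfunE !(linfunE l4) -mp.
by rewrite !comp_lfunE (linfunE l2) (linfunE l4) /= pi.
Qed.

(** The quantification over resolutions matches [ext_LB_epi]; by [coef_epi_decomposition] one
    resolution of each piece suffices to prove it. *)
Definition coef_epi_all n N X (eta : 'Hom(N, X)) M : Prop :=
  forall (P : nat -> fmod A) (d : forall n, 'Hom(P n.+1, P n)) (e : 'Hom(P 0%N, M)),
    projective_resolution d e -> coef_epi eta d n.

Definition coef_mono_all n N X (eta : 'Hom(N, X)) M : Prop :=
  forall (P : nat -> fmod A) (d : forall n, 'Hom(P n.+1, P n)) (e : 'Hom(P 0%N, M)),
    projective_resolution d e -> coef_mono eta d n.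

Lemma coef_mono_decomposition n N X (eta : 'Hom(N, X)) M (K : finType) (Ma : K -> fmod A) :
  decomposition M Ma -> (forall a, exists (P : nat -> fmod A) (d : forall n, 'Hom(P n.+1, P n)) (e : 'Hom(P 0%N, Ma a)),
    projective_resolution d e /\ coef_mono eta d n.+1) -> coef_mono_all n.+1 eta M.
Proof.
case=> i [p [mi mp ip]] h P d e r.
have [Pa h1] := fin_all_exists h; have [da h2] := fin_all_exists h1.
have [ea h3] := fin_all_exists h2.
apply: (transport_res_mono mi mp ip r (fun a => (h3 a).1)) => a.
exact: (h3 a).2.
Qed.

Lemma coef_epi_decomposition n N X (eta : 'Hom(N, X)) M (K : finType) (Ma : K -> fmod A) :
  decomposition M Ma -> (forall a, exists (P : nat -> fmod A) (d : forall n, 'Hom(P n.+1, P n)) (e : 'Hom(P 0%N, Ma a)),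
    projective_resolution d e /\ coef_epi eta d n.+1) -> coef_epi_all n.+1 eta M.
Proof.
case=> i [p [mi mp ip]] h P d e r.
have [Pa h1] := fin_all_exists h; have [da h2] := fin_all_exists h1.
have [ea h3] := fin_all_exists h2.
apply: (transport_res_epi mi mp ip r (fun a => (h3 a).1)) => a.
exact: (h3 a).2.
Qed.

Lemma coef_mono_all_decomposition n N X (eta : 'Hom(N, X)) M (K : finType) (Ma : K -> fmod A) :
  decomposition M Ma -> (forall a, coef_mono_all n.+1 eta (Ma a)) -> coef_mono_all n.+1 eta M.
Proof.
move=> dM h; apply: coef_mono_decomposition dM _ => a.
have [P [d [e r]]] := resolution_exists (Ma a); exists P, d, e; split=> //; exact: h r.
Qed.

Lemma coef_epi_all_decomposition n N X (eta : 'Hom(N, X)) M (K : finType) (Ma : K -> fmod A) :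
  decomposition M Ma -> (forall a, coef_epi_all n.+1 eta (Ma a)) -> coef_epi_all n.+1 eta M.
Proof.
move=> dM h; apply: coef_epi_decomposition dM _ => a.
have [P [d [e r]]] := resolution_exists (Ma a); exists P, d, e; split=> //; exact: h r.
Qed.

(** For the resolution concentrated in degree zero every cochain of positive degree is zero; other
    resolutions follow by transport. *)
Lemma coef_projective n N X (eta : 'Hom(N, X)) M : projective M ->
  coef_mono_all n.+1 eta M /\ coef_epi_all n.+1 eta M.
Proof.
move=> pM; pose P n := if n is 0 then M else zero_mod : fmod A.
pose d m : 'Hom(P m.+1, P m) := 0.
have zz m (x : P m.+1) : x = 0 by rewrite [LHS]thinmx0 [RHS]thinmx0.
have r : projective_resolution d (\1%VF : 'Hom(P 0%N, M)).
  split.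
  - case=> //= m; apply: (@proj_retract _ _ zero_mod M 0 0) pM => [||x].
    + exact: mlinear0.
    + exact: mlinear0.
    by rewrite [RHS](zz m x) zero_lfunE.
  - by move=> m; apply: mlinear0.
  - exact: mlinear_id.
  - by apply/limg_fullP=> y; exists y; rewrite id_lfunE.
  split=> [|m]; apply/vspaceP=> x; apply/memv_limgP/idP.
  - by case=> y ->; rewrite zero_lfunE mem0v.
  - by rewrite memv_ker id_lfunE => /eqP->; exists 0; rewrite linear0.
  - by case=> y ->; rewrite zero_lfunE mem0v.
  by move=> _; exists 0; rewrite linear0 (zz m x).
have dM := decomposition_miso (miso_refl M).
have cb m N' (f : 'Hom(P m.+1, N')) : coboundary d f.
  apply/coboundaryP; exists 0; first exact: mlinear0.
  by move=> x; rewrite (zz m x) linear0 zero_lfunE.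
split.
  apply: coef_mono_decomposition dM _ => _; exists P, d, \1%VF; split=> // f _ _; exact: cb.
apply: coef_epi_decomposition dM _ => _; exists P, d, \1%VF; split=> // F _.
exists 0; last exact: cb.
apply/cocycleP; split; [exact: mlinear0 | by move=> x; rewrite zero_lfunE].
Qed.

Lemma coef_bijective n N X (eta : 'Hom(N, X)) M : mlinear eta -> bijective eta ->
  coef_mono_all n.+1 eta M /\ coef_epi_all n.+1 eta M.
Proof.
move=> me be; have [g [mg eK gK]] := bij_mlinear_inv me be.
split=> P d e r.
  move=> f /cocycleP[mf fd] /coboundaryP[G mG GE]; apply/coboundaryP.
  exists (g \o G)%VF; first exact: mlinear_comp.
  by move=> x; rewrite comp_lfunE -GE comp_lfunE eK.
move=> F /cocycleP[mF Fd]; exists (g \o F)%VF.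
  apply/cocycleP; split; first exact: mlinear_comp.
  by move=> x; rewrite comp_lfunE Fd linear0.
apply/coboundaryP; exists 0; first exact: mlinear0.
by move=> x; rewrite add_lfunE opp_lfunE !comp_lfunE gK subrr zero_lfunE.
Qed.

Lemma coef_miso n N X (eta : 'Hom(N, X)) N' X' (eta' : 'Hom(N', X'))
    (f : 'Hom(N, N')) (g : 'Hom(X, X')) M :
  mlinear f -> bijective f -> mlinear g -> bijective g ->
  (forall x, g (eta x) = eta' (f x)) ->
  (coef_mono_all n.+1 eta M -> coef_mono_all n.+1 eta' M) /\
  (coef_epi_all n.+1 eta M -> coef_epi_all n.+1 eta' M).
Proof.
move=> mf bf mg bg sq.
have [f' [mf' fK f'K]] := bij_mlinear_inv mf bf.
have [g' [mg' gK g'K]] := bij_mlinear_inv mg bg.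
have sN x : \sum_(c : unit) f (f' x) = x by rewrite big_const card_unit /= addr0.
have sX x : \sum_(c : unit) g (g' x) = x by rewrite big_const card_unit /= addr0.
have e1 (c : unit) x : eta' (f x) = g (eta x) by [].
have e2 (c : unit) x : eta (f' x) = g' (eta' x) by rewrite -{2}[x]f'K -sq gK.
split=> h P d e r.
  by apply: (transport_coef_mono (etac := fun=> eta) (ic := fun=> f) (pc := fun=> f')
    (Pc := fun=> g')) => // _; apply: h r.
by apply: (transport_coef_epi (etac := fun=> eta) (ic := fun=> f)
    (Ic := fun=> g) (Pc := fun=> g')) => // _; apply: h r.
Qed.

End Decompositions.

(** * Induction and Shapiro's lemma *)

Section Restriction.

Variables (k : fieldType) (C D : falgType k) (phi : C -> D).
Hypotheses (phil : linear phi) (phi1 : phi 1 = 1) (phiM : forall a b, phi (a * b) = phi a * phi b).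
Variable M : fmod D.

Definition resm_act (c : C) (x : M) : M := phi c ∙ x.

Fact resm_act_linear c : linear (resm_act c).
Proof. exact: act_linear. Qed.

Fact resm_act_linear_l x : linear (resm_act^~ x).
Proof. by move=> c a b; rewrite /resm_act phil actDl actZl. Qed.

Fact resm_act1 x : resm_act 1 x = x.
Proof. by rewrite /resm_act phi1 act1. Qed.

Fact resm_actM a b x : resm_act (a * b) x = resm_act a (resm_act b x).
Proof. by rewrite /resm_act phiM actM. Qed.

Definition resm : fmod C := Fmod resm_act_linear resm_act_linear_l resm_act1 resm_actM.

End Restriction.

Section Induction.

Variables (k : fieldType) (A : falgType k) (B : {aspace A}) (B1 : 1 \in B).
Implicit Types (M N L : fmod (subvs_of B)) (X Y : fmod A).

Fact subvs_val1 : vsval (1 : subvs_of B) = 1.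
Proof. by rewrite /= (_ : algid B = 1) //; apply/eqP; rewrite algid_eq1. Qed.

Fact subvs_valM (a b : subvs_of B) : vsval (a * b) = vsval a * vsval b.
Proof. by []. Qed.

Fact subvs_val_linear : linear (vsval : subvs_of B -> A).
Proof. exact: linearP. Qed.

Definition res X : fmod (subvs_of B) := resm subvs_val_linear subvs_val1 subvs_valM X.

Lemma res_actE X (b : subvs_of B) (x : X) : act (f := res X) b x = vsval b ∙ x.
Proof. by []. Qed.

Lemma mlinear_res X Y (f : 'Hom(X, Y)) : mlinear f -> mlinear (f : 'Hom(res X, res Y)).
Proof. by move=> mf b x; apply: mf. Qed.

Lemma ind_pure_linear_r N a : linear (ind_pure (M := N) a).
Proof. by move=> c x y; rewrite /ind_pure pure_linear_r linearP. Qed.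

Lemma ind_pure_linear_l N x : linear (fun a => ind_pure (M := N) a x).
Proof. by move=> c a b; rewrite /ind_pure pure_linear_l linearP. Qed.

Lemma ind_ext N (U : vectType k) (f g : 'Hom(ind_mod N, U)) :
  (forall a x, f (ind_pure a x) = g (ind_pure a x)) -> forall z, f z = g z.
Proof.
move=> e z; have [w <-] := quo_pi_surj z; move: w.
by apply: tens_ext => [c u v | c u v | a x]; rewrite ?linearP //; apply: e.
Qed.

Lemma ind_lift N (U : vectType k) (b : A -> N -> U) :
  (forall a, linear (b a)) -> (forall x, linear (b^~ x)) ->
  (forall a (c : subvs_of B) x, b (a * vsval c) x = b a (c ∙ x)) ->
  exists F : 'Hom(ind_mod N, U), forall a x, F (ind_pure a x) = b a x.
Proof.
move=> br bl bal.
pose t : 'Hom(free_mod N, U) := linfun (tlift b).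
have tE a x : t (a ⊗ x) = b a x.
  by rewrite linfunE ?tlift_pure //; apply: tlift_is_linear.
have [|F FE] := @lfun_factor _ _ _ _ (quo_pi (balance_sub N)) t.
  move=> z /eqP; rewrite quo_pi_eq0 => bz; apply/eqP; rewrite -memv_ker.
  move: z bz; apply/subvP/balance_sub_le => a c x.
  by rewrite memv_ker linearB /= !tE bal subrr.
by exists F => a x; rewrite -FE tE.
Qed.

Definition ind_unit N : 'Hom(N, res (ind_mod N)) := linfun (ind_pure 1).

Lemma ind_unitE N x : ind_unit N x = ind_pure 1 x.
Proof. by rewrite linfunE //; apply: ind_pure_linear_r. Qed.

Lemma ind_pureE N a x : ind_pure a x = a ∙ (ind_unit N x : ind_mod N).
Proof. by rewrite ind_unitE act_ind_pure mulr1. Qed.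

Lemma ind_unit_mlinear N : mlinear (ind_unit N).
Proof.
by move=> b x; rewrite res_actE !ind_unitE act_ind_pure mulr1 -ind_pure_balanced mul1r.
Qed.

Lemma ind_hom_ext N X (F G : 'Hom(ind_mod N, X)) : mlinear F -> mlinear G ->
  (forall x, F (ind_unit N x) = G (ind_unit N x)) -> forall z, F z = G z.
Proof.
by move=> mF mG e; apply: ind_ext => a x; rewrite ind_pureE mF mG e.
Qed.

Lemma ind_mlinear N X (F : 'Hom(ind_mod N, X)) :
  (forall a b x, F (a ∙ ind_pure b x) = a ∙ F (ind_pure b x)) -> mlinear F.
Proof.
move=> h a z; pose f1 := (F \o linfun (act (f := ind_mod N) a))%VF.
pose f2 := (linfun (act (f := X) a) \o F)%VF.
have e : f1 z = f2 z.
  by apply: ind_ext => b x; rewrite !comp_lfunE !(linfunE (act_linear _)) h.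
by move: e; rewrite !comp_lfunE !(linfunE (act_linear _)).
Qed.

(** Existence in the adjunction between induction and restriction; uniqueness is [ind_hom_ext]. *)
Lemma ind_hom N X (f : 'Hom(N, res X)) : mlinear f ->
  exists2 F : 'Hom(ind_mod N, X), mlinear F & forall x, F (ind_unit N x) = f x.
Proof.
move=> mf; have [|||F FE] := @ind_lift N X (fun a x => a ∙ (f x : X)).
- by move=> a c x y; rewrite linearP actDr actZr.
- by move=> x c a b; rewrite actDl actZl.
- by move=> a c x; rewrite mf res_actE actM.
exists F; last by move=> x; rewrite ind_unitE FE act1.
by apply: ind_mlinear => a b x; rewrite act_ind_pure !FE actM.
Qed.

Lemma ind_map_unit M N (f : 'Hom(M, N)) x : mlinear f ->
  ind_map f (ind_unit M x) = ind_unit N (f x).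
Proof. by move=> mf; rewrite !ind_unitE ind_map_pure. Qed.

Lemma ind_map_mlinear M N (f : 'Hom(M, N)) : mlinear f -> mlinear (ind_map f).
Proof.
by move=> mf; apply: ind_mlinear => a b x; rewrite act_ind_pure !ind_map_pure // act_ind_pure.
Qed.

Lemma ind_projective N : projective N -> projective (ind_mod N).
Proof.
move=> pN X Y g h mg /limg_fullP sg mh.
have [|l ml lE] := @proj_lift_surj _ _ N (res X) (res Y) g (h \o ind_unit N)%VF pN (mlinear_res mg) _ sg.
  by move=> b x; rewrite !comp_lfunE ind_unit_mlinear !res_actE mh.
have [F mF FE] := ind_hom ml; exists F => //; apply/lfunP.
apply: ind_hom_ext => //; first exact: mlinear_comp.
by move=> x; rewrite comp_lfunE FE lE comp_lfunE.
Qed.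

Section Shapiro.

Variables (N : fmod (subvs_of B)) (P : nat -> fmod (subvs_of B)).
Variable d : forall n, 'Hom(P n.+1, P n).
Hypothesis md : forall n, mlinear (d n).

(** By adjunction, A-maps out of [ind_mod (P n)] are B-maps out of [P n]; [ind_map f] corresponds to
    [ind_unit N \o f], and composing with [ind_diff d] to composing with [d]. So cocycles and
    coboundaries match. *)
Lemma shapiro_mono n : ext_map_mono N d n.+1 <-> coef_mono (ind_unit N) d n.+1.
Proof.
split=> h f cf; have [mf fd] := proj1 (cocycleP _ f) cf.
  move=> /coboundaryP[G mG GE]; apply: h => //.
  have [F mF FE] := ind_hom mG; apply/coboundaryP; exists F => //.
  have mfi := ind_map_mlinear mf; have mdi := ind_map_mlinear (@md n).
  move=> z; rewrite /ind_diff -comp_lfunE; move: z; apply: ind_hom_ext => //.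
    exact: mlinear_comp.
  by move=> x; rewrite ind_map_unit // comp_lfunE ind_map_unit // FE -GE comp_lfunE.
move=> /coboundaryP[G mG GE]; apply: h => //; apply/coboundaryP.
exists (G \o ind_unit (P n))%VF.
  by move=> a x; rewrite !comp_lfunE ind_unit_mlinear !res_actE mG.
move=> x; rewrite !comp_lfunE -(ind_map_unit _ mf) GE.
by rewrite /ind_diff ind_map_unit.
Qed.

Lemma shapiro_epi n : ext_map_epi N d n.+1 <-> coef_epi (ind_unit N) d n.+1.
Proof.
have cw (G : 'Hom(ind_mod (P n.+1), ind_mod N)) (g : 'Hom(P n.+1, res (ind_mod N))) :
    (forall x, G (ind_unit _ x) = g x) -> mlinear G -> cocycle (ind_diff d) G <-> cocycle d g.
  move=> e mG; have mg : mlinear g.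
    by move=> b x; rewrite -!e ind_unit_mlinear !res_actE mG.
  split=> [/cocycleP[_ Gd] | /cocycleP[_ gd]]; apply/cocycleP; split=> //.
    by move=> x; rewrite -e -(ind_map_unit _ (@md n.+1)) Gd.
  move=> z; rewrite -comp_lfunE -[RHS](zero_lfunE _ z); move: z; apply: ind_hom_ext.
  - by apply: mlinear_comp => //; apply: ind_map_mlinear.
  - exact: mlinear0.
  by move=> x; rewrite comp_lfunE zero_lfunE /ind_diff ind_map_unit // e.
split=> h F cF.
  have [mF Fd] := proj1 (cocycleP _ F) cF; have [G mG GE] := ind_hom mF.
  have [|f cf /coboundaryP[E mE EE]] := h G; first exact/(cw G F).
  have [mf _] := proj1 (cocycleP _ f) cf; exists f => //; apply/coboundaryP.
  exists (E \o ind_unit (P n))%VF.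
    by move=> a x; rewrite !comp_lfunE ind_unit_mlinear !res_actE mE.
  move=> x; rewrite comp_lfunE -(ind_map_unit _ (@md n)) -EE !add_lfunE !opp_lfunE.
  by rewrite comp_lfunE GE ind_map_unit.
have [mF Fd] := proj1 (cocycleP _ F) cF.
have [|f cf /coboundaryP[E mE EE]] := h (F \o ind_unit (P n.+1))%VF.
  by apply/(cw F) => // x; rewrite comp_lfunE.
have [mf _] := proj1 (cocycleP _ f) cf; exists f => //; apply/coboundaryP.
have [G mG GE] := ind_hom mE; exists G => // z.
have mfi := ind_map_mlinear mf; have mdi := ind_map_mlinear (@md n).
rewrite /ind_diff -[G _]comp_lfunE; move: z; apply: ind_hom_ext.
- exact: mlinearB.
- exact: mlinear_comp.
move=> x; rewrite comp_lfunE ind_map_unit // GE -EE !add_lfunE !opp_lfunE.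
by rewrite (ind_map_unit x mf); congr (_ - _); rewrite comp_lfunE.
Qed.

End Shapiro.

(** Induction is additive and the unit is natural, so a decomposition of [N] induces a compatible
    one of [ind_mod N]. *)
Lemma coef_ind_decomposition n N (K : finType) (Na : K -> fmod (subvs_of B)) M : decomposition N Na ->
  ((forall a, coef_mono_all n.+1 (ind_unit (Na a)) M) -> coef_mono_all n.+1 (ind_unit N) M) /\
  ((forall a, coef_epi_all n.+1 (ind_unit (Na a)) M) -> coef_epi_all n.+1 (ind_unit N) M).
Proof.
case=> i [p [mi mp ip]].
have sX (z : ind_mod N) : \sum_a ind_map (i a) (ind_map (p a) z) = z.
  pose F := (\sum_a (ind_map (i a) \o ind_map (p a)))%VF.
  have FE y : F y = \sum_a ind_map (i a) (ind_map (p a) y).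
    by rewrite sum_lfunE; apply: eq_bigr => a _; rewrite comp_lfunE.
  rewrite -FE -[RHS]id_lfunE; move: z; apply: ind_hom_ext.
  - by apply: mlinear_sum => a; apply: mlinear_comp; apply: ind_map_mlinear.
  - exact: mlinear_id.
  move=> x; rewrite FE id_lfunE -[in RHS](ip x) linear_sum /=; apply: eq_bigr => a _.
  by rewrite !ind_map_unit.
have miI a : mlinear (ind_map (i a) : 'Hom(res (ind_mod _), res (ind_mod _))).
  exact/mlinear_res/ind_map_mlinear.
have mpI a : mlinear (ind_map (p a) : 'Hom(res (ind_mod _), res (ind_mod _))).
  exact/mlinear_res/ind_map_mlinear.
have e1 a x : ind_unit N (i a x) = ind_map (i a) (ind_unit (Na a) x) by rewrite ind_map_unit.
have e2 a x : ind_unit (Na a) (p a x) = ind_map (p a) (ind_unit N x) by rewrite ind_map_unit.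
split=> h P d e r.
  apply: (transport_coef_mono mi mp mpI ip e2) => a; exact: h r.
apply: (transport_coef_epi mi miI mpI sX e1) => a; exact: h r.
Qed.

(** Each simple module is a direct summand of L^B, both as first argument of Ext and as
    coefficients. *)
Lemma ext_LB_pieces n :
  (ext_LB_mono B n.+1 -> forall (J : finType) (L : J -> fmod (subvs_of B)), is_Sim L ->
     forall a c, coef_mono_all n.+1 (ind_unit (L c)) (L a)) /\
  (ext_LB_epi B n.+1 -> forall (J : finType) (L : J -> fmod (subvs_of B)), is_Sim L ->
     forall a c, coef_epi_all n.+1 (ind_unit (L c)) (L a)).
Proof.
split=> h J L sL a c; have hL := h J L sL.
all: have [i [p [mi mp pi]]] := big_dsum_retract L (mem_index_enum a).
all: have [i' [p' [mi' mp' pi']]] := big_dsum_retract L (mem_index_enum c).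
all: have da := decomposition_retract mp mi pi.
all: have dc := decomposition_retract mp' mi' pi'.
  apply: (proj1 (coef_ind_decomposition _ _ dc)) => _.
  apply: coef_mono_all_decomposition da _ => _ P d e r.
  by apply/shapiro_mono; [apply: res_mlinear r | apply: hL r].
apply: (proj2 (coef_ind_decomposition _ _ dc)) => _.
apply: coef_epi_all_decomposition da _ => _ P d e r.
by apply/shapiro_epi; [apply: res_mlinear r | apply: hL r].
Qed.

Lemma pieces_ext_LB n :
  ((forall L L' : fmod (subvs_of B), simple L -> simple L' -> coef_mono_all n.+1 (ind_unit L') L) ->
     ext_LB_mono B n.+1) /\
  ((forall L L' : fmod (subvs_of B), simple L -> simple L' -> coef_epi_all n.+1 (ind_unit L') L) ->
     ext_LB_epi B n.+1).
Proof.
split=> h J L [sL _ _] LB P d e r.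
  apply/shapiro_mono; first exact: res_mlinear r.
  have hM c : coef_mono_all n.+1 (ind_unit (L c)) LB.
    rewrite /LB; elim/big_ind: _ => [|M N hM hN|a _].
    - by apply: (coef_mono_all_decomposition (decomposition_zero _)) => -[].
    - by apply: (coef_mono_all_decomposition (decomposition_dsum _ _)) => -[].
    exact: h.
  (* [LB] is both the resolved module and the coefficients; generalising the former to [M] lets the
     latter be decomposed alone. *)
  suff hN M : (forall c, coef_mono_all n.+1 (ind_unit (L c)) M) ->
      coef_mono_all n.+1 (ind_unit LB) M by exact: (hN LB hM) r.
  move=> hL; rewrite /LB; elim/big_ind: _ => [|N1 N2 h1 h2|c _] //.
    by apply: (proj1 (coef_ind_decomposition _ _ (decomposition_zero _))) => -[].
  by apply: (proj1 (coef_ind_decomposition _ _ (decomposition_dsum _ _))) => -[].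
apply/shapiro_epi; first exact: res_mlinear r.
have hM c : coef_epi_all n.+1 (ind_unit (L c)) LB.
  rewrite /LB; elim/big_ind: _ => [|M N hM hN|a _].
  - by apply: (coef_epi_all_decomposition (decomposition_zero _)) => -[].
  - by apply: (coef_epi_all_decomposition (decomposition_dsum _ _)) => -[].
  exact: h.
suff hN M : (forall c, coef_epi_all n.+1 (ind_unit (L c)) M) ->
    coef_epi_all n.+1 (ind_unit LB) M by exact: (hN LB hM) r.
move=> hL; rewrite /LB; elim/big_ind: _ => [|N1 N2 h1 h2|c _] //.
  by apply: (proj2 (coef_ind_decomposition _ _ (decomposition_zero _))) => -[].
by apply: (proj2 (coef_ind_decomposition _ _ (decomposition_dsum _ _))) => -[].
Qed.

End Induction.

(** * Tensor products of modules and of quasi-hereditary algebras *)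

Section TensorLinear.

Variable k : fieldType.
Implicit Types V W U : vectType k.

Lemma lin_ext_tens V W U (f g : 'Hom(tens V W, U)) :
  (forall v w, f (v ⊗ w) = g (v ⊗ w)) -> forall z, f z = g z.
Proof. by move=> e; apply: tens_ext => // c x y; rewrite linearP. Qed.

Lemma bilinear_lift V W U (b : V -> W -> U) :
  (forall w, linear (b^~ w)) -> (forall v, linear (b v)) ->
  exists f : 'Hom(tens V W, U), forall v w, f (v ⊗ w) = b v w.
Proof.
move=> bl br; exists (linfun (tlift b)) => v w.
by rewrite linfunE ?tlift_pure //; apply: tlift_is_linear.
Qed.

Definition tmap V W V' W' (f : 'Hom(V, V')) (g : 'Hom(W, W')) : 'Hom(tens V W, tens V' W') :=
  linfun (tlift (fun v w => f v ⊗ g w)).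

Lemma tmapE V W V' W' (f : 'Hom(V, V')) (g : 'Hom(W, W')) v w :
  tmap f g (v ⊗ w) = f v ⊗ g w.
Proof.
rewrite linfunE; last exact: tlift_is_linear.
by rewrite tlift_pure // => ? c x y; rewrite linearP ?pure_linear_l ?pure_linear_r.
Qed.

(** The contraction [id ⊗ xi]. Contractions detect tensors and are linear for the action on the
    remaining factor, which is how maps between tensor products are taken apart. *)
Definition contr_r V W (xi : 'Hom(W, k^o)) : 'Hom(tens V W, V) :=
  linfun (tlift (fun v w => (xi w : k) *: v)).

Lemma contr_rE V W (xi : 'Hom(W, k^o)) (v : V) w : contr_r V xi (v ⊗ w) = (xi w : k) *: v.
Proof.
rewrite linfunE; last exact: tlift_is_linear.
rewrite tlift_pure // => [? c x y | ? c x y].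
  by rewrite scalerDr !scalerA mulrC.
by rewrite linearP scalerDl scalerA.
Qed.

Definition contr_l V W (xi : 'Hom(V, k^o)) : 'Hom(tens V W, W) :=
  linfun (tlift (fun v w => (xi v : k) *: w)).

Lemma contr_lE V W (xi : 'Hom(V, k^o)) v (w : W) : contr_l W xi (v ⊗ w) = (xi v : k) *: w.
Proof.
rewrite linfunE; last exact: tlift_is_linear.
rewrite tlift_pure // => [? c x y | ? c x y].
  by rewrite linearP scalerDl scalerA.
by rewrite scalerDr !scalerA mulrC.
Qed.

Lemma pure0l V W (w : W) : (0 : V) ⊗ w = 0.
Proof. by have := pure_linear_l w (-1) (0 : V) 0; rewrite scaler0 addr0 scaleN1r addNr. Qed.

Lemma pure0r V W (v : V) : v ⊗ (0 : W) = 0.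
Proof. by have := pure_linear_r v (-1) (0 : W) 0; rewrite scaler0 addr0 scaleN1r addNr. Qed.

Lemma pureBl V W (v v' : V) (w : W) : (v - v') ⊗ w = v ⊗ w - v' ⊗ w.
Proof.
by have := pure_linear_l w (-1) v' v; rewrite !scaleN1r ![- _ + _]addrC.
Qed.

Lemma pureBr V W (v : V) (w w' : W) : v ⊗ (w - w') = v ⊗ w - v ⊗ w'.
Proof.
by have := pure_linear_r v (-1) w' w; rewrite !scaleN1r ![- _ + _]addrC.
Qed.

Lemma pureZr V W c (v : V) (w : W) : v ⊗ (c *: w) = c *: (v ⊗ w).
Proof. by have := pure_linear_r v c w 0; rewrite !addr0 pure0r addr0. Qed.

Lemma contr_r_eq0 V W (z : tens V W) : (forall xi, contr_r V xi z = 0) -> z = 0.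
Proof.
move=> h; apply/matrixP=> i j; rewrite mxE.
pose xi : 'Hom(W, k^o) := linfun (coord (vbasis {:W}) j : W -> k^o).
have xiE w : xi w = coord (vbasis {:W}) j w by rewrite linfunE // => c x y; rewrite linearP.
have := h xi; rewrite {1}[z]tens_sum linear_sum /= => e.
have {e} e : \sum_i0 z i0 j *: (vbasis {:V})`_i0 = 0.
  rewrite -[RHS]e; apply: eq_bigr => i0 _; rewrite linear_sum /= (bigD1 j) //= big1 => [|j0 nj].
    rewrite addr0 linearZ /= contr_rE xiE coord_free ?(basis_free (vbasisP _)) //.
    by rewrite eqxx scale1r.
  rewrite linearZ /= contr_rE xiE coord_free ?(basis_free (vbasisP _)) //.
  by rewrite (negPf nj) scale0r scaler0.
have /freeP/(_ (fun i => z i j) e i) := basis_free (vbasisP {:V}).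
by [].
Qed.

Lemma contrC V W (xi : 'Hom(V, k^o)) (xi' : 'Hom(W, k^o)) z :
  xi (contr_r V xi' z) = xi' (contr_l W xi z).
Proof.
rewrite -!comp_lfunE; move: z; apply: lin_ext_tens => v w.
by rewrite !comp_lfunE contr_rE contr_lE !linearZ /= /GRing.scale /= mulrC.
Qed.

Lemma contr_l_eq0 V W (z : tens V W) : (forall xi, contr_l W xi z = 0) -> z = 0.
Proof.
move=> h; apply/contr_r_eq0 => xi'; apply: functional_eq0 => xi.
by rewrite contrC h linear0.
Qed.

Lemma contr_r_ext V W (z z' : tens V W) : (forall xi, contr_r V xi z = contr_r V xi z') -> z = z'.
Proof.
move=> h; apply/eqP; rewrite -subr_eq0; apply/eqP/contr_r_eq0 => xi.
by rewrite linearB /= h subrr.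
Qed.

Lemma contr_r_tmap V W V' W' (f : 'Hom(V, V')) (g : 'Hom(W, W')) xi z :
  contr_r V' xi (tmap f g z) = f (contr_r V (xi \o g)%VF z).
Proof.
rewrite -!comp_lfunE; move: z; apply: lin_ext_tens => v w.
by rewrite !comp_lfunE tmapE !contr_rE comp_lfunE linearZ.
Qed.

Lemma contr_l_tmap V W V' W' (f : 'Hom(V, V')) (g : 'Hom(W, W')) xi z :
  contr_l W' xi (tmap f g z) = g (contr_l W (xi \o f)%VF z).
Proof.
rewrite -!comp_lfunE; move: z; apply: lin_ext_tens => v w.
by rewrite !comp_lfunE tmapE !contr_lE comp_lfunE linearZ.
Qed.

(** The kernel of g ⊗ g' is ker g ⊗ W + V ⊗ ker g', expressed through maps [h] vanishing on it. With
    partial inverses of [g] and [g'], such an [h] factors through g ⊗ g'. *)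
Lemma tmap_ker V W V1 W1 U (g : 'Hom(V, V1)) (g' : 'Hom(W, W1)) (h : 'Hom(tens V W, U)) :
  (forall v w, g v = 0 -> h (v ⊗ w) = 0) -> (forall v w, g' w = 0 -> h (v ⊗ w) = 0) ->
  forall z, tmap g g' z = 0 -> h z = 0.
Proof.
move=> h1 h2 z e.
have gK x : g (x - (g^-1)%VF (g x)) = 0.
  by rewrite linearB /= limg_lfunVK ?subrr ?memv_img ?memvf.
have g'K x : g' (x - (g'^-1)%VF (g' x)) = 0.
  by rewrite linearB /= limg_lfunVK ?subrr ?memv_img ?memvf.
suff -> : h z = (h \o tmap (g^-1)%VF (g'^-1)%VF \o tmap g g')%VF z.
  by rewrite comp_lfunE e linear0.
move: z {e}; apply: lin_ext_tens => v w; rewrite !comp_lfunE !tmapE.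
apply/eqP; rewrite -subr_eq0; apply/eqP.
have -> : v ⊗ w = (v - (g^-1)%VF (g v)) ⊗ w +
    ((g^-1)%VF (g v) ⊗ (w - (g'^-1)%VF (g' w)) + (g^-1)%VF (g v) ⊗ (g'^-1)%VF (g' w)).
  by rewrite pureBl pureBr subrK subrK.
by rewrite !linearD /= h1 // h2 // !add0r subrr.
Qed.

Lemma tmap_surj V W V' W' (f : 'Hom(V, V')) (g : 'Hom(W, W')) :
  (forall y, exists x, f x = y) -> (forall y, exists x, g x = y) ->
  forall y, exists x, tmap f g x = y.
Proof.
move=> /lfun_section[s sK] /lfun_section[t tK] y; exists (tmap s t y).
rewrite -comp_lfunE -[RHS]id_lfunE; move: y; apply: lin_ext_tens => v w.
by rewrite comp_lfunE !tmapE sK tK id_lfunE.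
Qed.

Lemma tmap_inj V W V' W' (f : 'Hom(V, V')) (g : 'Hom(W, W')) :
  (forall x, f x = 0 -> x = 0) -> (forall x, g x = 0 -> x = 0) ->
  forall z, tmap f g z = 0 -> z = 0.
Proof.
move=> fi gi z e; rewrite -[z]id_lfunE.
apply: (tmap_ker (g := f) (g' := g) _ _ e) => v w; rewrite id_lfunE.
  by move/fi->; rewrite pure0l.
by move/gi->; rewrite pure0r.
Qed.

Lemma tmap_bij V W V' W' (f : 'Hom(V, V')) (g : 'Hom(W, W')) :
  bijective f -> bijective g -> bijective (tmap f g).
Proof.
move=> bf bg; apply: lfun_bij.
  apply: tmap_inj => x e; [apply: (bij_inj bf) | apply: (bij_inj bg)]; by rewrite e linear0.
have [f' _ f'K] := bf; have [g' _ g'K] := bg.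
apply: tmap_surj => y; [by exists (f' y) | by exists (g' y)].
Qed.

Definition tswap V W : 'Hom(tens V W, tens W V) := linfun (tlift (fun v w => w ⊗ v)).

Lemma tswapE V W (v : V) (w : W) : tswap V W (v ⊗ w) = w ⊗ v.
Proof.
rewrite linfunE; last exact: tlift_is_linear.
by rewrite tlift_pure // => ? c x y; rewrite ?pure_linear_l ?pure_linear_r.
Qed.

Lemma tswapK V W z : tswap W V (tswap V W z) = z.
Proof.
rewrite -comp_lfunE -[RHS]id_lfunE; move: z; apply: lin_ext_tens => v w.
by rewrite comp_lfunE !tswapE id_lfunE.
Qed.

End TensorLinear.

(* C is identified with the tensor product of B and B' through tn; tm b b' is the
   element of C that corresponds to b ⊗ b'. *)
Record tensor_structure (k : fieldType) (B B' C : falgType k) := TensorStructure {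
  tn : C -> tens_alg B B';
  tm : B -> B' -> C;
  tn_linear : linear tn;
  tn_one : tn 1 = 1;
  tn_mul : forall c d, tn (c * d) = tn c * tn d;
  tn_tm : forall b b', tn (tm b b') = tpure b b';
  tn_inj : injective tn
}.

Lemma fmod_eq (k : fieldType) (A : falgType k) (V : vectType k) (a : A -> V -> V) l1 l2 u m l1' l2' u' m' :
  @Fmod k A V a l1 l2 u m = @Fmod k A V a l1' l2' u' m'.
Proof. by congr Fmod; apply: proof_irrelevance. Qed.

Section TensorProduct.

Variables (k : fieldType) (B B' C : falgType k) (T : tensor_structure B B' C).

Lemma tm_linear_l b' : linear (fun b => tm T b b').
Proof.
move=> c x y; apply: (@tn_inj _ _ _ _ T).
by rewrite tn_linear !tn_tm /tpure pure_linear_l.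
Qed.

Lemma tm_linear_r b : linear (tm T b).
Proof.
move=> c x y; apply: (@tn_inj _ _ _ _ T).
by rewrite tn_linear !tn_tm /tpure pure_linear_r.
Qed.

Lemma tm1 : tm T 1 1 = 1.
Proof. by apply: (@tn_inj _ _ _ _ T); rewrite tn_tm tn_one. Qed.

Lemma tmM a a' b b' : tm T a a' * tm T b b' = tm T (a * b) (a' * b').
Proof. by apply: (@tn_inj _ _ _ _ T); rewrite tn_mul !tn_tm tpureM. Qed.

Lemma tensor_ind (Q : C -> Prop) : (forall c x y, Q x -> Q y -> Q (c *: x + y)) ->
  Q 0 -> (forall b b', Q (tm T b b')) -> forall c, Q c.
Proof.
move=> QP Q0 Qm c.
have -> : c = \sum_i \sum_j (tn T c : tens B B') i j *: tm T (vbasis {:B})`_i (vbasis {:B'})`_j.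
  apply: (@tn_inj _ _ _ _ T); rewrite [LHS](tens_sum (tn T c : tens B B')).
  rewrite -[RHS](linfunE (@tn_linear _ _ _ _ T)) linear_sum; apply: eq_bigr => i _.
  rewrite linear_sum; apply: eq_bigr => j _; rewrite linearZ /=.
  by rewrite (linfunE (@tn_linear _ _ _ _ T)) tn_tm.
have QD x y : Q x -> Q y -> Q (x + y) by move=> Qx Qy; rewrite -[x]scale1r; apply: QP.
have QZ a x : Q x -> Q (a *: x) by move=> Qx; rewrite -[_ *: _]addr0; apply: QP.
by apply: big_ind => // i _; apply: big_ind => // j _; apply: QZ.
Qed.

Lemma tensor_mlinear (X Y : fmod C) (f : 'Hom(X, Y)) :
  (forall b b' x, f (tm T b b' ∙ x) = tm T b b' ∙ f x) -> mlinear f.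
Proof.
move=> h; elim/tensor_ind => [a c d hc hd x | x | b b' x]; last exact: h.
  by rewrite !actDl !actZl linearP /= hc hd.
by rewrite !act0l linear0.
Qed.

Section TensorModule.

Variables (M : fmod B) (M' : fmod B').

Definition tmod : fmod C :=
  resm (@tn_linear _ _ _ _ T) (@tn_one _ _ _ _ T) (@tn_mul _ _ _ _ T) (tens_mod M M').

Lemma tmod_act b b' (x : M) (x' : M') :
  act (f := tmod) (tm T b b') (x ⊗ x') = (b ∙ x) ⊗ (b' ∙ x').
Proof. by rewrite {1}/act /= /resm_act tn_tm; apply: tens_act_pure. Qed.

Lemma tmod_mlinear (X : fmod C) (f : 'Hom(tmod, X)) :
  (forall b b' (x : M) (x' : M'), f ((b ∙ x) ⊗ (b' ∙ x')) = tm T b b' ∙ f (x ⊗ x')) -> mlinear f.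
Proof.
move=> h; apply: tensor_mlinear => b b'; apply: tens_ext => [c u v|c u v|x x'].
- by rewrite actDr actZr linearP.
- by rewrite linearP actDr actZr.
by rewrite tmod_act h.
Qed.

End TensorModule.

Lemma tmap_mlinear (M N : fmod B) (M' N' : fmod B') (f : 'Hom(M, N)) (f' : 'Hom(M', N')) :
  mlinear f -> mlinear f' -> mlinear (tmap f f' : 'Hom(tmod M M', tmod N N')).
Proof.
by move=> mf mf'; apply: tmod_mlinear => b b' x x'; rewrite !tmapE mf mf' tmod_act.
Qed.

Lemma tmod_miso (M N : fmod B) (M' N' : fmod B') :
  miso M N -> miso M' N' -> miso (tmod M M') (tmod N N').
Proof.
case=> f mf bf [f' mf' bf']; exists (tmap f f'); first exact: tmap_mlinear.
exact: tmap_bij.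
Qed.

Section Slices.

Variables (M N : fmod B) (M' N' : fmod B') (h : 'Hom(tmod M M', tmod N N')).

(** Slices reduce a [C]-linear map to [B]-linear ones: [tm T b 1] acts on the first factor alone, so
    fixing [x'] and contracting by [xi] keeps linearity. *)
Definition slice_l (x' : M') (xi : 'Hom(N', k^o)) : 'Hom(M, N) :=
  linfun (fun x => contr_r N xi (h (x ⊗ x'))).

Definition slice_r (x : M) (xi : 'Hom(N, k^o)) : 'Hom(M', N') :=
  linfun (fun x' => contr_l N' xi (h (x ⊗ x'))).

Lemma slice_lE x' xi x : slice_l x' xi x = contr_r N xi (h (x ⊗ x')).
Proof. by rewrite linfunE // => c u v; rewrite pure_linear_l !linearP. Qed.

Lemma slice_rE x xi x' : slice_r x xi x' = contr_l N' xi (h (x ⊗ x')).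
Proof. by rewrite linfunE // => c u v; rewrite pure_linear_r !linearP. Qed.

Lemma contr_r_act b xi (z : tmod N N') : contr_r N xi (tm T b 1 ∙ z) = b ∙ contr_r N xi z.
Proof.
move: z; apply: tens_ext => [c u v | c u v | y y'].
- by rewrite actDr actZr linearP.
- by rewrite linearP actDr actZr.
by rewrite tmod_act act1 !contr_rE actZr.
Qed.

Lemma contr_l_act b' xi (z : tmod N N') : contr_l N' xi (tm T 1 b' ∙ z) = b' ∙ contr_l N' xi z.
Proof.
move: z; apply: tens_ext => [c u v | c u v | y y'].
- by rewrite actDr actZr linearP.
- by rewrite linearP actDr actZr.
by rewrite tmod_act act1 !contr_lE actZr.
Qed.

Hypothesis mh : mlinear h.

Lemma slice_l_mlinear x' xi : mlinear (slice_l x' xi).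
Proof. by move=> b x; rewrite !slice_lE -contr_r_act -mh tmod_act act1. Qed.

Lemma slice_r_mlinear x xi : mlinear (slice_r x xi).
Proof. by move=> b x'; rewrite !slice_rE -contr_l_act -mh tmod_act act1. Qed.

End Slices.

(** Every left slice is an endomorphism of [S], hence a scalar, and this scalar is read off at [s0]
    with the functional [xi0]. Thus Hom(S ⊗ M', S ⊗ N') is Hom(M', N'). *)
Lemma hom_scalar_tens (S : fmod B) (M' N' : fmod B') (h : 'Hom(tmod S M', tmod S N')) :
  scalar_end S -> (exists x : S, x != 0) -> mlinear h ->
  exists2 g : 'Hom(M', N'), mlinear g & forall x x', h (x ⊗ x') = x ⊗ g x'.
Proof.
move=> sS [s0 s0n] mh; have [xi0 xi0E] := functional_neq0 s0n.
exists (slice_r h s0 xi0); first exact: slice_r_mlinear.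
move=> x x'; apply: contr_r_ext => xi.
have [c cE] := sS _ (slice_l_mlinear mh x' xi).
rewrite -slice_lE cE contr_rE; congr (_ *: _).
have -> : c = xi0 (c *: s0) by rewrite linearZ /= xi0E /GRing.scale /= mulr1.
by rewrite -cE slice_lE slice_rE contrC.
Qed.

Lemma projective_section (D : falgType k) (P : fmod D) : projective P ->
  exists2 s : 'Hom(P, freem D P), mlinear s & forall x, free_cover P (s x) = x.
Proof.
move=> pP; have [s ms sE] := proj_lift_surj pP (@free_cover_mlinear _ _ P) (@mlinear_id _ _ P) (@free_cover_surj _ _ P).
by exists s => // x; rewrite sE id_lfunE.
Qed.

(** Both modules split off free ones. On (B ⊗ P) ⊗ (B' ⊗ P') a lift may be prescribed on generators
    by [t (h (x ⊗ x'))], where [t] is a linear section of [g]. *)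
Lemma tmod_projective (P : fmod B) (P' : fmod B') : projective P -> projective P' -> projective (tmod P P').
Proof.
move=> /projective_section[s ms sK] /projective_section[s' ms' sK'] X Y g h mg /limg_fullP sg mh.
have [t tK] := lfun_section sg.
pose F : tens (freem B P) (freem B' P') -> X :=
  tlift (fun (z : freem B P) (z' : freem B' P') =>
    tlift2 (fun (b : B) (x : P) (b' : B') (x' : P') => tm T b b' ∙ t (h (x ⊗ x'))) z z').
have FE b x b' x' : F ((b ⊗ x) ⊗ (b' ⊗ x')) = tm T b b' ∙ t (h (x ⊗ x')).
  rewrite /F tlift_pure; [|exact: tlift2_linear_l|exact: tlift2_linear_r].
  rewrite tlift2_pure // => [w v' w'|v v' w'|v w w'|v w v'] c y z.
  - by rewrite tm_linear_l actDl actZl.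
  - by rewrite pure_linear_l !linearP.
  - by rewrite tm_linear_r actDl actZl.
  by rewrite pure_linear_r !linearP.
have Fl : linear F by apply: tlift_is_linear.
pose l : 'Hom(tmod P P', X) := (linfun F \o tmap s s')%VF.
have lE z : l z = F (tmap s s' z) by rewrite comp_lfunE linfunE.
have FM b b' (z : freem B P) (z' : freem B' P') : F ((b ∙ z) ⊗ (b' ∙ z')) = tm T b b' ∙ F (z ⊗ z').
  move: z; apply: tens_ext => [c u v|c u v|a x].
  - by rewrite actDr actZr pure_linear_l Fl.
  - by rewrite pure_linear_l Fl actDr actZr.
  move: z'; apply: tens_ext => [c u v|c u v|a' x'].
  - by rewrite actDr actZr pure_linear_r Fl.
  - by rewrite pure_linear_r Fl actDr actZr.
  by rewrite [b ∙ _]freem_act_pure [b' ∙ _]freem_act_pure !FE -actM tmM.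
exists l.
  by apply: tmod_mlinear => b b' x x'; rewrite !lE !tmapE ms ms' FM.
apply/lfunP=> z; rewrite comp_lfunE.
suff e w : g (F w) = h (tmap (free_cover P) (free_cover P') w).
  rewrite lE e -!comp_lfunE; move: z; apply: lin_ext_tens => x x'.
  by rewrite !comp_lfunE !tmapE sK sK'.
rewrite -[F w](linfunE Fl) -!comp_lfunE; move: w {z}; apply: lin_ext_tens => z z'.
rewrite !comp_lfunE (linfunE Fl) tmapE; move: z; apply: tens_ext => [c u v|c u v|a x].
- by rewrite pure_linear_l Fl linearP.
- by rewrite linearP pure_linear_l linearP.
move: z'; apply: tens_ext => [c u v|c u v|a' x'].
- by rewrite pure_linear_r Fl linearP.
- by rewrite linearP pure_linear_r linearP.
by rewrite FE !free_coverE mg tK -mh tmod_act.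
Qed.

End TensorProduct.

Section SubquotientFacts.

Variables (k : fieldType) (A : falgType k).
Implicit Types (M N D : fmod A).

Lemma subquotient_section M (V : {vspace M}) D (g : 'Hom(M, D)) :
  (g @: V)%VS = fullv -> exists s : 'Hom(D, M), (forall y, s y \in V) /\ forall y, g (s y) = y.
Proof.
move=> gV; pose v : 'Hom(subvs_of V, M) := linfun vsval.
have vE x : v x = vsval x by rewrite lfunE.
have [|s sE] := @lfun_section _ _ _ (g \o v)%VF.
  move=> y; have : y \in (g @: V)%VS by rewrite gV memvf.
  by case/memv_imgP=> x Vx ->; exists (vsproj V x); rewrite comp_lfunE vE vsprojK.
exists (v \o s)%VF; split=> y; first by rewrite comp_lfunE vE subvsP.
by have := sE y; rewrite !comp_lfunE.
Qed.

Lemma simple_submod M (W : {vspace M}) : submod W -> W <> 0%VS ->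
  exists D (f : 'Hom(D, M)),
    [/\ simple D, mlinear f, forall x, f x \in W & forall x, f x = 0 -> x = 0].
Proof.
move=> sW W0.
have [|V [D [sV /andP[_ VW] nV sD [g [mg gV gK]]]]] := layer (@submod0 _ _ M) sW (sub0v _).
  by move=> e; apply: W0.
have mv := mlinear_subm_val (sU := sV).
have mgv : mlinear (g \o subm_val sV)%VF.
  by move=> a x; rewrite !comp_lfunE mv mg ?subm_valP.
have bij : bijective (g \o subm_val sV)%VF.
  apply: lfun_bij => [x | y].
    rewrite comp_lfunE => gx; apply: (@subm_val_inj _ _ _ _ sV); rewrite linear0.
    by apply/eqP; rewrite -memv0 -gK memv_cap subm_valP memv_ker gx /=.
  have : y \in (g @: V)%VS by rewrite gV memvf.
  case/memv_imgP=> x Vx ->; have [z <-] := subm_ex sV Vx.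
  by exists z; rewrite comp_lfunE.
exists (subm sV), (subm_val sV); split=> //.
- by apply: simple_miso sD; apply: miso_sym; exists (g \o subm_val sV)%VF.
- by move=> x; rewrite (subvP VW) // subm_valP.
by move=> x e; apply: (@subm_val_inj _ _ _ _ sV); rewrite e linear0.
Qed.

End SubquotientFacts.

Lemma hom_neq0 (k : fieldType) (V W : vectType k) (f : 'Hom(V, W)) x : f x != 0 -> f <> 0.
Proof. by move=> fx e; rewrite e zero_lfunE eqxx in fx. Qed.

Section TensorStructures.

Variable k : fieldType.

Section Basic.

Variables (B B' C : falgType k) (T : tensor_structure B B' C).

Lemma tswap_linear : linear (fun c : C => (tswap B B' (tn T c) : tens_alg B' B)).
Proof. by move=> a x y; rewrite tn_linear linearP. Qed.

Lemma tswap_one : tswap B B' (tn T 1) = (1 : tens_alg B' B).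
Proof. by rewrite tn_one; apply: tswapE. Qed.

Lemma tswap_mul_alg (x y : tens_alg B B') :
  (tswap B B' (x * y) : tens_alg B' B) = (tswap B B' x : tens_alg B' B) * tswap B B' y.
Proof.
move: x; apply: (tens_ext (f := fun x => (tswap B B' ((x : tens_alg B B') * y) : tens_alg B' B))
  (g := fun x => (tswap B B' x : tens_alg B' B) * tswap B B' y)).
- by move=> c u v; rewrite mulrDl -scalerAl linearP.
- by move=> c u v; rewrite linearP mulrDl -scalerAl.
move=> a a'; move: y; apply: (tens_ext (f := fun y => (tswap B B' ((a ⊗ a' : tens_alg B B') * y) : tens_alg B' B))
  (g := fun y => (tswap B B' (a ⊗ a') : tens_alg B' B) * tswap B B' y)).
- by move=> c u v; rewrite mulrDr -scalerAr linearP.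
- by move=> c u v; rewrite linearP mulrDr -scalerAr.
move=> b b'; rewrite [_ * _](tens_mul_pure a b a' b') !tswapE.
by apply/esym; apply: tens_mul_pure.
Qed.

(** Transparent, so that its [tm] agrees with the original one, arguments exchanged, by
    computation. *)
Definition tensor_swap : tensor_structure B' B C.
Proof.
apply: (@TensorStructure k B' B C (fun c => tswap B B' (tn T c)) (fun b' b => tm T b b')).
- exact: tswap_linear.
- exact: tswap_one.
- by move=> c d; rewrite tn_mul tswap_mul_alg.
- by move=> b' b; rewrite tn_tm; apply: tswapE.
move=> c d /(congr1 (tswap B' B)); rewrite !tswapK; exact: tn_inj.
Defined.

Lemma tmod_swap (T' : tensor_structure B' B C) (M : fmod B) (M' : fmod B') :
  (forall b b', tm T' b' b = tm T b b') ->
  mlinear (tswap M M' : 'Hom(tmod T M M', tmod T' M' M)) /\ bijective (tswap M M').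
Proof.
move=> TT'; split.
  apply: (tmod_mlinear (T := T)) => b b' x x'; rewrite !tswapE -TT'.
  by apply: esym; apply: (tmod_act T').
by exists (tswap M' M) => z; rewrite tswapK.
Qed.

End Basic.

Definition tensor_self (A A' : falgType k) : tensor_structure A A' (tens_alg A A').
Proof.
exact: (@TensorStructure k A A' (tens_alg A A') id (@tpure k A A')
  (fun _ _ _ => erefl) erefl (fun _ _ => erefl) (fun _ _ => erefl) (fun _ _ => id)).
Defined.

Lemma tmod_self (A A' : falgType k) (M : fmod A) (M' : fmod A') :
  tmod (tensor_self A A') M M' = tens_mod M M'.
Proof. exact: fmod_eq. Qed.

Section Subalgebra.

Variables (A A' : falgType k) (B : {aspace A}) (B' : {aspace A'}).
Hypotheses (B1 : 1 \in B) (B1' : 1 \in B').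

Lemma one_tens_sub : 1 \in tens_aspace B B'.
Proof. exact: (mem_tens_sub B1 B1'). Qed.

Let proj : 'Hom(tens A A', tens (subvs_of B) (subvs_of B')) :=
  tmap (linfun (vsproj B)) (linfun (vsproj B')).

Let projE a a' : proj (a ⊗ a') = vsproj B a ⊗ vsproj B' a'.
Proof. by rewrite tmapE !lfunE. Qed.

Lemma subvs_tens_ind (Q : subvs_of (tens_aspace B B') -> Prop) :
    Q 0 -> (forall x y, Q x -> Q y -> Q (x + y)) -> (forall c x, Q x -> Q (c *: x)) ->
    (forall (b : subvs_of B) (b' : subvs_of B'), Q (vsproj _ (tpure (vsval b) (vsval b')))) ->
  forall x, Q x.
Proof.
move=> Q0 QD QZ Qp x; rewrite -[x]vsvalK; move: (vsval x) (subvsP x).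
apply: tens_sub_ind => [|y z|c y|b b' Bb Bb'].
- by rewrite linear0.
- by rewrite linearD; apply: QD.
- by rewrite linearZ; apply: QZ.
by rewrite -(vsprojK Bb) -(vsprojK Bb'); apply: Qp.
Qed.

(** On the span of products from [B] and [B'] the linear projections of both factors lose nothing;
    this makes [sub_n] injective. *)
Lemma tens_sub_projK (x : subvs_of (tens_aspace B B')) :
  tmap (linfun (@vsval k A B)) (linfun (@vsval k A' B')) (proj (vsval x)) = vsval x.
Proof.
elim/subvs_tens_ind: x => [|x y hx hy|c x hx|b b'].
- by rewrite !linear0.
- by rewrite !linearD /= hx hy.
- by rewrite !linearZ /= hx.
rewrite vsprojK ?mem_tens_sub ?subvsP // projE tmapE !lfunE /=.
by rewrite !vsvalK.
Qed.

Let sub_n (c : subvs_of (tens_aspace B B')) : tens_alg (subvs_of B) (subvs_of B') :=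
  proj (vsval c).
Let sub_m (b : subvs_of B) (b' : subvs_of B') : subvs_of (tens_aspace B B') :=
  vsproj _ (tpure (vsval b) (vsval b')).

Let sub_mE b b' : vsval (sub_m b b') = tpure (vsval b) (vsval b').
Proof. by rewrite vsprojK // mem_tens_sub ?subvsP. Qed.

Let sub_linear : linear sub_n. Proof. by move=> c x y; rewrite /sub_n !linearP. Qed.

Let sub_one : sub_n 1 = 1.
Proof.
rewrite /sub_n (subvs_val1 one_tens_sub) [LHS](projE 1 1).
by rewrite -(subvs_val1 B1) -(subvs_val1 B1') !vsvalK.
Qed.

Let sub_nm b b' : sub_n (sub_m b b') = tpure b b'.
Proof. by rewrite /sub_n sub_mE [LHS]projE !vsvalK. Qed.

Let sub_mul c d : sub_n (c * d) = sub_n c * sub_n d.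
Proof.
rewrite /sub_n; elim/subvs_tens_ind: c => [|x x' hx hx'|c x hx|b b'].
- by rewrite mul0r !linear0 mul0r.
- by rewrite mulrDl !linearD /= mulrDl -hx -hx'.
- by rewrite -scalerAl !linearZ /= -scalerAl -hx.
elim/subvs_tens_ind: d => [|x x' hx hx'|c x hx|d d'].
- by rewrite mulr0 !linear0 mulr0.
- by rewrite mulrDr !linearD /= mulrDr -hx -hx'.
- by rewrite -scalerAr !linearZ /= -scalerAr -hx.
rewrite -/(sub_m b b') -/(sub_m d d') -/(sub_n (sub_m b b')) -/(sub_n (sub_m d d')) !sub_nm.
rewrite tpureM -sub_nm /sub_n; congr (proj _).
by rewrite [LHS]/= !sub_mE tpureM.
Qed.

Let sub_inj : injective sub_n.
Proof.
move=> x y e; apply: val_inj => /=.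
by rewrite -[LHS]tens_sub_projK -/(sub_n x) e tens_sub_projK.
Qed.

Definition tensor_sub : tensor_structure (subvs_of B) (subvs_of B') (subvs_of (tens_aspace B B')) :=
  TensorStructure sub_linear sub_one sub_mul sub_nm sub_inj.

Lemma tensor_sub_tm (b : subvs_of B) (b' : subvs_of B') :
  vsval (tm tensor_sub b b') = tpure (vsval b) (vsval b').
Proof. exact: sub_mE. Qed.

End Subalgebra.

Section Opposite.

Variables (B B' C : falgType k) (T : tensor_structure B B' C).

(** [B^c] and [B] carry separately chosen bases, so even the identity on tensors has to be rewritten
    in new coordinates. *)
Let pureo (b : B) (b' : B') : tens B^c B'^c := (b : B^c) ⊗ (b' : B'^c).
Let pureo' (b : B^c) (b' : B'^c) : tens B B' := (b : B) ⊗ (b' : B').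

Let oppE : forall b b', tlift pureo (b ⊗ b') = pureo b b'.
Proof.
by move=> b b'; rewrite tlift_pure // => ? c x y;
  [exact: (pure_linear_l (V := B^c)) | exact: (pure_linear_r (W := B'^c))].
Qed.

Let oppE' : forall b b', tlift pureo' (b ⊗ b') = pureo' b b'.
Proof.
by move=> b b'; rewrite tlift_pure // => ? c x y;
  [exact: (pure_linear_l (V := B)) | exact: (pure_linear_r (W := B'))].
Qed.

Let opp_alg (x : tens_alg B B') : tens_alg B^c B'^c := tlift pureo x.

Let opp_alg_linear : linear opp_alg. Proof. exact: tlift_is_linear. Qed.

Let opp_alg_mul (x y : tens_alg B B') : opp_alg (x * y) = opp_alg y * opp_alg x.
Proof.
move: x; apply: (tens_ext (f := fun x => opp_alg ((x : tens_alg B B') * y))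
  (g := fun x => opp_alg y * opp_alg x)).
- by move=> c u v; rewrite mulrDl -scalerAl opp_alg_linear.
- by move=> c u v; rewrite opp_alg_linear mulrDr -scalerAr.
move=> a a'; move: y; apply: (tens_ext (f := fun y => opp_alg ((a ⊗ a' : tens_alg B B') * y))
  (g := fun y => opp_alg y * opp_alg (a ⊗ a'))).
- by move=> c u v; rewrite mulrDr -scalerAr opp_alg_linear.
- by move=> c u v; rewrite opp_alg_linear mulrDl -scalerAl.
move=> b b'; rewrite [_ * _](tens_mul_pure a b a' b') /opp_alg !oppE.
by apply/esym; apply: (tens_mul_pure (b : B^c) a (b' : B'^c) a').
Qed.

Definition tensor_opp : tensor_structure B^c B'^c C^c.
Proof.
apply: (@TensorStructure k B^c B'^c C^c (fun c => opp_alg (tn T c)) (fun b b' => tm T b b')).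
- by move=> c x y; rewrite [tn T _]tn_linear opp_alg_linear.
- by rewrite tn_one; apply: oppE.
- by move=> c d; rewrite [tn T _](tn_mul T) opp_alg_mul.
- by move=> b b'; rewrite tn_tm; apply: oppE.
move=> c d e; apply: (@tn_inj _ _ _ _ T).
have inv z : tlift pureo' (tlift pureo z) = z.
  move: z; apply: tens_ext => [a u v|//|b b'].
    by rewrite !tlift_is_linear.
  by rewrite oppE [LHS]oppE'.
by rewrite -[LHS]inv -[RHS]inv; congr (tlift pureo' _).
Defined.

End Opposite.

End TensorStructures.

(** * Simple modules and projective covers over a tensor product *)

Section TensorSimple.

Variables (k : closedFieldType) (B B' C : falgType k) (T : tensor_structure B B' C).

Lemma tm_l_linear : linear (fun b => tm T b 1). Proof. exact: tm_linear_l. Qed.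
Lemma tm_l_mul b d : tm T (b * d) 1 = tm T b 1 * tm T d 1.
Proof. by rewrite tmM mulr1. Qed.
Lemma tm_r_mul b d : tm T 1 (b * d) = tm T 1 b * tm T 1 d.
Proof. by rewrite tmM mulr1. Qed.

Definition resl (X : fmod C) : fmod B := resm tm_l_linear (tm1 T) tm_l_mul X.
Definition resr (X : fmod C) : fmod B' := resm (tm_linear_r T 1) (tm1 T) tm_r_mul X.

Lemma submod_resl (X : fmod C) (U : {vspace X}) : submod U -> submod (U : {vspace resl X}).
Proof. by move=> sU b x; apply: sU. Qed.

Variables (S : fmod B) (S' : fmod B').
Hypotheses (sS : simple S) (sS' : simple S').

(** A nonzero submodule [U] contains a simple [B]-module, which some contraction identifies with
    [S]. By Schur its inclusion is [s |-> s ⊗ w] for a fixed nonzero [w], and simplicity of [S']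
    spreads [w] to all of [S']. *)
Lemma tmod_simple : simple (tmod T S S').
Proof.
have [s0 s0n] := simple_neq0 sS; have [xi0 xi0E] := functional_neq0 s0n.
split.
  have [s' s'n] := simple_neq0 sS'; apply/eqP=> e.
  have := memvf (s0 ⊗ s' : tmod T S S'); rewrite e memv0; apply/negP.
  exact: pure_neq0.
move=> U sU; have [-> | U0] := eqVneq U 0%VS; [by left | right].
have [|D [f [sD mf fU fi]]] := simple_submod (submod_resl sU).
  by move=> e; move/eqP: U0.
have [y y0] := simple_neq0 sD.
have [xi xin] : exists xi, contr_r S xi (f y) != 0.
  apply: NNPP => h; move/eqP: y0; apply; apply: fi; apply: contr_r_eq0 => xi.
  by apply/eqP; apply: contraT => n; case: h; exists xi.
have mc xi1 : mlinear (contr_r S xi1 \o f : 'Hom(D, S))%VF.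
  by move=> b x; rewrite !comp_lfunE mf contr_r_act.
have bc : bijective (contr_r S xi \o f : 'Hom(D, S))%VF.
  by apply: (schur (x := y)) => //; rewrite comp_lfunE.
have [g [mg _ gK]] := bij_mlinear_inv (mc xi) bc.
pose w := contr_l S' xi0 (f (g s0)).
have fgE s : f (g s) = s ⊗ w.
  apply: contr_r_ext => xi1.
  have [c cE] := schur_scalar sS (mlinear_comp (mc xi1) mg).
  have {}cE x : contr_r S xi1 (f (g x)) = c *: x by rewrite -cE !comp_lfunE.
  rewrite cE contr_rE /w -contrC cE linearZ /= xi0E /GRing.scale /= mulr1 //.
have w0 : w != 0.
  apply: contraNneq s0n => e; rewrite -(gK s0) comp_lfunE fgE e pure0r linear0 //.
have sU' s : submod (linfun (fun s' : S' => s ⊗ s' : tens S S') @^-1: U : {vspace S'})%VS.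
  move=> b' s'; rewrite -!memv_preim !(linfunE (pure_linear_r s)) => Us.
  by have := sU (tm T 1 b') _ Us; rewrite tmod_act act1.
apply/vspaceP=> z; rewrite memvf; move: z.
suff h s s' : s ⊗ s' \in U.
  move=> z; rewrite [z]tens_sum; apply: memv_suml => i _; apply: memv_suml => j _.
  by rewrite memvZ.
have : s' \in (linfun (fun s' : S' => s ⊗ s' : tens S S') @^-1: U)%VS.
  rewrite (simple_sub sS' (sU' s) _ w0) ?memvf //.
  by rewrite -memv_preim (linfunE (pure_linear_r s)) -fgE fU.
by rewrite -memv_preim (linfunE (pure_linear_r s)).
Qed.

End TensorSimple.

Section TensorSimpleComplete.

Variables (k : closedFieldType) (B B' C : falgType k) (T : tensor_structure B B' C).

(** [U] is a maximal submodule of [M] whose tensor product with [S'] is killed by [f]. On a simple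
    layer just above it, [f] induces a nonzero map from a simple tensor product to [X]. *)
Lemma simple_of_tmod (M : fmod B) (S' : fmod B') (X : fmod C) (f : 'Hom(tmod T M S', X)) :
  simple S' -> simple X -> mlinear f -> f <> 0 -> exists S, simple S /\ miso X (tmod T S S').
Proof.
move=> sS' sX mf nf.
pose Pr (U : {vspace M}) := submod U /\ forall x s, x \in U -> f (x ⊗ s) = 0.
have [|U [[sU fU] mU]] := @max_vspace _ _ Pr 0%VS.
  split; first exact: submod0.
  by move=> x s; rewrite memv0 => /eqP->; rewrite pure0l linear0.
have nU : U <> fullv.
  move=> e; apply: nf; apply/lfunP; apply: lin_ext_tens => x s.
  by rewrite zero_lfunE fU // e memvf.
have [V [S [sV /andP[UV _] nUV sS [g [mg gV gK]]]]] := layer sU (@submodT _ _ M) (subvf _) nU.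
have [t [tV tE]] := subquotient_section gV.
have gU x y : x \in V -> y \in V -> g x = g y -> x - y \in U.
  move=> Vx Vy e; rewrite -gK memv_cap rpredB // memv_ker linearB /= e subrr //.
have [||F FE] := @bilinear_lift _ _ _ X (fun d s => f (t d ⊗ s)).
- by move=> s c x y; rewrite linearP pure_linear_l linearP.
- by move=> d c x y; rewrite pure_linear_r linearP.
(* The section [t] is only linear, but its failure to be a module map lies in [U], where [f]
   vanishes. *)
have tU b d : t (b ∙ d) - b ∙ t d \in U.
  by apply: gU; rewrite ?tV ?sV ?tV // tE mg ?tV // tE.
have mF : mlinear (F : 'Hom(tmod T S S', X)).
  apply: tmod_mlinear => b b' d s; rewrite !FE -mf tmod_act.
  by apply: lfun_eq_sub; rewrite -pureBl fU.
have [x [s [Vx fx]]] : exists x s, x \in V /\ f (x ⊗ s) != 0.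
  apply: NNPP => h; apply: nUV; apply/esym/mU => //; split=> // x s Vx.
  by apply/eqP; apply: contraT => n; case: h; exists x, s.
exists S; split=> //; apply: miso_sym; exists F => //.
apply: (@schur _ _ (tmod T S S') X F (g x ⊗ s)) => //; first exact: tmod_simple.
rewrite FE; suff -> : f (t (g x) ⊗ s) = f (x ⊗ s) by [].
by apply: lfun_eq_sub; rewrite -pureBl fU // gU // tE.
Qed.

(** A simple [B']-submodule [S'] of [X] gives a nonzero map from B ⊗ S' to [X]. *)
Lemma simple_tens (X : fmod C) : simple X ->
  exists (S : fmod B) (S' : fmod B'), [/\ simple S, simple S' & miso X (tmod T S S')].
Proof.
move=> sX; have [x x0] := simple_neq0 sX.
have [|S' [f [sS' mf _ fi]]] := simple_submod (@submodT _ _ (resr T X)).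
  by move=> e; have := memvf (x : resr T X); rewrite e memv0 (negPf x0).
pose f' : 'Hom(S', X) := f.
have [||F FE] := @bilinear_lift _ _ _ X (fun (b : B) (s : S') => tm T b 1 ∙ f' s).
- by move=> s c a b; rewrite tm_linear_l actDl actZl.
- by move=> b c s s'; rewrite linearP actDr actZr.
have [y y0] := simple_neq0 sS'.
have [||S [sS iS]] := @simple_of_tmod (regular_mod B) S' X F sS' sX.
- apply: tmod_mlinear => b b' a s; rewrite !FE /f' mf.
  transitivity (tm T (b * a) 1 ∙ (tm T 1 b' ∙ f' s)) => //.
  by rewrite -!actM !tmM !mulr1 !mul1r.
- apply: (hom_neq0 (x := 1 ⊗ y)); rewrite FE tm1 act1 /f'.
  by apply: contra y0 => /eqP/fi->.
by exists S, S'.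
Qed.

Definition tensor_Sim (I I' : finType) (S : I -> fmod B) (S' : I' -> fmod B') (x : I * I') :=
  tmod T (S x.1) (S' x.2).

Lemma nonzero_slices (M N : fmod B) (M' N' : fmod B') (h : 'Hom(tmod T M M', tmod T N N')) :
  h <> 0 -> (exists x' xi, slice_l h x' xi <> 0) /\ (exists x xi, slice_r h x xi <> 0).
Proof.
move=> nh; split; apply: NNPP => a; apply: nh; apply/lfunP; apply: lin_ext_tens => x x'.
  rewrite zero_lfunE; apply: contr_r_eq0 => xi; rewrite -slice_lE.
  apply/eqP; apply: contraT => n; case: a; exists x', xi; exact: hom_neq0 n.
rewrite zero_lfunE; apply: contr_l_eq0 => xi; rewrite -slice_rE.
apply/eqP; apply: contraT => n; case: a; exists x, xi; exact: hom_neq0 n.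
Qed.

Section Sim.

Variables (I I' : finType) (S : I -> fmod B) (S' : I' -> fmod B').
Hypotheses (simS : is_Sim S) (simS' : is_Sim S').

Lemma tensor_is_Sim : is_Sim (tensor_Sim S S').
Proof.
have [sS iS cS] := simS; have [sS' iS' cS'] := simS'.
split=> [[i i'] | [i i'] [j j'] | X sX]; first exact: tmod_simple.
  case=> h mh bh; have [x x0] := simple_neq0 (tmod_simple T (sS i) (sS' i')).
  have [|[x1 [xi n1]] [x2 [xi2 n2]]] := @nonzero_slices _ _ _ _ h.
    move=> e; move/eqP: x0; apply; apply: (bij_inj bh).
    by rewrite e !zero_lfunE.
  have [y ny] := lfun_neq0 n1; have [z nz] := lfun_neq0 n2.
  congr (_, _).
    apply: iS; exists (slice_l h x1 xi); first exact: slice_l_mlinear.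
    apply: schur ny => //; exact: slice_l_mlinear.
  apply: iS'; exists (slice_r h x2 xi2); first exact: slice_r_mlinear.
  apply: schur nz => //; exact: slice_r_mlinear.
have [S1 [S1' [s1 s1' h]]] := simple_tens sX.
have [i hi] := cS _ s1; have [i' hi'] := cS' _ s1'.
by exists (i, i'); apply: miso_trans h _; apply: tmod_miso.
Qed.

End Sim.

Section Cover.

Variables (P S : fmod B) (P' S' : fmod B') (p : 'Hom(P, S)) (p' : 'Hom(P', S')).
Hypotheses (cp : projective_cover p) (cp' : projective_cover p').
Hypotheses (sS : simple S) (sS' : simple S').

(** If a proper [U] mapped onto the target, some map [h] from P ⊗ P' onto a simple module [S1 ⊗ S1']
    would kill [U]. Its slices are maps from covers to simple modules, so they vanish on ker p and
    ker p'; thus [h] vanishes on ker (p ⊗ p') and on [U], which together span P ⊗ P'. *)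
Lemma tmod_cover : projective_cover (tmap p p' : 'Hom(tmod T P P', tmod T S S')).
Proof.
have [pP mp _ _] := cp; have [pP' mp' _ _] := cp'.
have sp := cover_surj cp; have sp' := cover_surj cp'.
split.
- exact: tmod_projective.
- exact: tmap_mlinear.
- by apply/limg_fullP; apply: tmap_surj.
move=> U sU eU; apply: NNPP => nU.
have [U1 [D [sU1 /andP[UU1 _] nU1 sD [g [mg gV gK]]]]] :=
  colayer sU (@submodT _ _ (tmod T P P')) (subvf _) nU.
have mg' : mlinear g by move=> a x; apply: mg; rewrite memvf.
have [S1 [S1' [s1 s1' [f mf bf]]]] := simple_tens sD.
pose h := (f \o g)%VF; have mh : mlinear h by apply: mlinear_comp.
have hU z : z \in U -> h z = 0.
  move/(subvP UU1); rewrite -gK memv_cap memv_ker => /andP[_ /eqP e].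
  by rewrite comp_lfunE e linear0.
have h0 z : tmap p p' z = 0 -> h z = 0.
  apply: tmap_ker => x x' e.
    apply: contr_r_eq0 => xi; rewrite -slice_lE; apply/eqP; apply: contraT => n.
    have [kE _] := cover_hom cp sS s1 (slice_l_mlinear mh x' xi) n.
    by rewrite -memv_ker kE memv_ker e eqxx in n.
  apply: contr_l_eq0 => xi; rewrite -slice_rE; apply/eqP; apply: contraT => n.
  have [kE _] := cover_hom cp' sS' s1' (slice_r_mlinear mh x xi) n.
  by rewrite -memv_ker kE memv_ker e eqxx in n.
apply: nU1; apply/vspaceP=> z; rewrite memvf -gK memv_cap memvf /= memv_ker.
rewrite -(inj_eq (bij_inj bf)) linear0 -comp_lfunE -/h.
have: tmap p p' z \in (tmap p p' @: U)%VS by rewrite eU memvf.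
case/memv_imgP=> u Uu e; rewrite -[z](subrK u) linearD /= (hU u Uu) addr0; apply/eqP/h0.
by rewrite linearB /= e subrr.
Qed.

End Cover.

End TensorSimpleComplete.

(** * Tensor products of directed algebras and of standard modules *)

Section TensorDirected.

Variables (k : closedFieldType) (B B' C : falgType k) (T : tensor_structure B B' C).
Variables (I I' : finType) (S : I -> fmod B) (S' : I' -> fmod B') (le : rel I) (le' : rel I').
Hypotheses (simS : is_Sim S) (simS' : is_Sim S').

(** Up to a scalar an endomorphism of the cover lands in the radical, and a nonzero radical one
    would force j <> j. *)
Lemma radical_scalar_end (D : falgType k) (J : finType) (L : J -> fmod D) (leJ : rel J) j
    (P : fmod D) (p : 'Hom(P, L j)) :
  is_Sim L -> radical_homs_increase L leJ -> projective_cover p -> scalar_end P.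
Proof.
move=> [sL _ _] rad cp f mf; have [pP mp _ _] := cp.
have [c cE] : exists c, forall x, p (f x) = c *: p x.
  case: (classic ((p \o f)%VF = 0)) => [e | /lfun_neq0[x nx]].
    by exists 0 => x; rewrite scale0r -comp_lfunE e zero_lfunE.
  have mpf := mlinear_comp mp mf.
  have [kE _] := cover_hom cp (sL j) (sL j) mpf nx.
  have [|g gE] := @lfun_factor _ _ _ _ p (p \o f)%VF.
    by move=> y /eqP; rewrite -memv_ker -kE memv_ker => /eqP.
  have mg : mlinear g.
    by move=> a y; have [z <-] := cover_surj cp y; rewrite -mp -!gE mpf.
  by have [c cE] := schur_scalar (sL j) mg; exists c => y; rewrite -cE -gE comp_lfunE.
exists c => x; pose g := f - c *: \1%VF.
have gE u : g u = f u - c *: u by rewrite add_lfunE opp_lfunE scale_lfunE id_lfunE.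
have mg : mlinear g by apply: mlinearB => //; apply/mlinearZ/mlinear_id.
case: (classic (g = 0)) => [e | ng].
  by apply/eqP; rewrite -subr_eq0 -gE e zero_lfunE.
have [|_ /eqP//] := rad j j P P p p g cp cp mg ng.
by move=> u; rewrite gE linearB linearZ /= cE subrr.
Qed.

Lemma radical_homs_le (D : falgType k) (J : finType) (L : J -> fmod D) (leJ : rel J) (a b : J)
    (Q Q' : fmod D) (q : 'Hom(Q, L a)) (q' : 'Hom(Q', L b)) (u : 'Hom(Q', Q)) :
  is_Sim L -> reflexive leJ -> radical_homs_increase L leJ ->
  projective_cover q -> projective_cover q' -> mlinear u -> u <> 0 -> leJ a b.
Proof.
move=> simL rJ rJ' cq cq' mu nu; have [_ mq _ _] := cq.
case: (classic ((q \o u)%VF = 0)) => [e | n].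
  have [|//] := rJ' a b Q Q' q q' u cq cq' mu nu.
  by move=> y; rewrite -comp_lfunE e zero_lfunE.
by rewrite (cover_hom_Sim simL cq' (mlinear_comp mq mu) n).
Qed.

(** Slices of a nonzero map give i <= j in both components. If i = j, both covers have scalar
    endomorphisms, so the map is a scalar; landing in the radical, it is zero. *)
Lemma tensor_radical : reflexive le -> reflexive le' ->
  (forall i, exists (P : fmod B) (p : 'Hom(P, S i)), projective_cover p) ->
  (forall i, exists (P : fmod B') (p : 'Hom(P, S' i)), projective_cover p) ->
  radical_homs_increase S le -> radical_homs_increase S' le' ->
  radical_homs_increase (tensor_Sim T S S') (prod_rel le le').
Proof.
move=> refl refl' cov cov' rad rad'.
have [sS _ _] := simS; have [sS' _ _] := simS'.
have {cov} [P cov] := fin_all_exists cov; have [p cp] := fin_all_exists cov.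
have {cov'} [P' cov'] := fin_all_exists cov'; have [p' cp'] := fin_all_exists cov'.
have pT x : projective_cover (tmap (p x.1) (p' x.2) :
    'Hom(tmod T (P x.1) (P' x.2), tensor_Sim T S S' x)).
  by apply: tmod_cover.
have sT x : simple (tensor_Sim T S S' x) by apply: tmod_simple.
move=> i j X Y p0 q0 f cX cY mf nf pf.
have [h [mh bh hE]] := cover_iso (pT j) cY.
have [g [mg bg gE]] := cover_iso cX (pT i).
pose f1 := (g \o f \o h)%VF.
have mf1 : mlinear f1 by do 2?apply: mlinear_comp.
have f1p z : tmap (p i.1) (p' i.2) (f1 z) = 0 by rewrite !comp_lfunE gE pf.
have nf1 : f1 <> 0.
  move=> e; apply: nf; apply/lfunP=> y; rewrite zero_lfunE; apply: (bij_inj bg).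
  have [h' _ h'K] := bh.
  by have := congr1 (fun u : 'Hom(_, _) => u (h' y)) e; rewrite !comp_lfunE h'K zero_lfunE linear0.
have [[x1 [xi1 n1]] [x2 [xi2 n2]]] := nonzero_slices nf1.
have l1 : le i.1 j.1 :=
  radical_homs_le simS refl rad (cp _) (cp _) (slice_l_mlinear mf1 x1 xi1) n1.
have l2 : le' i.2 j.2 :=
  radical_homs_le simS' refl' rad' (cp' _) (cp' _) (slice_r_mlinear mf1 x2 xi2) n2.
split; first by rewrite /prod_rel l1 l2.
apply/eqP=> e; subst j; have [y ny] := simple_neq0 (sS i.1); have [y' ny'] := simple_neq0 (sS' i.2).
have [x xE] := cover_surj (cp _) y; have [x' xE'] := cover_surj (cp' _) y'.
have x0 : x != 0 by apply: contraNneq ny => e; rewrite -xE e linear0.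
have [G mG GE] := hom_scalar_tens (radical_scalar_end simS rad (cp i.1)) (ex_intro _ x x0) mf1.
have [c cE] := radical_scalar_end simS' rad' (cp' i.2) mG.
have fc z : f1 z = c *: z.
  rewrite -[z in RHS]id_lfunE -scale_lfunE; move: z; apply: lin_ext_tens => v w.
  by rewrite GE cE pureZr scale_lfunE id_lfunE.
apply: nf1; apply/lfunP=> z; rewrite zero_lfunE fc.
have := f1p (x ⊗ x'); rewrite fc linearZ /= tmapE xE xE' => /eqP.
rewrite scaler_eq0 (negPf (pure_neq0 ny ny')) orbF => /eqP->.
by rewrite scale0r.
Qed.

Lemma tensor_directed : directed S le -> directed S' le' ->
  directed (tensor_Sim T S S') (prod_rel le le').
Proof.
move=> dS dS'; have [qh _] := dS; have [qh' _] := dS'.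
have [r a t _] := qh; have [r' a' t' _] := qh'.
have simT := tensor_is_Sim T simS simS'.
have [sS _ _] := simS; have [sS' _ _] := simS'.
apply: directed_criterion => //.
- by move=> x; rewrite /prod_rel r r'.
- case=> i i' [j j'] /andP[/andP[/= l1 l2] /andP[/= l3 l4]].
  by congr (_, _); [apply: a; rewrite l1 l3 | apply: a'; rewrite l2 l4].
- by move=> y x z /andP[l1 l2] /andP[l3 l4]; apply/andP; split; [apply: t l1 l3 | apply: t' l2 l4].
- case=> i i'; have [P [p cp]] := quasi_hereditary_cover qh i.
  have [P' [p' cp']] := quasi_hereditary_cover qh' i'.
  by exists (tmod T P P'), (tmap p p'); apply: tmod_cover.
- by move=> x; apply: schur_scalar; have [] := simT.
apply: tensor_radical => //; [exact: quasi_hereditary_cover qh | exact: quasi_hereditary_cover qh' | | ].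
  exact: directed_radical dS.
exact: directed_radical dS'.
Qed.

End TensorDirected.

Lemma miso_quo_ker (k : fieldType) (A : falgType k) (M N : fmod A) (g : 'Hom(M, N))
    (sK : submod (lker g)) : mlinear g -> (forall y, exists x, g x = y) -> miso N (quo_mod sK).
Proof.
move=> mg sg; have [|f mf fE] := quo_lift sK mg.
  by move=> x; rewrite memv_ker => /eqP.
apply: miso_sym; exists f => //; apply: lfun_bij => [y | y].
  have [x <-] := quo_pi_surj y; rewrite fE => /eqP gx.
  by apply/eqP; rewrite quo_pi_eq0 memv_ker.
by have [x <-] := sg y; exists (quo_pi _ x); rewrite fE.
Qed.

Section TensorStandard.

Variables (k : closedFieldType) (B B' C : falgType k) (T : tensor_structure B B' C).
Variables (I I' : finType) (S : I -> fmod B) (S' : I' -> fmod B') (le : rel I) (le' : rel I').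
Hypotheses (simS : is_Sim S) (simS' : is_Sim S').
Hypotheses (qh : quasi_hereditary S le) (qh' : quasi_hereditary S' le').

(** Failing the product order means failing it in one component, so the trace in P ⊗ P' is U ⊗ P' +
    P ⊗ U', the kernel of the map to the tensor product of the two quotients. *)
Lemma tensor_standard i i' D D' : is_standard S le i D -> is_standard S' le' i' D' ->
  is_standard (tensor_Sim T S S') (prod_rel le le') (i, i') (tmod T D D').
Proof.
case=> P [p [U [sU [cp [tU mU] iD]]]] [P' [p' [U' [sU' [cp' [tU' mU'] iD']]]]].
have [sS _ _] := simS; have [sS' _ _] := simS'.
pose pi : 'Hom(P, quo_mod sU) := quo_pi U.
pose pi' : 'Hom(P', quo_mod sU') := quo_pi U'.
have mpi : mlinear pi := mlinear_quo_pi sU.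
have mpi' : mlinear pi' := mlinear_quo_pi sU'.
pose G : 'Hom(tmod T P P', tmod T (quo_mod sU) (quo_mod sU')) := tmap pi pi'.
have mG : mlinear G by apply: tmap_mlinear.
have sK := submod_ker mG.
exists (tmod T P P'), (tmap p p'), (lker G), sK; split.
- exact: tmod_cover.
- split.
    case=> j j' Y q0 f nle cY mf; apply/subvP=> _ /memv_limgP[y ->].
    have [Q [q cq]] := quasi_hereditary_cover qh j.
    have [Q' [q' cq']] := quasi_hereditary_cover qh' j'.
    have [h [mh bh _]] := cover_iso (tmod_cover T cq cq' (sS j) (sS' j')) cY.
    have [h' _ h'K] := bh; rewrite -[y]h'K; move: (h' y) => z {y}.
    have mfh := mlinear_comp mf mh.
    rewrite memv_ker -comp_lfunE -[_ (h z)]comp_lfunE -comp_lfunA.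
    suff -> : (G \o (f \o h) : 'Hom(tmod T Q Q', _))%VF = 0 by rewrite zero_lfunE.
    apply/lfunP; apply: lin_ext_tens => x x'; rewrite zero_lfunE comp_lfunE.
    move: nle; rewrite /prod_rel /= negb_and => /orP[nle | nle].
      apply: contr_r_eq0 => xi; rewrite contr_r_tmap -(@slice_lE _ _ _ _ T); apply/eqP.
      rewrite quo_pi_eq0; have := tU j Q q _ nle cq (slice_l_mlinear mfh x' (xi \o pi')%VF).
      by move/subvP; apply; rewrite memv_img ?memvf.
    apply: contr_l_eq0 => xi; rewrite contr_l_tmap -(@slice_rE _ _ _ _ T); apply/eqP.
    rewrite quo_pi_eq0; have := tU' j' Q' q' _ nle cq' (slice_r_mlinear mfh x (xi \o pi)%VF).
    by move/subvP; apply; rewrite memv_img ?memvf.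
  move=> W cW; apply/subvP=> z; rewrite memv_ker => /eqP Gz.
  rewrite -(quo_pi_eq0 (M := tmod T P P')); apply/eqP; move: z Gz.
  apply: tmap_ker => x x' /eqP; rewrite quo_pi_eq0 => Ux; apply/eqP; rewrite quo_pi_eq0.
    have l : linear (fun x : P => x ⊗ x' : tmod T P P') by apply: pure_linear_l.
    rewrite -(linfunE l) memv_preim; move: x Ux; apply/subvP/mU => j Q q f nle cq mf.
    apply/subvP=> _ /memv_limgP[y ->]; rewrite -memv_preim (linfunE l).
    have := cW (j, i') (tmod T Q P') (tmap q p') (tmap f \1%VF).
    have nle2 : ~~ prod_rel le le' (j, i') (i, i') by rewrite /prod_rel /= negb_and nle.
    move/(_ nle2 (tmod_cover T cq cp' (sS j) (sS' i')) (tmap_mlinear (T := T) mf (@mlinear_id _ _ P'))).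
    by move/subvP/(_ (f y ⊗ x')); apply; rewrite -[x' in f y ⊗ x']id_lfunE -tmapE memv_img ?memvf.
  have l : linear (fun x' : P' => x ⊗ x' : tmod T P P') by apply: pure_linear_r.
  rewrite -(linfunE l) memv_preim; move: x' Ux; apply/subvP/mU' => j Q q f nle cq mf.
  apply/subvP=> _ /memv_limgP[y ->]; rewrite -memv_preim (linfunE l).
  have := cW (i, j) (tmod T P Q) (tmap p q) (tmap \1%VF f).
  have nle2 : ~~ prod_rel le le' (i, j) (i, i') by rewrite /prod_rel /= negb_and nle orbT.
  move/(_ nle2 (tmod_cover T cp cq (sS i) (sS' j)) (tmap_mlinear (T := T) (@mlinear_id _ _ P) mf)).
  by move/subvP/(_ (x ⊗ f y)); apply; rewrite -[x in x ⊗ f y]id_lfunE -tmapE memv_img ?memvf.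
apply: miso_trans (tmod_miso T iD iD') _; apply: miso_quo_ker mG _.
by apply: tmap_surj; apply: quo_pi_surj.
Qed.

End TensorStandard.

Lemma memv_tens (k : fieldType) (V V' U : vectType k) (f : 'Hom(tens V V', U)) (W : {vspace U}) :
  (forall v v', f (v ⊗ v') \in W) -> forall z, f z \in W.
Proof.
move=> h z; rewrite [z]tens_sum linear_sum; apply: memv_suml => i _.
by rewrite linear_sum; apply: memv_suml => j _; rewrite linearZ /= memvZ.
Qed.

Lemma ind_span (k : fieldType) (A : falgType k) (B : {aspace A}) (N : fmod (subvs_of B))
    (W : {vspace ind_mod N}) : (forall a x, ind_pure a x \in W) -> forall z, z \in W.
Proof.
move=> h z; rewrite -quo_pi_eq0 -[X in _ == X](zero_lfunE _ z); apply/eqP; move: z.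
by apply: ind_ext => a x; rewrite zero_lfunE; apply/eqP; rewrite quo_pi_eq0.
Qed.

(** * Induction commutes with tensor products *)

Section TensorInduction.

Variables (k : fieldType) (A A' : falgType k) (B : {aspace A}) (B' : {aspace A'}).
Hypotheses (B1 : 1 \in B) (B1' : 1 \in B').

Local Notation C := (subvs_of (tens_aspace B B')).
Local Notation T := (tensor_sub B1 B1').
Local Notation TA := (tensor_self A A').
Local Notation C1 := (one_tens_sub B1 B1').

Section Modules.

Variables (N : fmod (subvs_of B)) (N' : fmod (subvs_of B')).

(* (a ⊗ x) ⊗ (a' ⊗ x') |-> (a ⊗ a') ⊗ (x ⊗ x') induces the inverse of ind_tens *)
Let sigma : tens (free_mod N) (free_mod N') -> ind_mod (tmod T N N') :=
  tlift (fun (z : free_mod N) (z' : free_mod N') =>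
    tlift2 (fun (a : A) (x : N) (a' : A') (x' : N') =>
      ind_pure (M := tmod T N N') (tpure a a') (x ⊗ x')) z z').

Let sigmaE a x a' x' :
  sigma ((a ⊗ x) ⊗ (a' ⊗ x')) = ind_pure (M := tmod T N N') (tpure a a') (x ⊗ x').
Proof.
rewrite /sigma tlift_pure; [|exact: tlift2_linear_l|exact: tlift2_linear_r].
rewrite tlift2_pure // => [w v' w'|v v' w'|v w w'|v w v'] c y z.
- by rewrite /tpure pure_linear_l ind_pure_linear_l.
- by rewrite pure_linear_l ind_pure_linear_r.
- by rewrite /tpure pure_linear_r ind_pure_linear_l.
by rewrite pure_linear_r ind_pure_linear_r.
Qed.

Let sigma_linear : linear sigma. Proof. exact: tlift_is_linear. Qed.

Let act_l (b : subvs_of B) x x' : ((b ∙ x) ⊗ x' : tmod T N N') = tm T b 1 ∙ (x ⊗ x' : tmod T N N').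
Proof. by rewrite tmod_act act1. Qed.

Let act_r (b : subvs_of B') x x' : (x ⊗ (b ∙ x') : tmod T N N') = tm T 1 b ∙ (x ⊗ x' : tmod T N N').
Proof. by rewrite tmod_act act1. Qed.

Let tpure_l a a' (b : subvs_of B) : tpure (a * vsval b) a' = tpure a a' * vsval (tm T b 1).
Proof. by rewrite tensor_sub_tm tpureM (subvs_val1 B1') mulr1. Qed.

Let tpure_r a a' (b : subvs_of B') : tpure a (a' * vsval b) = tpure a a' * vsval (tm T 1 b).
Proof. by rewrite tensor_sub_tm tpureM (subvs_val1 B1) mulr1. Qed.

Let sigma_bal_l (z : free_mod N) z' : z \in balance_sub N -> sigma (z ⊗ z') = 0.
Proof.
have l : linear (fun z : free_mod N => sigma (z ⊗ z')).
  by move=> c u v; rewrite pure_linear_l sigma_linear.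
move=> bz; rewrite -(linfunE l); apply/eqP; rewrite -memv_ker; move: z bz.
apply/subvP/balance_sub_le => a b x; rewrite memv_ker (linfunE l); apply/eqP.
have l2 : linear (fun z' : free_mod N' => sigma (balance a b x ⊗ z')).
  by move=> c u v; rewrite pure_linear_r sigma_linear.
rewrite -(linfunE l2) -[RHS](zero_lfunE _ z'); move: z' {l}.
apply: lin_ext_tens => a' x'; rewrite (linfunE l2) zero_lfunE /balance pureBl.
rewrite -[sigma _](linfunE sigma_linear) linearB /= !(linfunE sigma_linear) !sigmaE.
by rewrite tpure_l act_l ind_pure_balanced subrr.
Qed.

Let sigma_bal_r z (z' : free_mod N') : z' \in balance_sub N' -> sigma (z ⊗ z') = 0.
Proof.
have l : linear (fun z' : free_mod N' => sigma (z ⊗ z')).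
  by move=> c u v; rewrite pure_linear_r sigma_linear.
move=> bz; rewrite -(linfunE l); apply/eqP; rewrite -memv_ker; move: z' bz.
apply/subvP/balance_sub_le => a b x; rewrite memv_ker (linfunE l); apply/eqP.
have l2 : linear (fun z : free_mod N => sigma (z ⊗ balance a b x)).
  by move=> c u v; rewrite pure_linear_l sigma_linear.
rewrite -(linfunE l2) -[RHS](zero_lfunE _ z); move: z {l}.
apply: lin_ext_tens => a' x'; rewrite (linfunE l2) zero_lfunE /balance pureBr.
rewrite -[sigma _](linfunE sigma_linear) linearB /= !(linfunE sigma_linear) !sigmaE.
by rewrite tpure_r act_r ind_pure_balanced subrr.
Qed.

(** [F] comes from adjunction, and [F] after [sigma] is the tensor product [pi] of the two
    projections. As [sigma] is onto and vanishes on the kernel of [pi], [F] is injective. *)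
Lemma ind_tens : exists F : 'Hom(ind_mod (tmod T N N'), tmod TA (ind_mod N) (ind_mod N')),
  [/\ mlinear F, bijective F &
    forall x x', F (ind_unit C1 (tmod T N N') (x ⊗ x')) = ind_unit B1 N x ⊗ ind_unit B1' N' x'].
Proof.
pose eta := tmap (ind_unit B1 N) (ind_unit B1' N').
have meta : mlinear (eta : 'Hom(tmod T N N', res C1 (tmod TA (ind_mod N) (ind_mod N')))).
  apply: tmod_mlinear => b b' x x'; rewrite res_actE tensor_sub_tm !tmapE.
  by rewrite !ind_unit_mlinear; apply: esym; apply: (tmod_act TA).
have [F mF FE] := ind_hom meta.
have FE' x x' : F (ind_unit C1 (tmod T N N') (x ⊗ x')) = ind_unit B1 N x ⊗ ind_unit B1' N' x'.
  by rewrite FE tmapE.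
pose pi : 'Hom(tens (free_mod N) (free_mod N'), tens (ind_mod N) (ind_mod N')) :=
  tmap (quo_pi (balance_sub N)) (quo_pi (balance_sub N')).
have Fs w : F (linfun sigma w) = pi w.
  rewrite -comp_lfunE; move: w; apply: lin_ext_tens => z z'.
  rewrite comp_lfunE (linfunE sigma_linear) tmapE; move: z; apply: tens_ext => [c u v|c u v|a x].
  - by rewrite pure_linear_l sigma_linear linearP.
  - by rewrite linearP pure_linear_l.
  move: z'; apply: tens_ext => [c u v|c u v|a' x'].
  - by rewrite pure_linear_r sigma_linear linearP.
  - by rewrite linearP pure_linear_r.
  rewrite sigmaE (ind_pureE C1) mF FE' (tmod_act TA).
  by rewrite -!ind_pureE.
exists F; split=> //; apply: lfun_bij => [y | y].
  have /memv_limgP[w ->] : y \in limg (linfun sigma).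
    apply: ind_span => a s.
    have l1 : linear (fun a : tens A A' => ind_pure (M := tmod T N N') (a : tens_alg A A') s).
      by move=> c u v; apply: (ind_pure_linear_l s c (u : tens_alg A A') v).
    rewrite -[ind_pure a s](linfunE l1); apply: memv_tens => a1 a2; rewrite (linfunE l1).
    have l2 : linear (fun s : tens N N' => ind_pure (M := tmod T N N') (tpure a1 a2) s).
      by move=> c u v; apply: ind_pure_linear_r.
    rewrite -[ind_pure _ s](linfunE l2); apply: memv_tens => x x'; rewrite (linfunE l2).
    by rewrite -sigmaE -(linfunE sigma_linear) memv_img ?memvf.
  rewrite Fs; apply: tmap_ker => z z' /eqP; rewrite quo_pi_eq0 (linfunE sigma_linear).
    exact: sigma_bal_l.
  exact: sigma_bal_r.
have s1 (z : ind_mod N) : exists u, quo_pi (balance_sub N) u = z := quo_pi_surj z.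
have s2 (z : ind_mod N') : exists u, quo_pi (balance_sub N') u = z := quo_pi_surj z.
have [w <-] := tmap_surj s1 s2 y.
by exists (linfun sigma w); rewrite Fs.
Qed.

End Modules.

(** A right module over B ⊗ B' is a left module over the tensor product of the opposite algebras,
    where [tmod_projective] applies. *)
Lemma right_mod_tens_projective : projective (right_mod B1) -> projective (right_mod B1') ->
  projective (right_mod C1).
Proof.
move=> pA pA'; apply: (proj_miso (P := tmod (tensor_opp T) (right_mod B1) (right_mod B1'))).
  exists \1%VF; last by exists id => z; rewrite id_lfunE.
  apply: tmod_mlinear => b b' x x'; rewrite !id_lfunE.
  have -> : tm (tensor_opp T) b b' = tm T b b' by [].
  rewrite {3}/act /= /right_act (tensor_sub_tm B1 B1').
  exact: esym (tens_mul_pure (x : A) (vsval (b : subvs_of B)) (x' : A') (vsval (b' : subvs_of B'))).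
exact: tmod_projective.
Qed.

End TensorInduction.

Section ExactBorelTensor.

Variables (k : closedFieldType) (A A' : falgType k) (I I' : finType).
Variables (S : I -> fmod A) (S' : I' -> fmod A') (le : rel I).

Lemma is_standard_miso (i : I) D D' : miso D D' -> is_standard S le i D -> is_standard S le i D'.
Proof.
move=> h [P [p [U [sU [c t iD]]]]]; exists P, p, U, sU; split=> //.
exact: miso_trans (miso_sym h) iD.
Qed.

Lemma prod_SimE : prod_Sim S S' = tensor_Sim (tensor_self A A') S S'.
Proof. by apply: functional_extensionality => x; rewrite /tensor_Sim tmod_self. Qed.

End ExactBorelTensor.

Lemma exact_borel_tensor (k : closedFieldType) (A A' : falgType k) (I I' : finType)
    (S : I -> fmod A) (S' : I' -> fmod A') (le : rel I) (le' : rel I')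
    (B : {aspace A}) (B' : {aspace A'}) : is_Sim S -> is_Sim S' ->
  quasi_hereditary S le -> quasi_hereditary S' le' ->
  exact_borel S le B -> exact_borel S' le' B' ->
  exact_borel (prod_Sim S S') (prod_rel le le') (tens_aspace B B').
Proof.
move=> simS simS' qh qh' [B1 pB [J [L [phi [simL bphi stL dL]]]]].
move=> [B1' pB' [J' [L' [phi' [simL' bphi' stL' dL']]]]].
exists (one_tens_sub B1 B1'); first exact: right_mod_tens_projective.
pose T := tensor_sub B1 B1'; rewrite prod_SimE.
exists (J * J')%type, (tensor_Sim T L L'), (fun x => (phi x.1, phi' x.2)); split.
- exact: tensor_is_Sim.
- have [psi phiK psiK] := bphi; have [psi' phiK' psiK'] := bphi'.
  by exists (fun x => (psi x.1, psi' x.2)) => -[x x'] /=; rewrite ?phiK ?phiK' ?psiK ?psiK'.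
- case=> j j' /=; have [F [mF bF _]] := ind_tens B1 B1' (L j) (L' j').
  apply: is_standard_miso (tensor_standard (tensor_self A A') simS simS' qh qh' (stL j) (stL' j')).
  by apply: miso_sym; exists F.
exact: (tensor_directed T simL simL' dL dL').
Qed.

(** * Exact Borel subalgebras in degree one *)

Section DegreeOne.

Variables (k : fieldType) (A : falgType k) (M N X P : fmod A) (eta : 'Hom(N, X)) (p : 'Hom(P, M)).
Hypotheses (pP : projective P) (mp : mlinear p) (sp : forall y, exists x, p x = y).

(** A class in Ext^1(M, N) is a module map on ker p, encoded by a linear map on all of [P] that is
    module-linear there. It is zero when it extends to a module map on [P], so injectivity on Ext^1
    turns an extension of [eta f] into one of [f]. *)
Lemma mono_extend (f : 'Hom(P, N)) (G : 'Hom(P, X)) : coef_mono_all 1 eta M ->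
  (forall a x, p x = 0 -> f (a ∙ x) = a ∙ f x) -> mlinear G ->
  (forall x, p x = 0 -> eta (f x) = G x) ->
  exists2 g : 'Hom(P, N), mlinear g & forall x, p x = 0 -> g x = f x.
Proof.
move=> mono mf mG eG; have [Q [d0 [d r]]] := resolution_from pP mp sp.
have pd x : p (d0 x) = 0 by have := res_ed r x.
have [||g mg gE] := mono _ _ _ r (f \o d0 : 'Hom(Q 0%N, N))%VF.
- apply/cocycleP; split=> [a x | x]; rewrite !comp_lfunE.
    by rewrite (res_mlinear r (n := 0%N)) mf.
  by have -> : d0 (cons_diff d0 d 1 x) = 0; [apply: (res_dd r (n := 0%N)) | rewrite linear0].
- by exists G => //; apply/lfunP=> x; rewrite !comp_lfunE eG.
exists g => // x /(res_exact0 r)[y <-].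
by rewrite -[g _]comp_lfunE -gE comp_lfunE.
Qed.

Lemma epi_extend (F : 'Hom(P, X)) : coef_epi_all 1 eta M ->
  (forall a x, p x = 0 -> F (a ∙ x) = a ∙ F x) ->
  exists (f : 'Hom(P, N)) (G : 'Hom(P, X)),
    [/\ forall a x, p x = 0 -> f (a ∙ x) = a ∙ f x, mlinear G
      & forall x, p x = 0 -> F x = eta (f x) + G x].
Proof.
move=> epi mF; have [Q [d0 [d r]]] := resolution_from pP mp sp.
have pd x : p (d0 x) = 0 by have := res_ed r x.
have [|f1 /cocycleP[mf1 f1d] [G mG GE]] := epi _ _ _ r (F \o d0 : 'Hom(Q 0%N, X))%VF.
  apply/cocycleP; split=> [a x | x]; rewrite !comp_lfunE.
    by rewrite (res_mlinear r (n := 0%N)) mF.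
  by have -> : d0 (cons_diff d0 d 1 x) = 0; [apply: (res_dd r (n := 0%N)) | rewrite linear0].
(* The cocycle [f1] kills the image of the next differential, so it descends to ker p, the image of
   [d0], and is extended linearly to [P]. *)
have [|f fE] := @lfun_factor _ _ _ _ d0 f1.
  by move=> x /(res_exact r (n := 0%N))[y <-]; apply: f1d.
exists f, G; split=> // [a x | x] /(res_exact0 r)[y <-].
  have md : mlinear d0 := res_mlinear r (n := 0%N).
  by rewrite [cons_diff _ _ _ _]/= -md -!fE mf1.
rewrite [cons_diff _ _ _ _]/= -fE.
have := congr1 (fun u : 'Hom(_, _) => u y) GE; rewrite add_lfunE opp_lfunE !comp_lfunE.
by move/eqP; rewrite subr_eq addrC => /eqP.
Qed.

End DegreeOne.

(** * The unit of induction and the case B = A *)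

Section FullSubalgebra.

Variables (k : fieldType) (A : falgType k) (B : {aspace A}) (B1 : 1 \in B).
Hypothesis Bfull : forall a, a \in B.

Lemma full_unit_bij (N : fmod (subvs_of B)) : bijective (ind_unit B1 N).
Proof.
have [|||F FE] := @ind_lift _ _ B N N (fun a x => vsproj B a ∙ x).
- by move=> a c x y; rewrite actDr actZr.
- by move=> x c a b; rewrite linearP actDl actZl.
- move=> a c x; rewrite -actM; congr (_ ∙ _); apply: val_inj => /=.
  by rewrite !vsprojK.
apply: lfun_bij => [x e | z].
  have := FE 1 x; rewrite -(ind_unitE B1) e linear0 => /esym.
  have -> : vsproj B 1 = 1; last by rewrite act1.
  by apply: val_inj; rewrite /= vsprojK // -[RHS]/(vsval (1 : subvs_of B)) subvs_val1.
suff: z \in limg (ind_unit B1 N) by move=> /memv_limgP[x ->]; exists x.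
move: z; apply: ind_span => a x; apply/memv_limgP; exists (vsproj B a ∙ x).
by rewrite ind_unitE -ind_pure_balanced mul1r vsprojK.
Qed.

Lemma full_submod (X : fmod A) (U : {vspace X}) :
  submod (U : {vspace res B1 X}) -> submod U.
Proof. by move=> sU a x Ux; have := sU (vsproj B a) x Ux; rewrite res_actE vsprojK. Qed.

Lemma full_mlinear (X Y : fmod A) (f : 'Hom(X, Y)) :
  mlinear (f : 'Hom(res B1 X, res B1 Y)) -> mlinear f.
Proof. by move=> mf a x; have := mf (vsproj B a) x; rewrite !res_actE vsprojK. Qed.

Lemma full_simple_res (X : fmod A) : simple X <-> simple (res B1 X).
Proof.
split=> -[X0 sX]; split=> // U sU; apply: sX; first exact: full_submod.
by move=> b x; apply: sU.
Qed.

Lemma full_projective (X : fmod A) : projective (res B1 X) -> projective X.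
Proof.
move=> pX M N g h mg sg mh.
have [l ml lE] := pX (res B1 M) (res B1 N) g h (mlinear_res mg) sg (mlinear_res mh).
by exists l => //; apply: full_mlinear.
Qed.

End FullSubalgebra.

Lemma ind_pureD (k : fieldType) (A : falgType k) (B : {aspace A}) (M : fmod (subvs_of B)) a (x y : M) :
  ind_pure a (x + y) = ind_pure a x + ind_pure a y.
Proof. by have := ind_pure_linear_r a 1 x y; rewrite !scale1r. Qed.

Lemma ind_pureB (k : fieldType) (A : falgType k) (B : {aspace A}) (M : fmod (subvs_of B)) a (x y : M) :
  ind_pure a (x - y) = ind_pure a x - ind_pure a y.
Proof. by apply/esym/eqP; rewrite subr_eq -ind_pureD subrK. Qed.

Section UnitSurjective.

Variables (k : fieldType) (A : falgType k) (B : {aspace A}) (B1 : 1 \in B).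
Variables (J : finType) (L : J -> fmod (subvs_of B)).
Hypothesis simL : is_Sim L.
Hypothesis unit_surj : forall j y, exists x, ind_unit B1 (L j) x = y.

(** Right exactness along a filtration of [M]: a maximal submodule whose induced elements lie in the
    image of the unit is all of [M], since a simple layer above it could be added. *)
Lemma unit_surj_all (M : fmod (subvs_of B)) y : exists x, ind_unit B1 M x = y.
Proof.
pose W : {vspace ind_mod M} := limg (ind_unit B1 M).
pose Pr (U : {vspace M}) := submod U /\ forall a x, x \in U -> ind_pure a x \in W.
have [|U [[sU UW] mU]] := @max_vspace _ _ Pr 0%VS.
  split; first exact: submod0.
  move=> a x; rewrite memv0 => /eqP->; rewrite (ind_pureE B1) linear0 act0r; exact: mem0v.
suff e : U = fullv.
  suff: y \in W by move=> /memv_limgP[x ->]; exists x.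
  by move: y; apply: ind_span => a x; apply: UW; rewrite e memvf.
apply: NNPP => nU; clear y.
have [V [D [sV /andP[UV _] nUV sD iD]]] := layer sU (@submodT _ _ M) (subvf _) nU.
have [_ _ cL] := simL; have [j jD] := cL _ sD.
have [g [mg gV gK]] := subquotient_miso iD jD.
have [t [tV tE]] := subquotient_section gV.
have inW a (x y : M) : ind_pure a (x - y) \in W -> quo_pi W (ind_pure a x) = quo_pi W (ind_pure a y).
  move=> h; apply: lfun_eq_sub; apply/eqP; rewrite quo_pi_eq0.
  by rewrite ind_pureB in h.
have inU x y : x \in V -> y \in V -> g x = g y -> x - y \in U.
  by move=> Vx Vy e; rewrite -gK memv_cap rpredB // memv_ker linearB /= e subrr.
have [|||F FE] := @ind_lift _ _ B (L j) (quo W) (fun a x => quo_pi W (ind_pure a (t x))).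
- by move=> a c x x'; rewrite linearP ind_pure_linear_r linearP.
- by move=> x c a b; rewrite ind_pure_linear_l linearP.
- move=> a c x; rewrite ind_pure_balanced; apply: inW; apply: UW; apply: inU => //.
    by apply: sV.
  by rewrite mg ?tV // !tE.
apply: nUV; apply/esym/mU => //; split=> // a x Vx.
have -> : x = (x - t (g x)) + t (g x) by rewrite subrK.
rewrite ind_pureD; apply: memvD; first by apply: UW; apply: inU => //; rewrite tE.
rewrite -quo_pi_eq0 -FE; have [x' <-] := unit_surj (ind_pure a (g x)).
by rewrite ind_unitE FE quo_pi_eq0 -(ind_unitE B1) memv_img ?memvf.
Qed.

(** For the regular module, A ⊗_B B is [A] and the unit is the inclusion of [B]. *)
Lemma unit_surj_full a : a \in B.
Proof.
pose R := regular_mod (subvs_of B).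
have [|||F FE] := @ind_lift _ _ B R A (fun a (x : R) => a * vsval (x : subvs_of B)).
- by move=> b c x y; rewrite linearP mulrDr scalerAr.
- by move=> x c b d; rewrite mulrDl scalerAl.
- by move=> b c x; rewrite -mulrA.
have [x e] := unit_surj_all (ind_pure (M := R) a (1 : subvs_of B)).
have := FE a (1 : subvs_of B); rewrite -e ind_unitE FE mul1r subvs_val1 // mulr1 => <-.
exact: subvsP.
Qed.

End UnitSurjective.

Section BorelFacts.

Variables (k : fieldType) (A : falgType k) (I : finType) (S : I -> fmod A) (le : rel I).
Variables (B : {aspace A}) (B1 : 1 \in B) (J : finType) (L : J -> fmod (subvs_of B)) (phi : J -> I).
Hypotheses (simS : is_Sim S) (qh : quasi_hereditary S le).
Hypotheses (simL : is_Sim L) (bphi : bijective phi).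
Hypothesis stL : forall j, is_standard S le (phi j) (ind_mod (L j)).
Hypothesis dL : directed L (fun j j' => le (phi j) (phi j')).
Hypothesis mono1 : forall a c, coef_mono_all 1 (ind_unit B1 (L c)) (L a).

Let sL j : simple (L j). Proof. by case: simL. Qed.

Lemma standard_scalar i D : is_standard S le i D -> scalar_end D /\ exists x : D, x != 0.
Proof.
move=> sD; have [_ _ _ h] := qh; have [P [p [U [sU [cp tU eU _]]]]] := h i.
have st : is_standard S le i (quo_mod sU) by exists P, p, U, sU; split=> //; apply: miso_refl.
have iD : miso (quo_mod sU) D by apply: standard_unique st sD.
split; first exact: scalar_end_miso iD (end_iso_field_scalar eU).
have [x x0] := end_iso_field_neq0 eU; have [f mf bf] := iD.
by exists (f x); rewrite -(inj_eq (bij_inj bf)) linear0 in x0 *.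
Qed.

(** The image of the unit generates the nonzero standard module, so the unit is nonzero, and its
    source is simple. *)
Lemma unit_inj j x : ind_unit B1 (L j) x = 0 -> x = 0.
Proof.
have [_ [z z0]] := standard_scalar (stL j).
have [y ny] : exists y, ind_unit B1 (L j) y != 0.
  apply: NNPP => h; move/eqP: z0; apply.
  rewrite -[z]id_lfunE -[RHS](zero_lfunE _ z); move: z.
  apply: ind_hom_ext; [exact: mlinear_id | exact: mlinear0 | move=> y].
  rewrite id_lfunE zero_lfunE; apply/eqP; apply: contraT => ny; case: h; by exists y.
exact: (simple_inj (sL j) (@ind_unit_mlinear _ _ _ B1 (L j)) ny).
Qed.

(* The mono condition in degree one makes the socle of ind L c map onto that of its cokernel. *)
Lemma unit_surj_of_hom :
  (forall a c, a != c -> forall F : 'Hom(L a, res B1 (ind_mod (L c))), mlinear F -> F = 0) ->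
  forall c y, exists x, ind_unit B1 (L c) x = y.
Proof.
move=> noH c; apply/(limg_fullP (ind_unit B1 (L c))); apply: NNPP => nV.
set eta := ind_unit B1 (L c) in nV *.
have meta : mlinear eta := @ind_unit_mlinear _ _ _ B1 (L c).
have [W [D [sW /andP[VW _] nVW sD iD]]] :=
  layer (submod_limg meta) (@submodT _ _ (res B1 (ind_mod (L c)))) (subvf _) nV.
have [_ _ cL] := simL; have [a aD] := cL _ sD.
have [qhL _] := dL; have [P [p cp]] := quasi_hereditary_cover qhL a.
have [pP mp _ _] := cp; have sp := cover_surj cp.
have [g [G [mG GW gG gK]]] := subquotient_lift sW (subquotient_miso iD aD) pP mp.
pose f := (eta^-1 \o G)%VF.
have fE x : p x = 0 -> eta (f x) = G x.
  move=> px; rewrite comp_lfunE limg_lfunVK // -gK memv_cap GW memv_ker gG px eqxx //.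
have mf b x : p x = 0 -> f (b ∙ x) = b ∙ f x.
  move=> px; apply/eqP; rewrite -subr_eq0; apply/eqP/(@unit_inj c).
  rewrite linearB /= -/eta meta !fE ?mG ?subrr // mp px act0r //.
have [h mh hE] := mono_extend pP mp sp (@mono1 a c) mf mG fE.
have [|H HE] := @lfun_factor _ _ _ _ p (G - (eta \o h)%VF).
  by move=> x px; rewrite add_lfunE opp_lfunE comp_lfunE hE // fE // subrr.
have mH : mlinear H.
  move=> b y; have [x <-] := sp y; rewrite -mp -!HE.
  by apply: mlinearB => //; apply: mlinear_comp.
have HV y : H y \in limg eta.
  (* For a = c, [H] extends to an endomorphism of a standard module, which is a scalar, so [H] is a
     multiple of the unit. *)
  have [ac | ac] := eqVneq a c; last by rewrite (noH _ _ ac H mH) zero_lfunE mem0v.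
  subst a; have [F mF FE] := ind_hom mH.
  have [sc _] := standard_scalar (stL c); have [l lE] := sc F mF.
  by rewrite -FE lE memvZ // memv_img ?memvf.
have [y y0] := simple_neq0 (sL a); have [x px] := sp y; move/eqP: y0; apply.
rewrite -px -gG; apply/eqP; rewrite -memv_ker.
suff: G x \in (W :&: lker g)%VS by rewrite memv_cap => /andP[].
rewrite gK; have := HV (p x); rewrite -HE add_lfunE opp_lfunE comp_lfunE => h1.
by rewrite -[G x](subrK (eta (h x))) memvD ?memv_img ?memvf.
Qed.

Lemma simple_ind_of_directed j : directed S le -> simple (ind_mod (L j)).
Proof. by case=> _; apply. Qed.

(** A map from L b to A ⊗_B L c extends to a map between standard modules, which are simple and, for
    b <> c, not isomorphic. *)
Lemma directed_full a : directed S le -> a \in B.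
Proof.
move=> dS; apply: (unit_surj_full simL); apply: unit_surj_of_hom => b c nbc F mF.
apply: NNPP => nF; have [F' mF' F'E] := ind_hom mF; have [x nx] := lfun_neq0 nF.
have [iS0 iS _] := simS; case/eqP: nbc; apply: (bij_inj bphi); apply: iS.
apply: miso_trans (simple_standard simS (stL b) (simple_ind_of_directed b dS)) _.
apply: miso_trans (miso_sym (simple_standard simS (stL c) (simple_ind_of_directed c dS))).
exists F' => //; rewrite -F'E in nx.
exact: schur (simple_ind_of_directed b dS) (simple_ind_of_directed c dS) mF' nx.
Qed.

Lemma full_directed : (forall a, a \in B) -> directed S le.
Proof.
move=> Bf; split=> // i D sD; have [psi phiK psiK] := bphi.
rewrite -(psiK i) in sD; apply: simple_miso (standard_unique (stL _) sD) _.
apply/(full_simple_res B1 Bf); apply: simple_miso (sL (psi i)).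
by exists (ind_unit B1 (L (psi i))); [apply: ind_unit_mlinear | apply: full_unit_bij].
Qed.

(* The class f in Ext^1(L b, L d) comes from a simple quotient of the kernel of the cover of L b;
   it is nonzero since there is no map from the cover of L b to L d. *)
Lemma nonprojective_ext b : ~ projective (L b) ->
  exists d (P : fmod (subvs_of B)) (p : 'Hom(P, L b)) (f : 'Hom(P, L d)),
  [/\ d != b, projective_cover p, forall a x, p x = 0 -> f (a ∙ x) = a ∙ f x
    & forall G : 'Hom(P, res B1 (ind_mod (L d))), mlinear G ->
        ~ (forall x, p x = 0 -> ind_unit B1 (L d) (f x) = G x)].
Proof.
move=> npb; have [qhL _] := dL; have [P [p cp]] := quasi_hereditary_cover qhL b.
have [pP mp _ _] := cp; have sp := cover_surj cp; have sK := submod_ker mp.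
have [e | nK] := classic (0%VS = lker p).
  case: npb; apply: proj_miso pP; exists p => //; apply: lfun_bij => // x px.
  by apply/eqP; rewrite -memv0 e memv_ker px.
have [U [D [sU /andP[_ UK] nUK sD iD]]] := colayer (@submod0 _ _ P) sK (sub0v _) nK.
have [_ _ cL] := simL; have [d dD] := cL _ sD.
have iDd := subquotient_miso iD dD; have [f [mf fV fK]] := iDd.
have [y y0] := simple_neq0 (sL d).
have ndb : d != b.
  have [Q [q cq]] := quasi_hereditary_cover qhL d; have [pQ mq _ _] := cq.
  have [g [h [mh hV gh _]]] := subquotient_lift sK iDd pQ mq.
  have [x qx] := cover_surj cq y.
  have nh : h x != 0 by apply: contraNneq y0 => e; rewrite -qx -gh e linear0.
  have [|//] := directed_radical simL dL cp cq mh (hom_neq0 nh).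
  by move=> z; apply/eqP; rewrite -memv_ker.
exists d, P, p, f; split=> // [a x px|G mG GE].
  by apply: mf; rewrite memv_ker px.
have mf' a x : p x = 0 -> f (a ∙ x) = a ∙ f x by move=> px; apply: mf; rewrite memv_ker px.
have [g mg gE] := mono_extend pP mp sp (@mono1 b d) mf' mG GE.
have g0 : g = 0.
  apply: NNPP => ng; move/eqP: ndb; apply; apply/esym; exact: (cover_hom_Sim simL cp mg ng).
have: y \in (f @: lker p)%VS by rewrite fV memvf.
case/memv_imgP=> x; rewrite memv_ker => /eqP px e.
by move: y0; rewrite e -gE // g0 zero_lfunE eqxx.
Qed.

End BorelFacts.

(** * The opposite algebra *)

Section Idempotents.

Variables (k : fieldType) (C : falgType k).

(** For a nonzero idempotent [e] this says that e C e is one-dimensional, that is End(C e) = k. The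
    condition reads the same in the opposite algebra. *)
Definition corner_scalar (e : C) : Prop := forall c, exists l : k, e * c * e = l *: e.

Lemma regular_projective : projective (regular_mod C).
Proof.
move=> M N g h mg /limg_fullP sg mh; have [y yE] := sg (h (1 : C)).
have l' : linear (fun a : regular_mod C => (a : C) ∙ y) by move=> c a b; rewrite actDl actZl.
exists (linfun (fun a : regular_mod C => (a : C) ∙ y)).
  by move=> a b; rewrite !(linfunE l') -actM.
apply/lfunP=> a; rewrite comp_lfunE (linfunE l') mg yE -mh; congr (h _).
exact: esym (mulr1 (a : C)).
Qed.

Section LeftIdeal.

Variable e : C.

(** The left ideal C e, for [e] idempotent. *)
Definition left_ideal_vs : {vspace regular_mod C} :=
  lker (linfun (fun x : regular_mod C => (x : C) * e - x : C)).

Lemma left_ideal_linear : linear (fun x : regular_mod C => (x : C) * e - x : C).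
Proof.
by move=> c x y; rewrite mulrDl -scalerAl scalerBr opprD addrACA.
Qed.

Lemma mem_left_ideal (x : C) : (x \in left_ideal_vs) = (x * e == x).
Proof. by rewrite memv_ker (linfunE left_ideal_linear) subr_eq0. Qed.

Lemma left_ideal_submod : submod left_ideal_vs.
Proof.
move=> a x; rewrite !mem_left_ideal => /eqP h.
by rewrite [a ∙ x]/(a * (x : C)) -mulrA h.
Qed.

Definition left_ideal : fmod C := subm left_ideal_submod.

Definition left_ideal_val : 'Hom(left_ideal, regular_mod C) := subm_val left_ideal_submod.

Lemma left_ideal_valM a x : left_ideal_val (a ∙ x) = a * (left_ideal_val x : C).
Proof. exact: mlinear_subm_val. Qed.

Lemma left_ideal_valE x : (left_ideal_val x : C) * e = left_ideal_val x.
Proof. by apply/eqP; rewrite -mem_left_ideal; apply: subm_valP. Qed.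

Hypothesis ee : e * e = e.

Lemma left_ideal_gen : exists g : left_ideal, left_ideal_val g = e :> C.
Proof. by apply: subm_ex; rewrite mem_left_ideal ee. Qed.

Lemma left_ideal_projective : projective left_ideal.
Proof.
have l : linear (fun x : regular_mod C => (x : C) * e : regular_mod C).
  by move=> c x y; rewrite mulrDl -scalerAl.
pose r : 'Hom(regular_mod C, regular_mod C) := linfun (fun x : regular_mod C => (x : C) * e).
have mr : mlinear r.
  by move=> a x; rewrite !(linfunE l) [a ∙ x]/(a * (x : C)) -mulrA.
have [|t mt tE] := subm_lift left_ideal_submod mr.
  by move=> x; rewrite (linfunE l) mem_left_ideal -mulrA ee.
apply: (proj_retract (i := left_ideal_val) (r := t)) regular_projective => //.
  exact: mlinear_subm_val.
move=> x; apply: (@subm_val_inj _ _ _ _ left_ideal_submod).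
by rewrite tE (linfunE l) left_ideal_valE.
Qed.

Lemma left_ideal_eq (x : left_ideal) g : left_ideal_val g = e :> C -> x = (left_ideal_val x : C) ∙ g.
Proof.
move=> gE; apply: (@subm_val_inj _ _ _ _ left_ideal_submod).
by rewrite -/left_ideal_val left_ideal_valM gE left_ideal_valE.
Qed.

End LeftIdeal.

Arguments left_ideal_val {e}.

(** Hom(C e, C e') is e C e': the map is right multiplication by [e * c * e']. *)
Lemma left_ideal_hom_ex (e e' c : C) : e * e = e -> e' * e' = e' -> e * c * e' != 0 ->
  exists2 f : 'Hom(left_ideal e, left_ideal e'), mlinear f & f <> 0.
Proof.
move=> ee ee' n; have [g gE] := left_ideal_gen ee.
have l : linear (fun x : left_ideal e => (left_ideal_val x : C) * (e * c * e') : regular_mod C).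
  by move=> a x y; rewrite linearP mulrDl -scalerAl.
have [||f mf fE] := @subm_lift _ _ _ _ (left_ideal_submod (e := e')) _
  (linfun (fun x : left_ideal e => (left_ideal_val x : C) * (e * c * e') : regular_mod C)).
- by move=> a x; rewrite !(linfunE l) left_ideal_valM -mulrA.
- by move=> x; rewrite (linfunE l) mem_left_ideal -!mulrA ee'.
exists f => //; apply: (hom_neq0 (x := g)); apply: contra n => /eqP fg.
by have := fE g; rewrite fg linear0 (linfunE l) gE !mulrA ee => <-.
Qed.

Lemma left_ideal_hom_neq0 (e e' : C) (f : 'Hom(left_ideal e, left_ideal e')) :
  e * e = e -> mlinear f -> f <> 0 -> exists c, e * c * e' != 0.
Proof.
move=> ee mf /lfun_neq0[x nx]; have [g gE] := left_ideal_gen ee.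
exists (left_ideal_val (f g)); apply: contra nx => /eqP e0.
have fg : f g = e ∙ f g by rewrite -mf; congr (f _); rewrite {1}(left_ideal_eq g gE) gE.
rewrite (left_ideal_eq x gE) mf fg; apply/eqP.
have -> : e ∙ f g = 0; last by rewrite act0r.
apply: (@subm_val_inj _ _ _ _ (left_ideal_submod (e := e'))).
by rewrite -/(left_ideal_val) left_ideal_valM linear0 -left_ideal_valE mulrA e0.
Qed.

Lemma left_ideal_scalar_end (e : C) : e * e = e -> corner_scalar e -> scalar_end (left_ideal e).
Proof.
move=> ee ce f mf; have [g gE] := left_ideal_gen ee.
have [l lE] := ce (left_ideal_val (f g)); exists l => x.
have fg : f g = e ∙ f g by rewrite -mf; congr (f _); rewrite {1}(left_ideal_eq g gE) gE.
have fgl : f g = l *: g.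
  apply: (@subm_val_inj _ _ _ _ (left_ideal_submod (e := e))).
  by rewrite fg -/(left_ideal_val) left_ideal_valM linearZ /= gE -lE -mulrA left_ideal_valE.
by rewrite {1}(left_ideal_eq x gE) mf fgl actZr -(left_ideal_eq x gE).
Qed.

(** If [U] still maps onto [S], some [u] in [U] maps to [e ∙ s]. By the corner condition [e ∙ u] is
    a multiple of the generator of C e, nonzero because [e ∙ s] is. *)
Lemma idempotent_cover (S : fmod C) (e : C) (s : S) : simple S -> e * e = e -> corner_scalar e ->
  e ∙ s != 0 -> exists p : 'Hom(left_ideal e, S), projective_cover p.
Proof.
move=> sS ee ce es; have [g gE] := left_ideal_gen ee.
pose s1 := e ∙ s; have es1 : e ∙ s1 = s1 by rewrite -actM ee.
have l : linear (fun x : left_ideal e => (left_ideal_val x : C) ∙ s1).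
  by move=> c x y; rewrite linearP actDl actZl.
pose p : 'Hom(left_ideal e, S) := linfun (fun x : left_ideal e => (left_ideal_val x : C) ∙ s1).
have pE x : p x = (left_ideal_val x : C) ∙ s1 by rewrite linfunE.
have mp : mlinear p by move=> a x; rewrite !pE left_ideal_valM actM.
have pg : p g = s1 by rewrite pE gE es1.
exists p; split=> //; first exact: left_ideal_projective.
  apply/limg_fullP; apply: (simple_surj (x := g)) => //; by rewrite pg.
move=> U sU eU; have: s1 \in (p @: U)%VS by rewrite eU memvf.
case/memv_imgP=> u Uu pu; have [c cE] := ce (left_ideal_val u).
have eu : e ∙ u = c *: g.
  apply: (@subm_val_inj _ _ _ _ (left_ideal_submod (e := e))).
  by rewrite -/(left_ideal_val) left_ideal_valM linearZ /= gE -cE -mulrA left_ideal_valE.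
have c0 : c != 0.
  apply: contra es => /eqP c0; have := congr1 p eu.
  by rewrite mp -pu es1 c0 scale0r linear0 => h; apply/eqP.
have Ug : g \in U by rewrite -[g]scale1r -(mulVf c0) -scalerA -eu memvZ ?sU.
apply/vspaceP=> x; rewrite memvf (left_ideal_eq x gE); exact: sU.
Qed.

(** Acting on [x0] gives [beta] from the regular module to [P], and lifting [p] through it gives
    [al]. Their composite on [P] is a scalar, equal to one modulo the radical, hence one; so [P] is
    C e with [e = al x0]. *)
Lemma cover_idempotent (P S : fmod C) (p : 'Hom(P, S)) : simple S -> projective_cover p ->
  scalar_end P -> exists e : C, [/\ e * e = e, corner_scalar e & exists s : S, e ∙ s != 0].
Proof.
move=> sS cp sP; have [pP mp _ _] := cp; have [s s0] := simple_neq0 sS.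
have [x0 px0] := cover_surj cp s.
have l : linear (fun a : regular_mod C => (a : C) ∙ x0) by move=> c a b; rewrite actDl actZl.
pose beta : 'Hom(regular_mod C, P) := linfun (fun a : regular_mod C => (a : C) ∙ x0).
have bE (a : C) : beta a = a ∙ x0 by rewrite linfunE.
have mb : mlinear beta by move=> a b; rewrite !bE -actM.
have mpb := mlinear_comp mp mb.
have pb1 : (p \o beta)%VF (1 : C) != 0 by rewrite comp_lfunE bE act1 px0.
have [al mal alE] := proj_lift_surj pP mpb mp (simple_surj sS mpb pb1).
have [m mE] := sP _ (mlinear_comp mb mal).
have ba x : beta (al x) = x.
  have := alE x0; rewrite !comp_lfunE -[beta _]comp_lfunE mE linearZ /= => /eqP.
  rewrite -subr_eq0 -{2}[p x0]scale1r -scalerBl scaler_eq0 px0 (negPf s0) orbF subr_eq0.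
  by move/eqP=> m1; rewrite -comp_lfunE mE m1 scale1r.
pose e : C := al x0.
have alb (a : C) : al (beta a) = a * e :> C by rewrite bE mal.
have be : beta e = x0 by rewrite /e ba.
exists e; split.
- by rewrite -alb be.
- move=> c; pose r : 'Hom(regular_mod C, regular_mod C) :=
    linfun (fun x : regular_mod C => (x : C) * (c * e) : regular_mod C).
  have rl : linear (fun x : regular_mod C => (x : C) * (c * e) : regular_mod C).
    by move=> a x y; rewrite mulrDl -scalerAl.
  have rE (x : C) : r x = x * (c * e) :> C by rewrite (linfunE rl).
  have mr : mlinear r by move=> a x; rewrite !rE [a ∙ x]/(a * (x : C)) -mulrA.
  have [d dE] := sP _ (mlinear_comp mb (mlinear_comp mr mal)); exists d.
  have := congr1 al (dE x0); rewrite !comp_lfunE linearZ /= -/e.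
  by rewrite rE alb => <-; rewrite -!mulrA -[in RHS]alb be.
exists s; rewrite -px0 -mp; suff -> : e ∙ x0 = x0 by rewrite px0.
by rewrite -bE be.
Qed.

End Idempotents.

(** * Duality and the simple modules of the opposite algebra *)

Section Duality.

Variable k : fieldType.

(** A basis of [U] embeds [V] in a coordinate space; every functional factors through this
    embedding, hence is a combination of the basis. *)
Lemma separating_full (V : vectType k) (U : {vspace 'Hom(V, k^o)}) :
  (forall x, (forall f, f \in U -> f x = 0) -> x = 0) -> U = fullv.
Proof.
move=> sep; apply/vspaceP=> psi; rewrite memvf.
pose n := \dim U; pose b i : 'Hom(V, k^o) := (vbasis U)`_i.
have bU (i : 'I_n) : b i \in U by apply: vbasis_mem; rewrite mem_nth // size_tuple.
pose Phi : 'Hom(V, 'rV[k]_n) := linfun (fun x => \row_(i < n) (b i x : k)).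
have Pl : linear (fun x : V => \row_(i < n) (b i x : k)).
  by move=> c x y; apply/rowP=> i; rewrite !mxE linearP.
have PE x i : Phi x 0 i = b i x by rewrite (linfunE Pl) mxE.
have [|h hE] := @lfun_factor _ _ _ _ Phi psi.
  move=> x Px; rewrite (sep x) ?linear0 // => f /coord_vbasis->.
  rewrite sum_lfunE big1 // => i _; rewrite scale_lfunE.
  by have := PE x i; rewrite Px mxE => e; rewrite -[_ x]/(b i x) -e scaler0.
have -> : psi = \sum_(i < n) (h (delta_mx 0 i) : k) *: b i.
  apply/lfunP=> x; rewrite hE {1}[Phi x]row_sum_delta linear_sum sum_lfunE.
  apply: eq_bigr => i _; rewrite linearZ /= scale_lfunE PE.
  by rewrite /GRing.scale /= mulrC.
by apply: memv_suml => i _; rewrite memvZ.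
Qed.

Lemma dual_simple (A : falgType k) (M : fmod A) : simple M -> simple (dual_mod M).
Proof.
move=> sM; have [x x0] := simple_neq0 sM; have [xi xiE] := functional_neq0 x0.
split.
  apply/eqP=> e; have: xi \in (fullv : {vspace dual_mod M}) by rewrite memvf.
  rewrite e memv0 => /eqP z; move: xiE; rewrite z zero_lfunE => /eqP.
  by rewrite eq_sym oner_eq0.
move=> U sU; have [-> | U0] := eqVneq U 0%VS; [by left | right].
apply: separating_full => y h; apply/eqP; apply: contraT => y0.
have [f Uf f0] := neq0_exists U0; case/eqP: f0; apply/lfunP=> z; rewrite zero_lfunE.
have l : linear (fun a : regular_mod A => (a : A) ∙ y) by move=> c a b; rewrite actDl actZl.
pose b : 'Hom(regular_mod A, M) := linfun (fun a : regular_mod A => (a : A) ∙ y).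
have bE (a : A) : b a = a ∙ y by rewrite (linfunE l).
have mb : mlinear b by move=> a c; rewrite !bE -actM.
have b1 : b (1 : A) != 0 by rewrite bE act1.
have [a <-] := simple_surj sM mb b1 z; rewrite bE.
by have := h _ (sU (a : A) f Uf); rewrite dual_actE.
Qed.

Variable A : falgType k.

(** The dual of an [A^c]-module is a module over the converse of [A^c]; its action is reread as one
    of [A]. *)
Definition predual (N : fmod A^c) : fmod A :=
  @Fmod k A 'Hom(N, k^o) (fun (a : A) => @dual_act k A^c N a)
    (@dual_act_linear k A^c N) (@dual_act_linear_l k A^c N)
    (@dual_act1 k A^c N) (@dual_actM k A^c N).

Lemma predual_actE (N : fmod A^c) (a : A) (f : predual N) (x : N) :
  (a ∙ f : 'Hom(N, k^o)) x = (f : 'Hom(N, k^o)) ((a : A^c) ∙ x).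
Proof. exact: dual_actE. Qed.

Lemma predual_simple (N : fmod A^c) : simple N -> simple (predual N).
Proof.
move=> sN; have [n0 sN'] := dual_simple sN; by split=> // U sU; apply: sN' => a x Ux; apply: (sU a x Ux).
Qed.

(** [g] and the map [h] in the other direction are one balanced pairing of [M] and [N], read from
    either side. *)
Lemma dual_hom_of_predual (M : fmod A) (N : fmod A^c) (g : 'Hom(M, predual N)) :
  simple M -> simple N -> mlinear g -> g <> 0 -> miso N (dual_mod M).
Proof.
move=> sM sN mg /lfun_neq0[s ns].
have l x : linear (fun s : M => (g s : 'Hom(N, k^o)) x).
  by move=> c u v; rewrite linearP add_lfunE scale_lfunE.
have l' : linear (fun x : N => linfun (fun s : M => (g s : 'Hom(N, k^o)) x) : 'Hom(M, k^o)).
  by move=> c x y; apply/lfunP=> u; rewrite add_lfunE scale_lfunE !(linfunE (l _)) linearP.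
pose h : 'Hom(N, dual_mod M) :=
  linfun (fun x : N => linfun (fun s : M => (g s : 'Hom(N, k^o)) x) : 'Hom(M, k^o)).
have hE x u : (h x : 'Hom(M, k^o)) u = (g u : 'Hom(N, k^o)) x.
  by rewrite (linfunE l') (linfunE (l _)).
have mh : mlinear h.
  move=> a x; apply/lfunP=> u; rewrite dual_actE !hE mg.
  exact: esym (predual_actE (a : A) (g u) x).
have [x nx] := lfun_neq0 (f := g s : 'Hom(N, k^o)) (fun e => negP ns (introT eqP e)).
exists h => //; apply: (schur (x := x)) => //; first exact: dual_simple.
apply: contra nx => /eqP e; by rewrite -hE e zero_lfunE.
Qed.

Lemma dual_is_Sim (I : finType) (S : I -> fmod A) : is_Sim S -> is_Sim (dual_Sim S).
Proof.
move=> [sS iS cS].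
have sD i : simple (dual_Sim S i) by apply: dual_simple.
split=> // [i j [h mh bh] | N sN].
  have tr j' (u : 'Hom(dual_mod (S i), dual_mod (S j'))) : mlinear u -> bijective u ->
      miso (S j') (predual (dual_mod (S i))).
    move=> mu bu.
    have l s : linear (fun f : dual_mod (S i) => (u f : 'Hom(S j', k^o)) s).
      by move=> c x y; rewrite linearP add_lfunE scale_lfunE.
    have l' : linear (fun s : S j' => linfun (fun f : dual_mod (S i) => (u f : 'Hom(S j', k^o)) s) : 'Hom(dual_mod (S i), k^o)).
      by move=> c x y; apply/lfunP=> f; rewrite add_lfunE scale_lfunE !(linfunE (l _)) linearP.
    pose g : 'Hom(S j', predual (dual_mod (S i))) :=
      linfun (fun s : S j' => linfun (fun f : dual_mod (S i) => (u f : 'Hom(S j', k^o)) s) : 'Hom(dual_mod (S i), k^o)).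
    have gE s f : (g s : 'Hom(dual_mod (S i), k^o)) f = (u f : 'Hom(S j', k^o)) s.
      by rewrite (linfunE l') (linfunE (l _)).
    have mg : mlinear g.
      move=> a s; apply/lfunP=> f; rewrite predual_actE !gE mu.
      exact: esym (dual_actE (a : A^c) _ s).
    have [s s0] := simple_neq0 (sS j'); have [xi xiE] := functional_neq0 s0.
    have [u' _ uK] := bu.
    exists g => //; apply: (schur (x := s)) => //; first by apply: predual_simple; apply: sD.
    apply/eqP => e; have := gE s (u' xi); rewrite e zero_lfunE uK xiE => /eqP.
    by rewrite eq_sym oner_eq0.
  apply: iS; apply: miso_trans (miso_sym (tr j h mh bh)).
  apply: (tr i \1%VF); [exact: mlinear_id | by exists id => x; rewrite id_lfunE].
have [i [g mg bg]] := cS _ (predual_simple sN).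
have [g' [mg' gK g'K]] := bij_mlinear_inv mg bg.
exists i; apply: (dual_hom_of_predual (g := g')) => //.
have [s s0] := simple_neq0 (sS i); apply: (hom_neq0 (x := s)).
by apply: contra s0 => /eqP e; rewrite -[s]g'K e linear0.
Qed.

End Duality.

Section OppositeDirected.

Variables (k : closedFieldType) (A : falgType k) (I : finType) (S : I -> fmod A) (le : rel I).
Hypotheses (simS : is_Sim S) (qh : quasi_hereditary S le).

Implicit Types (P Q D X Y : fmod A).

Let sS i : simple (S i). Proof. by case: simS. Qed.

(** A projective Delta(i) splits off P(i). As P(i) has a unique maximal submodule, the image of the
    splitting is everything and the trace vanishes. *)
Lemma standard_projective_trace i D P (p : 'Hom(P, S i)) (U : {vspace P}) :
  is_standard S le i D -> projective D -> projective_cover p -> is_trace S le i U -> U = 0%VS.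
Proof.
move=> sD pD cp tU; have [_ [x x0]] := standard_scalar qh sD.
case: sD x x0 pD => P1 [p1 [U1 [sU1 [cp1 tU1 iD]]]] x x0 pD.
have [h [mh bh _]] := cover_iso cp cp1.
have U10 : U1 = 0%VS.
  have pQ := proj_miso iD pD; have [f mf bf] := iD.
  have mpi := mlinear_quo_pi sU1.
  have [s ms sE] := proj_lift_surj pQ mpi (@mlinear_id _ _ _) (@quo_pi_surj _ _ _ _ sU1).
  have e : limg s = fullv.
    have [//|ne] := classic (limg s = fullv).
    have l1 := cover_proper cp1 (sS i) (submod_limg ms) ne.
    have [U1T|nU1] := classic (U1 = fullv).
      case/eqP: x0; apply: (bij_inj bf); rewrite linear0.
      have [y <-] := quo_pi_surj (f x); apply/eqP.
      by rewrite quo_pi_eq0 U1T memvf.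
    have l2 := cover_proper cp1 (sS i) sU1 nU1.
    case: (cover_ker_proper cp1 (sS i)); apply/vspaceP=> y; rewrite memvf.
    rewrite -[y](subrK (s (quo_pi U1 y))) memvD //; last by rewrite (subvP l1) // memv_img ?memvf.
    rewrite (subvP l2) // -quo_pi_eq0 linearB /=.
    by have := sE (quo_pi U1 y); rewrite id_lfunE => ->; rewrite subrr.
  apply/eqP; rewrite -subv0; apply/subvP=> y Uy; rewrite memv0.
  have /memv_limgP[z ez] : y \in limg s by rewrite e memvf.
  move: Uy; rewrite ez -quo_pi_eq0; have := sE z; rewrite id_lfunE => -> /eqP->.
  by rewrite linear0.
apply/eqP; rewrite -subv0; apply: (proj2 tU) => j Q q f nle cq mf.
have := proj1 tU1 j Q q (h \o f)%VF nle cq (mlinear_comp mh mf); rewrite U10 => hf.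
apply/subvP=> _ /memv_limgP[y ->]; rewrite memv0 -(inj_eq (bij_inj bh)) linear0.
by rewrite -memv0 (subvP hf) // -comp_lfunE memv_img ?memvf.
Qed.

(** Projective standard modules are the covers themselves, so a nonzero [e j * c * e i] forces j <=
    i. In [A^c] the same element is a map between covers in the other direction, and one-dimensional
    corners exclude radical endomorphisms. *)
Lemma opposite_directed :
  (forall i D, is_standard S le i D -> projective D) -> directed (dual_Sim S) le.
Proof.
move=> pr; have [r a t qh4] := qh.
have cov i : exists (P : fmod A) (p : 'Hom(P, S i)), [/\ projective_cover p, scalar_end P
    & forall j Q (q : 'Hom(Q, S j)) (f : 'Hom(Q, P)), projective_cover q -> mlinear f -> f <> 0 -> le j i].
  have [P [p [U [sU [cp tU eU _]]]]] := qh4 i.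
  have st : is_standard S le i (quo_mod sU) by exists P, p, U, sU; split=> //; apply: miso_refl.
  have U0 := standard_projective_trace st (pr _ _ st) cp tU.
  exists P, p; split=> //.
    apply: scalar_end_miso (end_iso_field_scalar eU); apply: miso_sym.
    exists (quo_pi U : 'Hom(P, quo_mod sU)); first exact: mlinear_quo_pi.
    apply: lfun_bij; last exact: quo_pi_surj.
    by move=> x /eqP; rewrite quo_pi_eq0 U0 memv0 => /eqP.
  move=> j Q q f cq mf nf; apply: contraT => nle; case: nf; apply/lfunP=> x.
  have := proj1 tU j Q q f nle cq mf; rewrite U0 => h.
  by apply/eqP; rewrite zero_lfunE -memv0 (subvP h) // memv_img ?memvf.
have idem i : exists e : A, [/\ e * e = e, corner_scalar e & exists s : S i, e ∙ s != 0].
  by have [P [p [cp sP _]]] := cov i; apply: cover_idempotent cp sP.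
have {idem} [e eP] := fin_all_exists idem.
have leE i j c : e j * c * e i != 0 -> le j i.
  have [ei ci [s si]] := eP i; have [ej cj [s' sj]] := eP j => n.
  have [f mf nf] := left_ideal_hom_ex ej ei n.
  have [P [p [cp _ h]]] := cov i.
  have [p' cp'] := idempotent_cover (sS i) ei ci si.
  have [q cq] := idempotent_cover (sS j) ej cj sj.
  have [u [mu bu _]] := cover_iso cp' cp.
  apply: (h j (left_ideal (e j)) q (u \o f)%VF cq (mlinear_comp mu mf)).
  have [x nx] := lfun_neq0 nf; apply: (hom_neq0 (x := x)).
  by rewrite comp_lfunE -(inj_eq (bij_inj bu)) linear0 in nx *.
have simD := dual_is_Sim simS; have sD i : simple (dual_Sim S i) by case: simD.
have eo i : (e i : A^c) * e i = e i by have [ee _ _] := eP i.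
have co i : corner_scalar (e i : A^c).
  have [_ h _] := eP i => c; have [l lE] := h c; exists l.
  exact: etrans (mulrA (e i : A) (c : A) (e i)) lE.
have covD i : exists q : 'Hom(left_ideal (e i : A^c), dual_Sim S i), projective_cover q.
  have [ei ci [s si]] := eP i; have [xi xiE] := functional_neq0 si.
  apply: (idempotent_cover (s := xi : dual_Sim S i)) => //.
  have h : ((e i : A^c) ∙ (xi : dual_Sim S i) : 'Hom(S i, k^o)) s = xi (e i ∙ s).
    exact: dual_actE.
  by apply/eqP => z; move: h; rewrite z zero_lfunE xiE => /esym/eqP; rewrite oner_eq0.
apply: directed_criterion => //.
- by move=> i; have [q cq] := covD i; exists (left_ideal (e i : A^c)), q.
- by move=> i; apply: schur_scalar.
move=> i j X Y p q f cX cY mf nf pf.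
have [p1 cp1] := covD i; have [q1 cq1] := covD j.
have [u [mu bu _]] := cover_iso cX cp1; have [v [mv bv _]] := cover_iso cq1 cY.
have [v' _ vK] := bv.
have nf1 : (u \o f \o v)%VF <> 0.
  have [y ny] := lfun_neq0 nf; apply: (hom_neq0 (x := v' y)).
  by rewrite !comp_lfunE vK -(inj_eq (bij_inj bu)) linear0 in ny *.
have [c cE] := left_ideal_hom_neq0 (eo j) (mlinear_comp (mlinear_comp mu mf) mv) nf1.
split; first by apply: (leE j i c); rewrite -mulrA.
apply/eqP => ij; subst j.
have [ei ci _] := eP i.
have sX : scalar_end X.
  apply: (scalar_end_miso (M := left_ideal (e i : A^c))).
    by apply: miso_sym; exists u.
  exact: left_ideal_scalar_end.
have [w [mw bw wE]] := cover_iso cX cY.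
have [l lE] := sX _ (mlinear_comp mf mw).
have [s s0] := simple_neq0 (sD i); have [x xE] := cover_surj cX s.
have := pf (w x); rewrite -[f (w x)]comp_lfunE lE linearZ /= xE => /eqP.
rewrite scaler_eq0 (negPf s0) orbF => /eqP l0; apply: nf; apply/lfunP=> y.
have [w' _ w'K] := bw; rewrite -[y]w'K -comp_lfunE lE l0 scale0r zero_lfunE //.
Qed.

(** The idempotents now come from [A^c]. Directedness there leaves no nonzero [e j * c * e i] in [A]
    unless j <= i, so the trace in P(i) is zero and Delta(i) is P(i). *)
Lemma standard_projective_of_opposite i D :
  directed (dual_Sim S) le -> is_standard S le i D -> projective D.
Proof.
move=> dD; have simD := dual_is_Sim simS; have sD j : simple (dual_Sim S j) by case: simD.
have [qhD _] := dD; have [r a t _] := qhD.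
have rad := directed_radical simD dD.
have idem j : exists e : A^c, [/\ e * e = e, corner_scalar e & exists s : dual_Sim S j, e ∙ s != 0].
  have [Q [q cq]] := quasi_hereditary_cover qhD j.
  exact: cover_idempotent cq (radical_scalar_end simD rad cq).
have {idem} [e eP] := fin_all_exists idem.
have ea j : (e j : A) * (e j : A) = e j by have [] := eP j.
have ca j : corner_scalar (e j : A).
  have [_ h _] := eP j => c; have [l lE] := h c; exists l.
  exact: etrans (esym (mulrA (e j : A) (c : A) (e j : A))) lE.
have cov j : exists p : 'Hom(left_ideal (e j : A), S j), projective_cover p.
  have [_ _ [xi nxi]] := eP j; have [s ns] := lfun_neq0 (f := e j ∙ xi : 'Hom(S j, k^o)) (fun z => negP nxi (introT eqP z)).
  apply: (idempotent_cover (s := s)) => //.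
  by apply: contra ns => /eqP z; rewrite [_ s]dual_actE z linear0.
have leE j j' c : (e j : A) * c * (e j' : A) != 0 -> le j j'.
  have [ej cj [s sj]] := eP j; have [ej' cj' [s' sj']] := eP j'.
  move=> n; have [|||f mf nf] := @left_ideal_hom_ex _ A^c (e j') (e j) c => //.
    by rewrite /= -[X in X != 0]/((e j : A) * (c * (e j' : A))) mulrA.
  have [p' cp'] := idempotent_cover (sD j) ej cj sj.
  have [q cq] := idempotent_cover (sD j') ej' cj' sj'.
  exact: (radical_homs_le simD r rad cp' cq mf nf).
case=> P [p [U [sU [cp tU iD]]]].
apply: (proj_miso (miso_sym iD)).
have [p1 cp1] := cov i; have [h [mh bh _]] := cover_iso cp cp1.
have U0 : U = 0%VS.
  apply/eqP; rewrite -subv0; apply: (proj2 tU) => j Q q f nle cq mf.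
  apply/subvP=> _ /memv_limgP[y ->]; rewrite memv0; apply: contraT => nfy.
  have [q1 cq1] := cov j; have [v [mv bv _]] := cover_iso cq1 cq.
  have [v' _ vK] := bv.
  have [||c cE] := @left_ideal_hom_neq0 _ A (e j) (e i) (h \o f \o v)%VF (ea j).
  - by do 2?apply: mlinear_comp.
  - by apply: (hom_neq0 (x := v' y)); rewrite !comp_lfunE vK -(inj_eq (bij_inj bh)) linear0 in nfy *.
  by rewrite (leE _ _ _ cE) in nle.
have [pP _ _ _] := cp; apply: proj_miso pP.
exists (quo_pi U : 'Hom(P, quo_mod sU)); first exact: mlinear_quo_pi.
apply: lfun_bij; last exact: quo_pi_surj.
by move=> x /eqP; rewrite quo_pi_eq0 U0 memv0 => /eqP.
Qed.

End OppositeDirected.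

(* theta : D -> B is an algebra anti-isomorphism in the intended use, so that R is a right
   B-module; rho is an embedding of R ⊗_B X in R ⊗ X, natural in X, as a section of the projection. *)
Lemma projective_balanced (k : fieldType) (D B : falgType k) (theta : D -> B) (R : fmod D) :
  linear theta -> (forall c d, theta (c * d) = theta d * theta c) -> projective R ->
  exists rho : forall X : fmod B, R -> X -> tens R X,
  [/\ (forall X a, linear (rho X a)) /\ (forall X x, linear ((rho X)^~ x)),
      forall X (c : D) a x, rho X (c ∙ a) x = rho X a (theta c ∙ x),
      forall (X Y : fmod B) (f : 'Hom(X, Y)) a x, mlinear f -> tmap \1%VF f (rho X a x) = rho Y a (f x)
    & forall (X : fmod B) (U : vectType k) (b : R -> X -> U), (forall a, linear (b a)) -> (forall x, linear (b^~ x)) ->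
        (forall c a x, b (c ∙ a) x = b a (theta c ∙ x)) -> forall a x, tlift b (rho X a x) = b a x].
Proof.
move=> lt tM pR; have [s ms sK] := projective_section pR.
pose psi (X : fmod B) (x : X) : tens D R -> tens R X :=
  tlift (fun (d : D) (a : R) => a ⊗ (theta d ∙ x)).
have psil (X : fmod B) (x : X) : linear (@psi X x) by apply: tlift_is_linear.
have psiE (X : fmod B) (x : X) d a : @psi X x (d ⊗ a) = a ⊗ (theta d ∙ x).
  rewrite /psi tlift_pure // => [? c u v | ? c u v].
    by rewrite lt actDl actZl pure_linear_r.
  by rewrite pure_linear_l.
have psix (X : fmod B) c (x y : X) u : @psi X (c *: x + y) u = c *: psi X x u + psi X y u.
  rewrite /psi -tlift_linear_fun; apply: tlift_ext => d a.
  by rewrite actDr actZr pure_linear_r.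
have psiB (X : fmod B) (c : D) (x : X) (u : freem D R) : psi X x (c ∙ u) = psi X (theta c ∙ x) u.
  move: u; apply: tens_ext => [d u v | d u v | d a].
  - by rewrite actDr actZr psil.
  - by rewrite psil.
  by rewrite [c ∙ _]freem_act_pure !psiE tM actM.
exists (fun X a x => psi X x (s a)); split.
- by split=> [X a c x y | X x c a b]; rewrite ?psix // linearP psil.
- by move=> X c a x; rewrite -psiB ms.
- move=> X Y f a x mf; move: (s a); apply: tens_ext => [c u v | c u v | d b].
  + by rewrite psil linearP.
  + by rewrite psil.
  by rewrite !psiE tmapE id_lfunE mf.
move=> X U b br bl bal a x; rewrite -{2}[a]sK.
have lb : linear (tlift b) by apply: tlift_is_linear.
move: (s a); apply: tens_ext => [c u v | c u v | d a'].
- by rewrite psil lb.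
- by rewrite linearP bl.
by rewrite psiE free_coverE tlift_pure // bal.
Qed.

(** * Projective standard modules and semisimplicity *)

Section Flatness.

Variables (k : fieldType) (A : falgType k) (B : {aspace A}) (B1 : 1 \in B).
Hypothesis pB : projective (right_mod B1).
Implicit Types (M N : fmod (subvs_of B)).

(** Flatness of a projective right module: the natural embedding of A ⊗_B X in A ⊗_k X from
    [projective_balanced] reduces it to tensoring over k. *)
Lemma ind_map_inj M N (f : 'Hom(M, N)) : mlinear f -> (forall x, f x = 0 -> x = 0) ->
  forall z, ind_map f z = 0 -> z = 0.
Proof.
move=> mf fi.
have [||r [[rr rl] bal nat back]] :=
  @projective_balanced k (subvs_of B)^c (subvs_of B) (fun b => b) (right_mod B1) _ _ pB.
- by [].
- by [].
have rho (X : fmod (subvs_of B)) :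
    exists F : 'Hom(ind_mod X, tens A X), forall a x, F (ind_pure a x) = r X a x.
  by apply: ind_lift => [a|x|a c x]; [exact: rr | exact: rl | exact: bal].
have [rM rME] := rho M; have [rN rNE] := rho N.
have backM z : linfun (tlift (ind_pure (M := M))) (rM z) = z.
  rewrite -[RHS]id_lfunE -comp_lfunE; move: z; apply: ind_ext => a x.
  rewrite id_lfunE comp_lfunE rME linfunE; last exact: tlift_is_linear.
  apply: back => [b|y|c b y]; [exact: ind_pure_linear_r | exact: ind_pure_linear_l |].
  exact: ind_pure_balanced.
have natf z : rN (ind_map f z) = tmap \1%VF f (rM z).
  rewrite -!comp_lfunE; move: z; apply: ind_ext => a x.
  by rewrite comp_lfunE [RHS]comp_lfunE ind_map_pure // rNE rME nat.
move=> z fz; rewrite -[z]backM; suff -> : rM z = 0 by rewrite linear0.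
apply: (tmap_inj (f := \1%VF) (g := f)) => [x | // | ]; first by rewrite id_lfunE.
by rewrite -natf fz linear0.
Qed.

(** The quotient map by the image of [ind_map i], restricted to [P], kills ker p; by adjunction it
    factors through [ind_map p]. *)
Lemma ind_map_exact (K P M : fmod (subvs_of B)) (i : 'Hom(K, P)) (p : 'Hom(P, M)) : mlinear i -> mlinear p ->
  (forall y, exists x, p x = y) -> (forall x, p x = 0 -> exists y, i y = x) ->
  forall z, ind_map p z = 0 -> exists y, ind_map i y = z.
Proof.
move=> mi mp sp ex z pz.
have mI := ind_map_mlinear mi; have mP := ind_map_mlinear mp.
have sI := submod_limg mI; pose q : 'Hom(ind_mod P, quo_mod sI) := quo_pi (limg (ind_map i)).
have mq : mlinear q := mlinear_quo_pi sI.
pose u : 'Hom(P, res B1 (quo_mod sI)) := (q \o ind_unit B1 P)%VF.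
have mu : mlinear u by move=> b x; rewrite !comp_lfunE ind_unit_mlinear !res_actE mq.
have [|v vE] := @lfun_factor _ _ _ _ p u.
  move=> x /ex[y <-]; rewrite comp_lfunE -(ind_map_unit B1 y mi); apply/eqP.
  by rewrite quo_pi_eq0 memv_img ?memvf.
have mv : mlinear v by move=> b y; have [x <-] := sp y; rewrite -mp -!vE mu.
have [F mF FE] := ind_hom mv.
have e : q z = F (ind_map p z).
  rewrite -comp_lfunE; move: z {pz}; apply: (ind_hom_ext (B1 := B1)) => //.
    exact: mlinear_comp.
  by move=> x; rewrite comp_lfunE ind_map_unit // FE -vE comp_lfunE.
have : z \in limg (ind_map i) by rewrite -quo_pi_eq0 -/q e pz linear0.
by case/memv_limgP=> y ->; exists y.
Qed.

End Flatness.

Section ProjectiveStandard.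

Variables (k : fieldType) (A : falgType k) (I : finType) (S : I -> fmod A) (le : rel I).
Variables (B : {aspace A}) (B1 : 1 \in B) (J : finType) (L : J -> fmod (subvs_of B)) (phi : J -> I).
Hypotheses (simS : is_Sim S) (qh : quasi_hereditary S le) (simL : is_Sim L).
Hypothesis pB : projective (right_mod B1).
Hypothesis dL : directed L (fun j j' => le (phi j) (phi j')).
Hypothesis mono1 : forall a c, coef_mono_all 1 (ind_unit B1 (L c)) (L a).

(** If L b is not projective, a class in Ext^1(L b, L d) survives with coefficients in A ⊗_B L d. By
    adjunction it is a map from the induced kernel of the cover, and a splitting of the induced
    cover extends that map, a contradiction. *)
Lemma projective_of_ind b : projective (ind_mod (L b)) -> projective (L b).
Proof.
move=> pI; apply: NNPP => npb.
have [d [P [p [f [ndb cp mf nG]]]]] := nonprojective_ext simL dL mono1 npb.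
have [pP mp _ _] := cp; have sp := cover_surj cp.
have sK := submod_ker mp; pose i := subm_val sK.
have mi : mlinear i := mlinear_subm_val (sU := sK).
have pi x : p (i x) = 0 by apply/eqP; rewrite -memv_ker subm_valP.
have iE x : p x = 0 -> exists y, i y = x.
  by move=> px; apply: subm_ex; rewrite memv_ker px.
pose u : 'Hom(subm sK, res B1 (ind_mod (L d))) := (ind_unit B1 (L d) \o f \o i)%VF.
have mu : mlinear u by move=> a x; rewrite !comp_lfunE mi mf ?pi // ind_unit_mlinear.
have [F mF FE] := ind_hom mu.
have mI := ind_map_mlinear mi; have mP := ind_map_mlinear mp.
have sP y : exists x, ind_map p x = y.
  suff: y \in limg (ind_map p) by move=> /memv_limgP[x ->]; exists x.
  move: y; apply: ind_span => a y; have [x <-] := sp y.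
  by rewrite -ind_map_pure // memv_img ?memvf.
have [s ms sE] := proj_lift_surj pI mP (@mlinear_id _ _ _) sP.
pose q := \1%VF - (s \o ind_map p)%VF.
have qE z : q z = z - s (ind_map p z) by rewrite add_lfunE opp_lfunE id_lfunE comp_lfunE.
have mq : mlinear q by apply: mlinearB; [exact: mlinear_id | exact: mlinear_comp].
(* [E] is the retraction of the induced cover onto the induced kernel determined by the splitting
   [s]. *)
pose E := ((ind_map i)^-1 \o q)%VF.
have EE z : ind_map i (E z) = q z.
  have [|y yE] := ind_map_exact B1 mi mp sp iE (z := q z).
    by rewrite qE linearB /=; have := sE (ind_map p z); rewrite id_lfunE => ->; rewrite subrr.
  by rewrite [E z]comp_lfunE limg_lfunVK // -yE memv_img ?memvf.
clearbody E q.
have inj := ind_map_inj pB mi (fun x e => @subm_val_inj _ _ _ _ sK x 0 (etrans e (esym (linear0 _)))).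
have mE : mlinear E.
  move=> a z; apply/eqP; rewrite -subr_eq0; apply/eqP/inj.
  by rewrite linearB /= mI !EE mq subrr.
apply: (nG (F \o E \o ind_unit B1 P)%VF).
  by move=> b' x; rewrite !comp_lfunE ind_unit_mlinear !res_actE mE mF.
move=> x px; have [y yE] := iE x px; rewrite !comp_lfunE.
have -> : E (ind_unit B1 P x) = ind_unit B1 (subm sK) y.
  apply/eqP; rewrite -subr_eq0; apply/eqP/inj.
  by rewrite linearB /= EE qE !ind_map_unit // px yE !linear0 addr0 subrr.
by rewrite FE !comp_lfunE yE.
Qed.

End ProjectiveStandard.

(** * Semisimple algebras and projectivity of simple modules *)

Section Semisimple.

Variables (k : fieldType) (A : falgType k).
Implicit Types (M N D S : fmod A).

Lemma big_dsum_hom (J : eqType) (L : J -> fmod A) (r : seq J) N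
    (f : 'Hom(\big[@dsum _ _/zero_mod]_(j <- r) L j, N)) : mlinear f -> f <> 0 ->
  exists j (i : 'Hom(L j, \big[@dsum _ _/zero_mod]_(j <- r) L j))
    (p : 'Hom(\big[@dsum _ _/zero_mod]_(j <- r) L j, L j)),
    [/\ mlinear i, mlinear p, forall x, p (i x) = x & (f \o i)%VF <> 0].
Proof.
elim: r f => [|j0 r IHr].
  rewrite big_nil => f _ nf; case: nf; apply/lfunP=> x.
  by rewrite (_ : x = 0) ?linear0 // [LHS]thinmx0 [RHS]thinmx0.
rewrite big_cons; set R := \big[_/_]_(_ <- _) _ in IHr * => f mf nf.
have l1 : linear (fun x : L j0 => (x, 0) : dsum (L j0) R).
  by move=> c x y; congr (_, _); rewrite /= ?scaler0 ?addr0.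
have l2 : linear (fun x : R => (0, x) : dsum (L j0) R).
  by move=> c x y; congr (_, _); rewrite /= ?scaler0 ?addr0.
have l3 : linear (fun x : dsum (L j0) R => x.1) by [].
have l4 : linear (fun x : dsum (L j0) R => x.2) by [].
pose i1 : 'Hom(L j0, dsum (L j0) R) := linfun (fun x => (x, 0)).
pose i2 : 'Hom(R, dsum (L j0) R) := linfun (fun x => (0, x)).
have m1 : mlinear i1 by move=> a x; rewrite !(linfunE l1) /act /= /dsum_act /= act0r.
have m2 : mlinear i2 by move=> a x; rewrite !(linfunE l2) /act /= /dsum_act /= act0r.
case: (classic ((f \o i1)%VF = 0)) => [e1|n1]; last first.
  exists j0, i1, (linfun (fun x : dsum (L j0) R => x.1)); split=> // [a x|x].
    by rewrite !(linfunE l3).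
  by rewrite (linfunE l3) (linfunE l1).
have n2 : (f \o i2)%VF <> 0.
  move=> e2; apply: nf; apply/lfunP=> x; rewrite zero_lfunE.
  have -> : x = i1 x.1 + i2 x.2.
    rewrite (linfunE l1) (linfunE l2); case: x => x y.
    by congr (_, _); rewrite /= ?addr0 ?add0r.
  by rewrite linearD /= -!comp_lfunE e1 e2 !zero_lfunE addr0.
have [j [i [p [mi mp pi n]]]] := IHr (f \o i2)%VF (mlinear_comp mf m2) n2.
exists j, (i2 \o i)%VF, (p \o linfun (fun x : dsum (L j0) R => x.2))%VF; split.
- exact: mlinear_comp.
- by move=> a x; rewrite !comp_lfunE !(linfunE l4) -mp.
- by move=> x; rewrite !comp_lfunE (linfunE l2) (linfunE l4) /= pi.
by rewrite comp_lfunA.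
Qed.

(** [S] is a quotient of the regular module, so some simple summand of the latter, which is
    projective, maps isomorphically onto [S]. *)
Lemma semisimple_simple_projective S : semisimple_alg A -> simple S -> projective S.
Proof.
case=> n [L [sL [h mh bh]]] sS; have [s s0] := simple_neq0 sS.
have [g [mg hK gK]] := bij_mlinear_inv mh bh.
have l : linear (fun a : regular_mod A => (a : A) ∙ s) by move=> c a b; rewrite actDl actZl.
pose b : 'Hom(regular_mod A, S) := linfun (fun a : regular_mod A => (a : A) ∙ s).
have mb : mlinear b by move=> a c; rewrite !(linfunE l) -actM.
have [|j [i [p [mi mp pi ni]]]] := big_dsum_hom (mlinear_comp mb mg).
  apply: (hom_neq0 (x := h (1 : A))).
  by rewrite comp_lfunE hK (linfunE l) act1.
have [x nx] := lfun_neq0 ni.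
apply: (proj_miso (P := L j)).
  exists ((b \o g) \o i)%VF; first by do 2?apply: mlinear_comp.
  by apply: schur nx => //; do 2?apply: mlinear_comp.
apply: (proj_retract (i := (g \o i)%VF) (r := (p \o h)%VF)) (@regular_projective _ _).
- exact: mlinear_comp.
- exact: mlinear_comp.
by move=> y; rewrite !comp_lfunE gK pi.
Qed.

(** A simple quotient of [U] is projective and splits off; the kernel has smaller dimension. *)
Lemma submodule_semisimple M (U : {vspace M}) (sU : submod U) :
  (forall S, simple S -> projective S) -> semisimple (subm sU).
Proof.
move=> ps; have [n] := ubnP (\dim U); elim: n U sU => // n IHn U sU dU.
have [e | nU] := classic (0%VS = U).
  exists 0%N, (fun _ => M); split; first by case.
  rewrite big_ord0; exists 0; first exact: mlinear0.
  apply: lfun_bij => [x _ | y]; last by exists 0; rewrite linear0 [LHS]thinmx0 [RHS]thinmx0.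
  apply: (@subm_val_inj _ _ _ _ sU); rewrite linear0.
  by apply/eqP; rewrite -memv0 e subm_valP.
have [U1 [D [sU1 /andP[_ U1U] nU1 sD iD]]] := colayer (@submod0 _ _ M) sU (sub0v _) nU.
have [g [mg gV gK]] := iD; pose G := (g \o subm_val sU)%VF.
have mG : mlinear G.
  by move=> a x; rewrite !comp_lfunE mlinear_subm_val mg ?subm_valP.
have sG y : exists x, G x = y.
  have : y \in (g @: U)%VS by rewrite gV memvf.
  case/memv_imgP=> x Ux ->; have [z <-] := subm_ex sU Ux; by exists z; rewrite comp_lfunE.
have [f mf fE] := proj_lift_surj (ps _ sD) mG (@mlinear_id _ _ D) sG.
have {}fE y : G (f y) = y by rewrite fE id_lfunE.
have U1P (x : subm sU) : (subm_val sU x \in U1) = (G x == 0).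
  by rewrite -gK memv_cap subm_valP memv_ker comp_lfunE.
pose q := (subm_val sU \o (\1 - (f \o G)))%VF.
have qE x : q x = subm_val sU (x - f (G x)) by rewrite comp_lfunE add_lfunE opp_lfunE id_lfunE comp_lfunE.
have mq : mlinear q.
  by move=> a x; rewrite !qE mG mf -actBr mlinear_subm_val.
have [|r mr rE] := subm_lift sU1 mq.
  by move=> x; rewrite qE U1P linearB /= fE subrr.
have hl : linear (fun x : subm sU => (G x, r x) : dsum D (subm sU1)).
  by move=> c x y; rewrite !linearP.
have iso1 : miso (subm sU) (dsum D (subm sU1)).
  exists (linfun (fun x : subm sU => (G x, r x) : dsum D (subm sU1))).
    by move=> a x; rewrite !(linfunE hl) mG mr.
  apply: lfun_bij => [x | [d u]]; rewrite ?(linfunE hl).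
    case=> Gx rx; apply: (@subm_val_inj _ _ _ _ sU).
    by have := rE x; rewrite rx qE Gx !linear0 addr0 => <-.
  have [w wE] := subm_ex sU (subvP U1U _ (subm_valP u)).
  have Gw : G w = 0 by apply/eqP; rewrite -U1P wE subm_valP.
  exists (f d + w); rewrite (linfunE hl); congr (_, _).
    by rewrite linearD /= fE Gw addr0.
  apply: (@subm_val_inj _ _ _ _ sU1).
  by rewrite rE qE [G _]linearD /= fE Gw addr0 addrC addKr wE.
have dU1 : (\dim U1 < n)%N.
  rewrite ltnS in dU; apply: leq_trans dU; rewrite ltn_neqAle dimvS // andbT.
  by apply/eqP=> e; apply: nU1; apply/eqP; rewrite eqEdim U1U e leqnn.
have [m [L [sL isoL]]] := IHn U1 sU1 dU1.
exists m.+1, (fun t => if unlift ord0 t is Some t' then L t' else D); split.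
  by move=> t; case: unliftP => [t' _|_].
apply: miso_trans iso1 _; rewrite big_ord_recl unlift_none.
under eq_bigr => t _ do rewrite liftK.
have [u mu bu] := isoL; have [v [mv uK vK]] := bij_mlinear_inv mu bu.
set R := \big[_/_]_(t < m) _ in u mu bu v mv uK vK *.
have kl : linear (fun x : dsum D (subm sU1) => (x.1, u x.2) : dsum D R).
  by move=> c x y; congr (_, _); rewrite linearP.
exists (linfun (fun x : dsum D (subm sU1) => (x.1, u x.2) : dsum D R)).
  by move=> a x; rewrite !(linfunE kl) [in LHS]/act /= /dsum_act /= mu.
apply: lfun_bij => [[x y] | [x y]]; rewrite ?(linfunE kl) /=.
  by case=> -> uy; rewrite -[y]uK uy linear0.
by exists (x, v y); rewrite (linfunE kl) /= vK.
Qed.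

Lemma semisimple_alg_of_projective : (forall S, simple S -> projective S) -> semisimple_alg A.
Proof.
move=> ps; have [n [L [sL iL]]] := submodule_semisimple (@submodT _ _ (regular_mod A)) ps.
exists n, L; split=> //; apply: miso_trans iL; apply: miso_sym.
exists (subm_val (@submodT _ _ (regular_mod A))); first exact: mlinear_subm_val.
apply: lfun_bij => [x e | y].
  by apply: (@subm_val_inj _ _ _ _ (@submodT _ _ (regular_mod A))); rewrite e linear0.
by have [x xE] := subm_ex (@submodT _ _ (regular_mod A)) (memvf y); exists x.
Qed.

End Semisimple.

Section SemisimpleBorel.

Variables (k : fieldType) (A : falgType k) (I : finType) (S : I -> fmod A) (le : rel I).
Variables (B : {aspace A}) (B1 : 1 \in B) (J : finType) (L : J -> fmod (subvs_of B)).
Hypotheses (simS : is_Sim S) (qh : quasi_hereditary S le) (simL : is_Sim L).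

(** The cover P(i) -> S(i) splits and is essential, hence an isomorphism, so its nonzero quotient
    Delta(i) is S(i). *)
Lemma semisimple_standard i D : semisimple_alg A -> is_standard S le i D -> simple D /\ projective D.
Proof.
move=> ssA sD; have [sS _ _] := simS; have [_ [x x0]] := standard_scalar qh sD.
suff iD : miso (S i) D.
  split; first exact: simple_miso iD (sS i).
  exact: proj_miso iD (semisimple_simple_projective ssA (sS i)).
case: sD => P [p [U [sU [cp _ iD]]]].
have [pP mp fp ep] := cp.
have [s ms sE] := proj_lift_surj (semisimple_simple_projective ssA (sS i)) mp (@mlinear_id _ _ _) (cover_surj cp).
have es : limg s = fullv.
  apply: ep; first exact: submod_limg.
  apply/vspaceP=> y; rewrite memvf; have := sE y; rewrite id_lfunE => <-.
  by rewrite memv_img // memv_img ?memvf.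
have bs : bijective s.
  apply: lfun_bij => [y e | y].
    by have := sE y; rewrite e linear0 id_lfunE.
  by have : y \in limg s; [rewrite es memvf | case/memv_limgP=> z ->; exists z].
apply: miso_trans (miso_sym iD); have [f mf bf] := iD.
exists (quo_pi U \o s : 'Hom(S i, quo_mod sU))%VF.
  by move=> a y; rewrite !comp_lfunE ms (mlinear_quo_pi sU).
have [y yE] := quo_pi_surj (f x).
have [s' _ s'K] := bs.
have n : (quo_pi U \o s : 'Hom(S i, quo_mod sU))%VF (s' y) != 0.
  by rewrite comp_lfunE s'K yE; rewrite -(inj_eq (bij_inj bf)) linear0 in x0.
have m : mlinear (quo_pi U \o s : 'Hom(S i, quo_mod sU))%VF.
  by move=> a z; rewrite !comp_lfunE ms (mlinear_quo_pi sU).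
apply: lfun_bij; first exact: simple_inj (sS i) m n.
by move=> z; have [w <-] := quo_pi_surj z; exists (s' w); rewrite comp_lfunE s'K.
Qed.

Lemma full_projective_semisimple : (forall a, a \in B) -> (forall j, projective (L j)) ->
  semisimple_alg A.
Proof.
move=> Bf pL; apply: semisimple_alg_of_projective => X sX.
apply: (@full_projective _ _ _ B1 Bf X); have [_ _ cL] := simL.
have [j jX] := cL _ (proj1 (full_simple_res B1 Bf X) sX).
exact: proj_miso (miso_sym jX) (pL j).
Qed.

End SemisimpleBorel.

(** * Comparison maps over the tensor product *)

Section DegreeOneObstruction.

Variables (k : fieldType) (B B' C : falgType k) (T : tensor_structure B B' C).
Variables (P La Lc Xc : fmod B) (P' Lb Ld Xd : fmod B').
Variables (p : 'Hom(P, La)) (p' : 'Hom(P', Lb)) (eta : 'Hom(Lc, Xc)) (eta' : 'Hom(Ld, Xd)).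
Hypotheses (pP : projective P) (pP' : projective P') (mp : mlinear p) (mp' : mlinear p').
Hypotheses (sp : forall y, exists x, p x = y) (sp' : forall y, exists x, p' x = y).
Hypotheses (meta : mlinear eta) (meta' : mlinear eta').
Hypothesis noP : forall g : 'Hom(P, Lc), mlinear g -> g = 0.
Hypothesis noP' : forall g : 'Hom(P', Ld), mlinear g -> g = 0.

(** This is the vanishing of Ext^1(La ⊗ Lb, Lc ⊗ Ld): an argument fixed in ker p or ker p' leaves,
    after contraction, a module map on the other cover, which is zero by [noP'] or [noP]. *)
Let ker_on (h : 'Hom(tens P P', tens Lc Ld)) :
  (forall c x, tmap p p' x = 0 -> h (c ∙ (x : tmod T P P')) = c ∙ (h x : tmod T Lc Ld)) ->
  forall z, tmap p p' z = 0 -> h z = 0.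
Proof.
move=> mh; apply: tmap_ker => v w e.
  have kw w' : tmap p p' (v ⊗ w') = 0 by rewrite tmapE e pure0l.
  apply: contr_l_eq0 => xi.
  have l : linear (fun w' => contr_l Ld xi (h (v ⊗ w'))).
    by move=> c x y; rewrite pure_linear_r !linearP.
  have m : mlinear (linfun (fun w' => contr_l Ld xi (h (v ⊗ w')))).
    move=> b' x; rewrite !(linfunE l) -(contr_l_act (T := T)) -mh // tmod_act act1 //.
  by rewrite -(linfunE l) (noP' m) zero_lfunE.
have kv v' : tmap p p' (v' ⊗ w) = 0 by rewrite tmapE e pure0r.
apply: contr_r_eq0 => xi.
have l : linear (fun v' => contr_r Lc xi (h (v' ⊗ w))).
  by move=> c x y; rewrite pure_linear_l !linearP.
have m : mlinear (linfun (fun v' => contr_r Lc xi (h (v' ⊗ w)))).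
  move=> b x; rewrite !(linfunE l) -(contr_r_act (T := T)) -mh // tmod_act act1 //.
by rewrite -(linfunE l) (noP m) zero_lfunE.
Qed.

(** The class of [F] has no preimage: one would vanish on the kernel by [ker_on], so [F] would agree
    there with a module map [G]. Slicing [G] at a point [x] over [y], where [F0 y] is nonzero, would
    extend [eta' f']. *)
Lemma tensor_not_epi (F0 : 'Hom(La, Xc)) (f' : 'Hom(P', Ld)) :
  mlinear F0 -> F0 <> 0 -> (forall a x, p' x = 0 -> f' (a ∙ x) = a ∙ f' x) ->
  (forall G : 'Hom(P', Xd), mlinear G -> ~ (forall x, p' x = 0 -> eta' (f' x) = G x)) ->
  ~ coef_epi_all 1 (tmap eta eta' : 'Hom(tmod T Lc Ld, tmod T Xc Xd)) (tmod T La Lb).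
Proof.
move=> mF0 /lfun_neq0[y ny] mf' nG epi.
pose F := tmap (F0 \o p)%VF (eta' \o f')%VF.
have mF c (z : tmod T P P') : tmap p p' z = 0 -> F (c ∙ z) = c ∙ (F z : tmod T Xc Xd).
  move: z; elim/(tensor_ind (T := T)): c => [a c d hc hd z e|z e|b b'].
  - by rewrite !actDl !actZl linearP /= hc ?hd.
  - by rewrite !act0l linear0.
  pose t := tm T b b'.
  (* The defect of linearity of [F]; vanishing on ker (p ⊗ p') can be tested on ker p ⊗ P' and P ⊗
     ker p'. *)
  pose de : 'Hom(tens P P', tens Xc Xd) := (F \o linfun (act (f := tmod T P P') t))%VF -
    (linfun (act (f := tmod T Xc Xd) t) \o F)%VF.
  have deE z : de z = F (t ∙ (z : tmod T P P')) - t ∙ (F z : tmod T Xc Xd).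
    rewrite add_lfunE opp_lfunE !comp_lfunE (linfunE (@act_linear _ _ (tmod T Xc Xd) t)).
    by rewrite (linfunE (@act_linear _ _ (tmod T P P') t)).
  move=> z e; apply/eqP; rewrite -subr_eq0 -/t -deE; apply/eqP.
  move: z e; apply: tmap_ker => v w e; rewrite deE tmod_act !tmapE !comp_lfunE.
    by rewrite mp e act0r !linear0 !pure0l act0r subrr.
  by rewrite mp mF0 mf' // meta' tmod_act subrr.
have [f [G [mf mG FE]]] := epi_extend (tmod_projective (T := T) pP pP') (tmap_mlinear (T := T) mp mp')
  (tmap_surj sp sp') epi mF.
have [x xE] := sp y.
have [xi xiE] := functional_neq0 ny.
apply: (nG (slice_r G x xi)); first exact: (slice_r_mlinear (T := T) mG).
move=> w e; have kz : tmap p p' (x ⊗ w) = 0 by rewrite tmapE e pure0r.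
rewrite (slice_rE (T := T)); have := FE _ kz; rewrite (ker_on mf kz) linear0 add0r => <-.
by rewrite tmapE contr_lE !comp_lfunE xE xiE scale1r.
Qed.

End DegreeOneObstruction.

(** * Tensoring a resolution with a projective simple module *)

Section TensorResolution.

Variables (k : fieldType) (B B' C : falgType k) (T : tensor_structure B B' C).

Lemma tmap_id_exact (V : vectType k) (W0 W1 W2 : vectType k) (f : 'Hom(W0, W1)) (g : 'Hom(W1, W2)) :
  limg f = lker g -> limg (tmap (\1%VF : 'End(V)) f) = lker (tmap (\1%VF : 'End(V)) g).
Proof.
move=> ex; apply/eqP; rewrite eqEsubv; apply/andP; split; apply/subvP=> z.
  case/memv_limgP=> u ->; rewrite memv_ker; apply/eqP.
  rewrite -comp_lfunE -[RHS](zero_lfunE _ u); move: u; apply: lin_ext_tens => v w.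
  rewrite comp_lfunE !tmapE zero_lfunE !id_lfunE.
  have : f w \in lker g by rewrite -ex memv_img ?memvf.
  by rewrite memv_ker => /eqP->; rewrite pure0r.
rewrite memv_ker => /eqP e.
(* [q] has kernel [W], so membership in the image becomes a vanishing statement that [tmap_ker] can
   test. *)
set W := limg _; pose q : 'End(tens V W1) := \1%VF - projv W.
have qE x : q x = x - projv W x by rewrite add_lfunE opp_lfunE id_lfunE.
suff: q z = 0 by rewrite qE => /eqP; rewrite subr_eq0 => /eqP->; apply: memv_proj.
move: z e; apply: tmap_ker => v w; rewrite qE.
  by rewrite id_lfunE => ->; rewrite pure0l linear0 subrr.
move=> gw; have : w \in limg f by rewrite ex memv_ker gw.
case/memv_limgP=> u ->; rewrite projv_id ?subrr //.
by rewrite -[v]id_lfunE -tmapE memv_img ?memvf.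
Qed.

Lemma tensor_resolution (S : fmod B) (M' : fmod B') (P' : nat -> fmod B')
    (d' : forall n, 'Hom(P' n.+1, P' n)) (e' : 'Hom(P' 0%N, M')) :
  projective S -> projective_resolution d' e' ->
  @projective_resolution k C (tmod T S M') (fun n => tmod T S (P' n))
    (fun n => tmap \1%VF (d' n)) (tmap \1%VF e').
Proof.
move=> pS r'; have [pP' md me /limg_fullP se [ex0 ex]] := r'.
split.
- by move=> n; apply: tmod_projective.
- by move=> n; apply: (tmap_mlinear (T := T)) => //; apply: mlinear_id.
- by apply: (tmap_mlinear (T := T)) => //; apply: mlinear_id.
- by apply/limg_fullP; apply: tmap_surj => // y; exists y; rewrite id_lfunE.
by split=> [|n]; apply: tmap_id_exact.
Qed.

End TensorResolution.

Section TensorSimpleProjective.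

Variables (k : closedFieldType) (B B' C : falgType k) (T : tensor_structure B B' C).
Variables (S : fmod B) (M' N' X' : fmod B') (eta' : 'Hom(N', X')).
Hypotheses (sS : simple S) (pS : projective S) (meta' : mlinear eta').

Let scS : scalar_end S := schur_scalar sS.
Let nzS : exists x : S, x != 0 := simple_neq0 sS.

Let pure_inj (Y : fmod B') s (y y' : Y) : s != 0 -> (s : S) ⊗ y = s ⊗ y' -> y = y'.
Proof.
move=> s0 e; apply/eqP; rewrite -subr_eq0; apply: contraTT isT => n.
by have := pure_neq0 s0 n; rewrite pureBr e subrr eqxx.
Qed.

Let lift_id (Y Z : fmod B') (g : 'Hom(Y, Z)) : mlinear g ->
  mlinear (tmap \1%VF g : 'Hom(tmod T S Y, tmod T S Z)).
Proof. by move=> mg; apply: (tmap_mlinear (T := T)) => //; apply: mlinear_id. Qed.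

(** S ⊗ P' is a resolution of S ⊗ M', and [hom_scalar_tens] identifies its cochains with those of
    [P']. *)
Lemma tensor_simple_coef n :
  (coef_mono_all n.+1 eta' M' ->
   coef_mono_all n.+1 (tmap \1%VF eta' : 'Hom(tmod T S N', tmod T S X')) (tmod T S M')) /\
  (coef_epi_all n.+1 eta' M' ->
   coef_epi_all n.+1 (tmap \1%VF eta' : 'Hom(tmod T S N', tmod T S X')) (tmod T S M')).
Proof.
have dM := decomposition_miso (miso_refl (tmod T S M')).
have [P' [d' [e' r']]] := resolution_exists M'.
have [s s0] := nzS.
split=> h.
  apply: coef_mono_decomposition dM _ => _.
  exists (fun n => tmod T S (P' n)), (fun n => tmap \1%VF (d' n)), (tmap \1%VF e').
  split; first exact: tensor_resolution.
  move=> f /cocycleP[mf fd] /coboundaryP[G mG GE].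
  have [f1 mf1 f1E] := hom_scalar_tens scS nzS mf.
  have [G1 mG1 G1E] := hom_scalar_tens scS nzS mG.
  have /coboundaryP[g mg gE] : coboundary d' f1.
    apply: (h _ _ _ r').
      apply/cocycleP; split=> // x; apply: (pure_inj s0).
      by rewrite -f1E pure0r -(fd (s ⊗ x)) tmapE id_lfunE.
    apply/coboundaryP; exists G1 => // x; apply: (pure_inj s0).
    by rewrite -G1E comp_lfunE -[s in RHS]id_lfunE -tmapE -GE comp_lfunE f1E tmapE id_lfunE.
  apply/coboundaryP; exists (tmap \1%VF g); first exact: lift_id.
  move=> x; rewrite -comp_lfunE; move: x; apply: lin_ext_tens => v w.
  by rewrite comp_lfunE !tmapE !id_lfunE f1E gE.
apply: coef_epi_decomposition dM _ => _.
exists (fun n => tmod T S (P' n)), (fun n => tmap \1%VF (d' n)), (tmap \1%VF e').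
split; first exact: tensor_resolution.
move=> F /cocycleP[mF Fd]; have [F1 mF1 F1E] := hom_scalar_tens scS nzS mF.
have [|f /cocycleP[mf fd] /coboundaryP[G mG GE]] := h _ _ _ r' F1.
  apply/cocycleP; split=> // x; apply: (pure_inj s0).
  by rewrite -F1E pure0r -(Fd (s ⊗ x)) tmapE id_lfunE.
exists (tmap \1%VF f).
  apply/cocycleP; split; first exact: lift_id.
  move=> x; rewrite -comp_lfunE -[RHS](zero_lfunE _ x); move: x; apply: lin_ext_tens => v w.
  by rewrite comp_lfunE !tmapE fd pure0r zero_lfunE.
apply/coboundaryP; exists (tmap \1%VF G); first exact: lift_id.
move=> x; rewrite -comp_lfunE; move: x; apply: lin_ext_tens => v w.
rewrite [RHS]comp_lfunE add_lfunE opp_lfunE comp_lfunE F1E !tmapE !id_lfunE -pureBr.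
by rewrite -GE add_lfunE opp_lfunE comp_lfunE.
Qed.

(** A slice of a nonzero cochain would be an isomorphism from [S] to [R] or [Xr], so all cochains on
    this resolution are zero. *)
Lemma tensor_simple_coef_vanish n (R : fmod B) (Xr : fmod B) (eta : 'Hom(R, Xr)) :
  simple R -> bijective eta -> mlinear eta -> ~ miso S R ->
  coef_mono_all n.+1 (tmap eta eta' : 'Hom(tmod T R N', tmod T Xr X')) (tmod T S M') /\
  coef_epi_all n.+1 (tmap eta eta' : 'Hom(tmod T R N', tmod T Xr X')) (tmod T S M').
Proof.
move=> sR be me nSR.
have sXr : simple Xr by apply: simple_miso sR; exists eta.
have nSX : ~ miso S Xr.
  by move=> i; apply: nSR; apply: miso_trans i _; apply: miso_sym; exists eta.
have dM := decomposition_miso (miso_refl (tmod T S M')).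
have [P' [d' [e' r']]] := resolution_exists M'.
have z (R1 : fmod B) (Y Z : fmod B') (f : 'Hom(tmod T S Y, tmod T R1 Z)) : simple R1 -> ~ miso S R1 ->
    mlinear f -> f = 0.
  move=> sR1 nR1 mf; apply: NNPP => nf; apply: nR1.
  have [[x' [xi ns]] _] := nonzero_slices nf; have [x nx] := lfun_neq0 ns.
  have ml := slice_l_mlinear mf x' xi.
  exists (slice_l f x' xi) => //; exact: schur sS sR1 ml nx.
split.
  apply: coef_mono_decomposition dM _ => _.
  exists (fun n => tmod T S (P' n)), (fun n => tmap \1%VF (d' n)), (tmap \1%VF e').
  split; first exact: tensor_resolution.
  move=> f /cocycleP[mf _] _; rewrite (z _ _ _ f sR nSR mf).
  by apply/coboundaryP; exists 0; [apply: mlinear0 | move=> x; rewrite !zero_lfunE].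
apply: coef_epi_decomposition dM _ => _.
exists (fun n => tmod T S (P' n)), (fun n => tmap \1%VF (d' n)), (tmap \1%VF e').
split; first exact: tensor_resolution.
move=> F /cocycleP[mF _]; rewrite (z _ _ _ F sXr nSX mF); exists 0.
  by apply/cocycleP; split; [apply: mlinear0 | move=> x; rewrite zero_lfunE].
apply/coboundaryP; exists 0; first exact: mlinear0.
by move=> x; rewrite add_lfunE opp_lfunE comp_lfunE !zero_lfunE linear0 subrr.
Qed.

Lemma tensor_simple_projective_coef n (R : fmod B) (Xr : fmod B) (eta : 'Hom(R, Xr)) :
  simple R -> bijective eta -> mlinear eta ->
  coef_mono_all n.+1 eta' M' -> coef_epi_all n.+1 eta' M' ->
  coef_mono_all n.+1 (tmap eta eta' : 'Hom(tmod T R N', tmod T Xr X')) (tmod T S M') /\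
  coef_epi_all n.+1 (tmap eta eta' : 'Hom(tmod T R N', tmod T Xr X')) (tmod T S M').
Proof.
move=> sR be me hm he.
have [[u mu bu] | nSR] := classic (miso S R); last exact: tensor_simple_coef_vanish.
have [h1 h2] := tensor_simple_coef n.
pose a : 'Hom(tmod T S N', tmod T R N') := tmap u \1%VF.
pose b : 'Hom(tmod T S X', tmod T Xr X') := tmap (eta \o u)%VF \1%VF.
have meu : mlinear (eta \o u)%VF by apply: mlinear_comp.
have beu : bijective (eta \o u)%VF.
  by apply: (eq_bij (bij_comp be bu)) => x; rewrite /= comp_lfunE.
have bid (Y : vectType k) : bijective (\1%VF : 'End(Y)) by exists id => y; rewrite id_lfunE.
have ma : mlinear a by apply: (tmap_mlinear (T := T)) => //; apply: mlinear_id.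
have mb : mlinear b by apply: (tmap_mlinear (T := T)) => //; apply: mlinear_id.
have sq (z : tmod T S N') : b ((tmap \1%VF eta' : 'Hom(tmod T S N', tmod T S X')) z) =
    (tmap eta eta' : 'Hom(tmod T R N', tmod T Xr X')) (a z).
  rewrite -!comp_lfunE; move: z; apply: lin_ext_tens => v w.
  by rewrite !comp_lfunE !tmapE !comp_lfunE !id_lfunE.
have [t1 t2] := coef_miso n (tmod T S M') ma (tmap_bij bu (bid _)) mb (tmap_bij beu (bid _)) sq.
by split; [apply: t1; apply: h1 | apply: t2; apply: h2].
Qed.

End TensorSimpleProjective.

Section TensorUnit.

Variables (k : fieldType) (A A' : falgType k) (B : {aspace A}) (B' : {aspace A'}).
Hypotheses (B1 : 1 \in B) (B1' : 1 \in B').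

Local Notation T := (tensor_sub B1 B1').
Local Notation C1 := (one_tens_sub B1 B1').

Definition tensor_unit (N : fmod (subvs_of B)) (N' : fmod (subvs_of B')) :
    'Hom(tmod T N N', tmod T (res B1 (ind_mod N)) (res B1' (ind_mod N'))) :=
  tmap (ind_unit B1 N) (ind_unit B1' N').

(** The isomorphism of [ind_tens] turns the unit for B ⊗ B' into the tensor product of the units. *)
Lemma coef_tensor_unit n N N' M :
  (coef_mono_all n.+1 (ind_unit C1 (tmod T N N')) M <-> coef_mono_all n.+1 (tensor_unit N N') M) /\
  (coef_epi_all n.+1 (ind_unit C1 (tmod T N N')) M <-> coef_epi_all n.+1 (tensor_unit N N') M).
Proof.
have [F [mF bF FE]] := ind_tens B1 B1' N N'.
pose G : 'Hom(res C1 (ind_mod (tmod T N N')), tmod T (res B1 (ind_mod N)) (res B1' (ind_mod N'))) := F.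
(* Restricting the tensor product to the subalgebra and tensoring the restrictions give the same
   action of b ⊗ b'. *)
have actE (t : tens (ind_mod N) (ind_mod N')) b b' :
    act (f := tmod (tensor_self A A') (ind_mod N) (ind_mod N')) (vsval (tm T b b')) t =
    act (f := tmod T (res B1 (ind_mod N)) (res B1' (ind_mod N'))) (tm T b b') t.
  rewrite tensor_sub_tm -[tpure _ _]/(tm (tensor_self A A') (vsval b) (vsval b')).
  move: t; apply: tens_ext => [c u v | c u v | x x'].
  - exact: (@act_linear _ _ (tmod (tensor_self A A') (ind_mod N) (ind_mod N')) _ c u v).
  - exact: (@act_linear _ _ (tmod T (res B1 (ind_mod N)) (res B1' (ind_mod N'))) _ c u v).
  by rewrite (tmod_act (tensor_self A A')) (tmod_act T).
have mG : mlinear G.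
  by apply: (tensor_mlinear (T := T)) => b b' x; rewrite res_actE [LHS]mF actE.
have GE z : G (ind_unit C1 (tmod T N N') z) = tensor_unit N N' z.
  rewrite -comp_lfunE; move: z; apply: lin_ext_tens => x x'.
  by rewrite comp_lfunE [LHS]FE tmapE.
have bid : bijective (\1%VF : 'End(tmod T N N')) by exists id => y; rewrite id_lfunE.
have [G' [mG' GK G'K]] := bij_mlinear_inv mG bF.
have bG' : bijective G' by exists G.
have sq1 z : G (ind_unit C1 (tmod T N N') z) = tensor_unit N N' (\1%VF z) by rewrite id_lfunE.
have sq2 z : G' (tensor_unit N N' z) = ind_unit C1 (tmod T N N') (\1%VF z) by rewrite id_lfunE -GE GK.
have [h1 h2] := coef_miso n M (@mlinear_id _ _ _) bid mG bF sq1.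
have [h3 h4] := coef_miso n M (@mlinear_id _ _ _) bid mG' bG' sq2.
by split; split.
Qed.

End TensorUnit.

Section CoefSwap.

Variables (k : fieldType) (B B' C : falgType k).
Variables (T : tensor_structure B B' C) (T' : tensor_structure B' B C).
Hypothesis TT' : forall b b', tm T' b' b = tm T b b'.
Variables (N X M : fmod B) (N' X' M' : fmod B') (eta : 'Hom(N, X)) (eta' : 'Hom(N', X')).

Lemma coef_swap n :
  (coef_mono_all n.+1 (tmap eta eta' : 'Hom(tmod T N N', tmod T X X')) (tmod T M M') ->
   coef_mono_all n.+1 (tmap eta' eta : 'Hom(tmod T' N' N, tmod T' X' X)) (tmod T' M' M)) /\
  (coef_epi_all n.+1 (tmap eta eta' : 'Hom(tmod T N N', tmod T X X')) (tmod T M M') ->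
   coef_epi_all n.+1 (tmap eta' eta : 'Hom(tmod T' N' N, tmod T' X' X)) (tmod T' M' M)).
Proof.
have [mN bN] := tmod_swap N N' TT'; have [mX bX] := tmod_swap X X' TT'.
have [mM bM] := tmod_swap M M' TT'.
have iM : miso (tmod T' M' M) (tmod T M M') by apply: miso_sym; exists (tswap M M').
have sq (z : tmod T N N') : (tswap X X' : 'Hom(tmod T X X', tmod T' X' X)) (tmap eta eta' z) =
    (tmap eta' eta : 'Hom(tmod T' N' N, tmod T' X' X)) (tswap N N' z).
  rewrite -[LHS]comp_lfunE -[RHS]comp_lfunE; move: z; apply: lin_ext_tens => v w.
  by rewrite !comp_lfunE !tmapE !tswapE tmapE.
have [h1 h2] := coef_miso n (tmod T M M') mN bN mX bX sq.
have dM := decomposition_miso iM.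
split=> h.
  by apply: coef_mono_all_decomposition dM _ => _; apply: h1.
by apply: coef_epi_all_decomposition dM _ => _; apply: h2.
Qed.

End CoefSwap.

(** The interface to one factor: a chosen Sim(B), the comparison maps on it, and three equivalences,
    two of them with explicit witnesses of failure. The factors then enter symmetrically and can be
    exchanged. *)
Record borel_data (k : fieldType) (A : falgType k) (I : finType) (S : I -> fmod A) (le : rel I)
    (B : {aspace A}) := BorelData {
  bd_one : 1 \in B;
  bd_J : finType;
  bd_L : bd_J -> fmod (subvs_of B);
  bd_sim : is_Sim bd_L;
  bd_cover : forall j, exists (P : fmod (subvs_of B)) (p : 'Hom(P, bd_L j)), projective_cover p;
  bd_coef : forall n a c, coef_mono_all n.+1 (ind_unit bd_one (bd_L c)) (bd_L a) /\
    coef_epi_all n.+1 (ind_unit bd_one (bd_L c)) (bd_L a);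
  bd_full : (forall a, a \in B) <-> directed S le;
  bd_not_full : ~ (forall a, a \in B) -> exists a c (F : 'Hom(bd_L a, res bd_one (ind_mod (bd_L c)))),
    [/\ a != c, mlinear F & F <> 0];
  bd_proj : (forall j, projective (bd_L j)) <-> directed (dual_Sim S) le;
  bd_not_proj : ~ (forall j, projective (bd_L j)) ->
    exists b d (P : fmod (subvs_of B)) (p : 'Hom(P, bd_L b)) (f : 'Hom(P, bd_L d)),
    [/\ d != b, projective_cover p, forall a x, p x = 0 -> f (a ∙ x) = a ∙ f x
      & forall G : 'Hom(P, res bd_one (ind_mod (bd_L d))), mlinear G ->
        ~ (forall x, p x = 0 -> ind_unit bd_one (bd_L d) (f x) = G x)];
  bd_ss : semisimple_alg A <-> (forall a, a \in B) /\ (forall j, projective (bd_L j))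
}.

Lemma borel_data_exists (k : closedFieldType) (A : falgType k) (I : finType) (S : I -> fmod A)
    (le : rel I) (B : {aspace A}) : is_Sim S -> quasi_hereditary S le ->
  regular_exact_borel B S le -> inhabited (borel_data S le B).
Proof.
move=> simS qh [[B1 pB [J [L [phi [simL bphi stL dL]]]]] reg].
have coef n a c : coef_mono_all n.+1 (ind_unit B1 (L c)) (L a) /\
    coef_epi_all n.+1 (ind_unit B1 (L c)) (L a).
  have [m e] := reg n.+1 isT; have [h1 h2] := ext_LB_pieces B1 n.
  by split; [apply: h1 | apply: h2].
have mono1 a c := proj1 (coef 0%N a c).
have full : (forall a, a \in B) <-> directed S le.
  split; first exact: (full_directed B1 qh simL bphi stL).
  by move=> dS a; apply: (directed_full simS qh simL bphi stL dL mono1).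
(* Projective L j induce projective standard modules, which give directedness of [A^c];
   [projective_of_ind] is what brings projectivity back down to [B]. *)
have proj : (forall j, projective (L j)) <-> directed (dual_Sim S) le.
  have [psi phiK psiK] := bphi.
  split=> [pL | dD j].
    apply: opposite_directed => // i D sD; rewrite -(psiK i) in sD.
    exact: (proj_miso (standard_unique (stL _) sD) (ind_projective B1 (pL _))).
  have pI := standard_projective_of_opposite simS dD (stL j).
  exact: (projective_of_ind simL pB dL mono1 pI).
have [qhL _] := dL.
constructor; apply: (@BorelData _ _ _ _ _ _ B1 J L) => //.
- exact: quasi_hereditary_cover qhL.
- move=> nB; apply: NNPP => h; apply: nB => a; apply: (unit_surj_full (B1 := B1) simL).
  apply: (unit_surj_of_hom qh simL stL dL mono1) => b c bc F mF.
  by apply: NNPP => nF; apply: h; exists b, c, F.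
- move=> np; have [b npb] : exists b, ~ projective (L b).
    by apply: NNPP => h; apply: np => j; apply: NNPP => n; apply: h; exists j.
  have [d [P [p [f [h1 h2 h3 h4]]]]] := nonprojective_ext simL dL mono1 npb.
  by exists b, d, P, p, f.
split=> [ss | [Bf pL]]; last exact: (full_projective_semisimple B1 simL Bf pL).
have sD i D : is_standard S le i D -> simple D by case/(semisimple_standard simS qh ss).
have dS : directed S le by split.
split; first exact/full.
move=> j; have [_ pI] := semisimple_standard simS qh ss (stL j).
exact: (projective_of_ind simL pB dL mono1 pI).
Qed.

(** * The comparison maps for the tensor product and the final equivalence *)

Section Main.

Variables (k : closedFieldType) (A A' : falgType k) (I I' : finType).
Variables (S : I -> fmod A) (S' : I' -> fmod A') (le : rel I) (le' : rel I').
Variables (B : {aspace A}) (B' : {aspace A'}).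
Variables (D : borel_data S le B) (D' : borel_data S' le' B').

Local Notation B1 := (bd_one D).
Local Notation B1' := (bd_one D').
Local Notation L := (@bd_L _ _ _ _ _ _ D).
Local Notation L' := (@bd_L _ _ _ _ _ _ D').
Local Notation T := (tensor_sub B1 B1').
Local Notation C1 := (one_tens_sub B1 B1').

Let sL j : simple (L j). Proof. by case: (bd_sim D). Qed.
Let sL' j : simple (L' j). Proof. by case: (bd_sim D'). Qed.

Lemma tensor_epi_pieces : ext_LB_epi (tens_aspace B B') 1 ->
  forall a b c d, coef_epi_all 1 (tensor_unit B1 B1' (L c) (L' d)) (tmod T (L a) (L' b)).
Proof.
move=> epi a b c d; apply/(coef_tensor_unit B1 B1' 0 (L c) (L' d) _).2.
have [_ h] := ext_LB_pieces C1 0.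
exact: (h epi _ (tensor_Sim T L L') (tensor_is_Sim T (bd_sim D) (bd_sim D')) (a, b) (c, d)).
Qed.

Lemma regular_of_pieces :
  (forall n a b c d, coef_mono_all n.+1 (tensor_unit B1 B1' (L c) (L' d)) (tmod T (L a) (L' b)) /\
     coef_epi_all n.+1 (tensor_unit B1 B1' (L c) (L' d)) (tmod T (L a) (L' b))) ->
  forall n, (1 <= n)%N -> ext_LB_mono (tens_aspace B B') n /\ ext_LB_epi (tens_aspace B B') n.
Proof.
move=> h [//|n] _; have [h1 h2] := pieces_ext_LB C1 n.
have [_ _ cT] := tensor_is_Sim T (bd_sim D) (bd_sim D').
split; [apply: h1 | apply: h2] => M N sM sN.
  have [[a b] iM] := cT M sM; have [[c d] iN] := cT N sN.
  apply: coef_mono_all_decomposition (decomposition_miso iM) _ => _.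
  apply: (coef_ind_decomposition C1 n _ (decomposition_miso iN)).1 => _.
  by apply/(coef_tensor_unit B1 B1' n (L c) (L' d) _).1; have [] := h n a b c d.
have [[a b] iM] := cT M sM; have [[c d] iN] := cT N sN.
apply: coef_epi_all_decomposition (decomposition_miso iM) _ => _.
apply: (coef_ind_decomposition C1 n _ (decomposition_miso iN)).2 => _.
by apply/(coef_tensor_unit B1 B1' n (L c) (L' d) _).2; have [] := h n a b c d.
Qed.

End Main.

(** The tensor structure is arbitrary so that the lemma also applies to the same algebra seen as B'
    ⊗ B. *)
Lemma full_or_projective (k : closedFieldType) (A A' : falgType k) (I I' : finType)
    (S : I -> fmod A) (S' : I' -> fmod A') (le : rel I) (le' : rel I')
    (B : {aspace A}) (B' : {aspace A'}) (C : falgType k) (D : borel_data S le B) (D' : borel_data S' le' B')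
    (T : tensor_structure (subvs_of B) (subvs_of B') C) :
  (forall a b c d, coef_epi_all 1 (tmap (ind_unit (bd_one D) (@bd_L _ _ _ _ _ _ D c)) (ind_unit (bd_one D') (@bd_L _ _ _ _ _ _ D' d)) :
      'Hom(tmod T _ _, tmod T (res (bd_one D) (ind_mod _)) (res (bd_one D') (ind_mod _)))) (tmod T (@bd_L _ _ _ _ _ _ D a) (@bd_L _ _ _ _ _ _ D' b))) ->
  (forall a, a \in B) \/ (forall j, projective (@bd_L _ _ _ _ _ _ D' j)).
Proof.
move=> epi; apply: NNPP => /not_or_and[nB nP].
have [a [c [F [ac mF nF]]]] := bd_not_full D nB.
have [b [d [P' [p' [f [db cp' mf nG]]]]]] := bd_not_proj nP.
have [P [p cp]] := bd_cover a.
have [pP mp _ _] := cp; have [pP' mp' _ _] := cp'.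
have noP (g : 'Hom(P, @bd_L _ _ _ _ _ _ D c)) : mlinear g -> g = 0.
  by move=> mg; apply: NNPP => ng; case/eqP: ac; apply: (cover_hom_Sim (bd_sim D) cp mg ng).
have noP' (g : 'Hom(P', @bd_L _ _ _ _ _ _ D' d)) : mlinear g -> g = 0.
  by move=> mg; apply: NNPP => ng; case/eqP: db; apply/esym/(cover_hom_Sim (bd_sim D') cp' mg ng).
apply: (tensor_not_epi (T := T) pP pP' mp mp' (cover_surj cp) (cover_surj cp') _ noP noP' mF nF mf nG).
  exact: ind_unit_mlinear.
exact: epi.
Qed.

Theorem proposition3p4 (k : closedFieldType) (A A' : falgType k)
    (I I' : finType) (S : I -> fmod A) (S' : I' -> fmod A')
    (le : rel I) (le' : rel I') (B : {aspace A}) (B' : {aspace A'}) :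
  is_Sim S -> is_Sim S' ->
  quasi_hereditary S le -> quasi_hereditary S' le' ->
  regular_exact_borel B S le -> regular_exact_borel B' S' le' ->
  [<-> regular_exact_borel (tens_aspace B B') (prod_Sim S S') (prod_rel le le');
       homological_exact_borel (tens_aspace B B') (prod_Sim S S') (prod_rel le le');
       [\/ directed S le /\ directed S' le',
           directed (dual_Sim S) le /\ directed (dual_Sim S') le',
           semisimple_alg A
         | semisimple_alg A']].
Proof.
move=> simS simS' qh qh' reg reg'.
have [D] := borel_data_exists simS qh reg; have [D'] := borel_data_exists simS' qh' reg'.
have exB := exact_borel_tensor simS simS' qh qh' (proj1 reg) (proj1 reg').
pose T := tensor_sub (bd_one D) (bd_one D').
have sw (b : subvs_of B) (b' : subvs_of B') : tm (tensor_swap T) b' b = tm T b b' by [].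
tfae.
- by case=> eb h; split=> // [|n n2]; [have [] := h 1%N isT | apply: h; apply: ltnW].
- case=> _ epi1 _; have epi := tensor_epi_pieces (D := D) (D' := D') epi1.
  have c1 := full_or_projective (T := T) epi.
  have c2 : (forall a, a \in B') \/ (forall j, projective (@bd_L _ _ _ _ _ _ D j)).
    apply: (full_or_projective (D := D') (D' := D) (T := tensor_swap T)) => a b c d.
    have [_ s2] := coef_swap sw (bd_L b) (bd_L a) (ind_unit (bd_one D) (bd_L d))
      (ind_unit (bd_one D') (bd_L c)) 0.
    exact: s2 (epi b a d c).
  (* Of the four combinations of [c1] and [c2], the two mixed ones put fullness and projectivity on
     the same factor, which is then semisimple. *)
  case: c1 => [/(bd_full D) dS | /(bd_proj D') dD'].
    case: c2 => [/(bd_full D') dS' | /(bd_proj D) dD]; first by constructor 1.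
    by constructor 3; apply/(bd_ss D); split; [apply/(bd_full D) | apply/(bd_proj D)].
  case: c2 => [/(bd_full D') dS' | /(bd_proj D) dD]; last by constructor 2.
  by constructor 4; apply/(bd_ss D'); split; [apply/(bd_full D') | apply/(bd_proj D')].
move=> cond; split=> //; apply: (regular_of_pieces (D := D) (D' := D')) => n a b c d.
have sL j : simple (@bd_L _ _ _ _ _ _ D j) by case: (bd_sim D).
have sL' j : simple (@bd_L _ _ _ _ _ _ D' j) by case: (bd_sim D').
have mu j := @ind_unit_mlinear _ _ _ (bd_one D) (@bd_L _ _ _ _ _ _ D j).
have mu' j := @ind_unit_mlinear _ _ _ (bd_one D') (@bd_L _ _ _ _ _ _ D' j).
have [m e] := bd_coef (b := D) n a c; have [m' e'] := bd_coef (b := D') n b d.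
case: cond => [[/(bd_full D) f /(bd_full D') f'] | [/(bd_proj D) p /(bd_proj D') p'] | /(bd_ss D)[f p] | /(bd_ss D')[f' p']].
- apply: coef_bijective; first exact: tmap_mlinear.
  by apply: tmap_bij; apply: full_unit_bij.
- by apply: coef_projective; apply: tmod_projective; [apply: p | apply: p'].
- apply: tensor_simple_projective_coef => //.
  exact: full_unit_bij.
(* Semisimplicity of A' is the previous case with the factors exchanged, carried back by the
   swap. *)
have [h1 h2] := tensor_simple_projective_coef (tensor_swap T) (sL' b) (p' b)
  (sL' d) (full_unit_bij (bd_one D') f' _) (mu' d) m e.
have sw' (b' : subvs_of B') (b0 : subvs_of B) : tm T b0 b' = tm (tensor_swap T) b' b0 by [].
have [s1 s2] := coef_swap sw' (bd_L b) (bd_L a) (ind_unit (bd_one D') (bd_L d))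
  (ind_unit (bd_one D) (bd_L c)) n.
by split; [exact: s1 h1 | exact: s2 h2].
Qed.
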